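(* Let $p$ be a prime, let $G$ be a finite $p$-solvable group, let $Q$ be a $p$-subgroup of $G$, and let $\delta$ be a linear character of $Q$. Suppose $\delta$ is stable in $G$, i.e. $\delta(x)=\delta(y)$ whenever $x,y\in Q$ are conjugate in $G$. Then the map $\chi\mapsto\chi^0$ (restriction to the $p$-regular elements of $G$) is a bijection from $\operatorname{Irr}(G|Q,\delta)$ onto $\operatorname{IBr}_p(G|Q)$.
   Context: All groups are finite. $\operatorname{IBr}_p(G|Q)$ is the set of irreducible $p$-Brauer characters of $G$ having $Q$ as a (Green) vertex. For a character $\chi$, $\chi^0$ denotes its restriction to the set of $p$-regular elements. Set $\pi=p'$ (all primes except $p$). An irreducible character $\chi$ of a $\pi$-separable group $H$ is $\pi$-special if $\chi(1)$ is a $\pi$-number and for every subnormal subgroup $S$ of $H$ the determinantal order of every irreducible constituent of $\chi_S$ is a $\pi$-number; $\chi$ is $\pi$-factored if $\chi=\alpha\beta$ with $\alpha$ $\pi$-special and $\beta$ $\pi'$-special; these factors are uniquely determined and denoted $\chi_\pi,\chi_{\pi'}$. Normal nucleus: for $\chi\in\operatorname{Irr}(G)$ there is a unique largest normal subgroup $N$ of $G$ such that every irreducible constituent of $\chi_N$ is $\pi$-factored. If $\chi$ is $\pi$-factored, the normal nucleus of $\chi$ is $(G,\chi)$. Otherwise, for an irreducible constituent $\theta$ of $\chi_N$, $\theta$ is not $G$-invariant, and one lets $\chi_\theta\in\operatorname{Irr}(G_\theta)$ be the Clifford correspondent of $\chi$ over $\theta$ ($G_\theta$ the inertia group); a normal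 nucleus of $\chi$ is then any normal nucleus of $\chi_\theta$ (recursively). A normal nucleus $(W,\gamma)$ is determined up to $G$-conjugacy, with $\gamma\in\operatorname{Irr}(W)$ $\pi$-factored. If $Q$ is a Hall $\pi'$-subgroup of $W$ (here a Sylow $p$-subgroup) and $\delta=(\gamma_{\pi'})_Q$, then $(Q,\delta)$ is a Navarro vertex of $\chi$. $\operatorname{Irr}(G|Q,\delta)$ is the set of $\chi\in\operatorname{Irr}(G)$ having $(Q,\delta)$ as a Navarro vertex. *)

(* Defs.v *)
From HB Require Import structures.
From mathcomp Require Import all_boot all_order all_algebra all_fingroup all_solvable.
From mathcomp Require Import all_field all_character.

Set Implicit Arguments.
Unset Strict Implicit.
Unset Printing Implicit Defensive.

Import GRing.Theory Num.Theory.
Local Open Scope ring_scope.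

Definition p_solvable (gT : finGroupType) (p : nat) (G : {group gT}) : Prop :=
  exists s : seq {group gT},
    path (fun H K : {group gT} =>
            (H <| K)%g && (p.-nat (#|K : H|)%g || p^'.-nat (#|K : H|)%g)) 1%G s
    /\ last 1%G s = G.

Definition pres (gT : finGroupType) (p : nat) (f : gT -> algC) : gT -> algC :=
  fun x => if (p^'.-elt x)%g then f x else 0.

(* Brauer characters.  F is an algebraically closed field of characteristic  *)
(* p, and lam is a fixed identification of the p'-roots of unity of F with   *)
(* (the p'-roots of unity of) algC: an injective multiplicative map on them. *)
Definition p'_unity_root (F : fieldType) (p : nat) (z : F) : Prop :=
  exists n : nat, [/\ (0 < n)%N, ~~ (p %| n)%N & z ^+ n = 1].

Definition brauer_lift (F : fieldType) (p : nat) (lam : F -> algC) : Prop :=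
  (forall z w, p'_unity_root p z -> p'_unity_root p w ->
     lam (z * w) = lam z * lam w) /\
  (forall z w, p'_unity_root p z -> p'_unity_root p w ->
     lam z = lam w -> z = w).

Definition roots_list (F : closedFieldType) (q : {poly F}) : seq F :=
  sval (closed_field_poly_normal q).

Definition brauer_val (F : closedFieldType) (lam : F -> algC)
    (gT : finGroupType) (G : {group gT}) (n : nat)
    (rG : mx_representation F G n) (x : gT) : algC :=
  \sum_(z <- roots_list (char_poly (rG x))) lam z.

Definition affords_brauer (F : closedFieldType) (p : nat) (lam : F -> algC)
    (gT : finGroupType) (G : {group gT}) (n : nat)
    (rG : mx_representation F G n) (phi : gT -> algC) : Prop :=
  forall x : gT,
    phi x = if (x \in G) && (p^'.-elt x)%g then brauer_val lam rG x else 0.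

(* Relative H-projectivity (Higman's criterion): there is an FH-endomorphism *)
(* A of the module whose relative trace Tr_H^G(A) is the identity.  Modules  *)
(* are row modules (v |-> v *m rG g), so the trace runs over a right         *)
(* transversal t of H in G: Tr_H^G(A) = sum_t rG(t^-1) A rG(t).              *)
Definition rel_proj (F : fieldType) (gT : finGroupType) (G : {group gT})
    (n : nat) (rG : mx_representation F G n) (H : {group gT}) : Prop :=
  (H \subset G)%g /\
  exists A : 'M[F]_n,
    (forall h, h \in H -> A *m rG h = rG h *m A) /\
    \sum_(t in transversal (rcosets H G) G) (rG (t^-1)%g *m A *m rG t)
      = 1%:M.

Definition is_vertex (F : fieldType) (gT : finGroupType) (G : {group gT})
    (n : nat) (rG : mx_representation F G n) (Q : {group gT}) : Prop :=
  rel_proj rG Q /\ forall R : {group gT}, (R \proper Q)%g -> ~ rel_proj rG R.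

Definition IBr_vertex (F : closedFieldType) (p : nat) (lam : F -> algC)
    (gT : finGroupType) (G Q : {group gT}) (phi : gT -> algC) : Prop :=
  exists (n : nat) (rG : mx_representation F G n),
    [/\ mx_irreducible rG, affords_brauer p lam rG phi & is_vertex rG Q].

Definition pi_special (pi : nat_pred) (gT : finGroupType) (H : {group gT})
    (chi : 'CF(H)) : Prop :=
  [/\ chi \in irr H,
      exists m : nat, pi.-nat m /\ chi 1%g = m%:R &
      forall S : {group gT}, (S <|<| H)%g ->
        forall i : Iirr S, i \in irr_constt ('Res[S] chi) ->
          pi.-nat ('o('chi_i))%CF].

(* chi = alpha * beta with alpha pi-special and beta pi'-special; beta is    *)
(* then the (unique) pi'-factor chi_{pi'} of chi.                            *)
Definition pi_factor (pi : nat_pred) (gT : finGroupType) (H : {group gT})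
    (chi beta : 'CF(H)) : Prop :=
  exists alpha : 'CF(H),
    [/\ pi_special pi alpha, pi_special pi^' beta & chi = alpha * beta].

Definition pi_factored (pi : nat_pred) (gT : finGroupType) (H : {group gT})
    (chi : 'CF(H)) : Prop :=
  chi \in irr H /\ exists beta : 'CF(H), pi_factor pi chi beta.

Definition constt_factored (pi : nat_pred) (gT : finGroupType)
    (G N : {group gT}) (chi : 'CF(G)) : Prop :=
  forall i : Iirr N, i \in irr_constt ('Res[N] chi) -> pi_factored pi 'chi_i.

Inductive normal_nucleus (pi : nat_pred) (gT : finGroupType) :
    forall G : {group gT}, 'CF(G) -> forall W : {group gT}, 'CF(W) -> Prop :=
| NNucleus_factored (G : {group gT}) (chi : 'CF(G)) :
    pi_factored pi chi -> normal_nucleus pi chi chi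
| NNucleus_step (G N : {group gT}) (chi : 'CF(G)) (t : Iirr N)
    (psi : 'CF(('I_G['chi_t])%G)) (W : {group gT}) (gamma : 'CF(W)) :
    chi \in irr G -> ~ pi_factored pi chi ->
    (N <| G)%g -> constt_factored pi N chi ->
    (forall M : {group gT}, (M <| G)%g -> constt_factored pi M chi ->
       (M \subset N)%g) ->
    t \in irr_constt ('Res[N] chi) ->
    psi \in irr ('I_G['chi_t])%G -> '['Res[N] psi, 'chi_t] != 0 ->
    'Ind[G] psi = chi ->
    normal_nucleus pi psi gamma -> normal_nucleus pi chi gamma.

Definition navarro_vertex (p : nat) (gT : finGroupType) (G : {group gT})
    (chi : 'CF(G)) (Q : {group gT}) (delta : 'CF(Q)) : Prop :=
  exists (W : {group gT}) (gamma : 'CF(W)),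
    [/\ normal_nucleus p^' chi gamma, (p.-Sylow(W) Q)%g &
        exists beta : 'CF(W), pi_factor p^' gamma beta /\ delta = 'Res[Q] beta].

Arguments navarro_vertex p {gT G} chi Q delta.
Arguments IBr_vertex {F} p lam {gT} G Q phi.
Arguments pres {gT} p f _.

(* Main.v *)
Require Import Defs.
From HB Require Import structures.
From mathcomp Require Import all_boot all_order all_algebra all_fingroup all_solvable.
From mathcomp Require Import all_field all_character.
From mathcomp Require finmodule.
From mathcomp Require boolp classical_sets.

(** A p'-special character stays irreducible on a Hall p'-subgroup, hence also
    modulo p, and reduction modulo p is a bijection from the p'-special characters
    onto the irreducible modular representations of dimension prime to p.
    A stable delta has, on every subgroup K such that some conjugate of Q meets K
    in a Sylow p-subgroup, a canonical linear extension mu_K (by the focal subgroup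
    theorem, proved with the transfer); it is trivial on p-regular elements and
    invariant under conjugation.  So chi has Navarro vertex (Q, delta) exactly when
    its nucleus is alpha * mu_W with alpha p'-special and Q Sylow in W.

    For such a chi the normal subgroup N of a nucleus step is the largest one for
    which Q :&: N is Sylow in N, and the characters of N below chi are the
    alpha * mu_N with alpha p'-special.  The inertia groups of alpha * mu_N, of alpha
    and of the reduction of alpha agree, so the Clifford correspondence before and
    after reduction is the same, and it preserves vertices; this gives the
    irreducibility of the reduction, its vertex, and, by induction, injectivity.
    Conversely an irreducible modular M is lifted by taking N maximal normal with a
    constituent of M of dimension prime to p: if N is proper its stabilizer is
    proper, and one inducts; that N is also the subgroup of the nucleus step of the
    resulting character follows by comparing both sides on a chief layer above N.

    Reduction modulo p of a representation over algC is done with a place from algC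
    to F extending lam on roots of unity (Zorn's lemma on partial homomorphisms). *)

Set Implicit Arguments.
Unset Strict Implicit.
Unset Printing Implicit Defensive.

Import GRing.Theory Num.Theory.
Local Open Scope ring_scope.

(** * Places *)

(** Inductions descend to inertia groups, where the relevant Sylow subgroup is only a conjugate [R]
    of [Q]. So everything below the theorem is stated for subgroups of one ambient group [G0], with
    [delta] stable in [G0] and [R] ranging over [conjQ]; stability is thus inherited for free.
    Modules in characteristic p are not semisimple, and vertices are given only by Higman's
    criterion. Two devices replace the structure theory. A composition factor is recognised by
    annihilators in the group algebra ([constt_repr]), and by density a single element of the group
    algebra acts at will on pairwise dissimilar irreducibles. A vertex is read off from an
    endomorphism of nonzero trace whose relative trace is 1 ([vertex_source]); it exists because the
    modules concerned are induced from modules of dimension prime to p. Induced modules are never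
    built: the module lying over a Clifford correspondent is found among the composition factors of
    the reduction of an induced character, by comparing dimensions. Reduction fixes only Brauer
    characters, so [reduces] is a relation between a character and a module, not a function. *)

Section SubringType.
Variables (S : comNzRingType) (A : {pred S}) (subA : subring_closed A).

(* A locked-up alias, so that the closure instance is not attached to every predicate. *)
Definition subring_pred : {pred S} := let _ := subA in A.
HB.instance Definition _ := GRing.isSubringClosed.Build S subring_pred subA.

Record subring_type := SubringElt {subring_val : S; _ : subring_val \in subring_pred}.

HB.instance Definition _ := [isSub for subring_val].
HB.instance Definition _ := [Choice of subring_type by <:].
HB.instance Definition _ := [SubChoice_isSubComNzRing of subring_type by <:].

(** Turns a subring given by a predicate into a ring with an embedding, so that a partial
    homomorphism can be handled as a pair of ring morphisms out of one ring. *)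
Lemma subring_type_exists :
  exists (V : comNzRingType) (f : {rmorphism V -> S}),
    [/\ injective f, forall v, f v \in A & forall x, x \in A -> exists v, f v = x].
Proof.
exists (subring_type : comNzRingType), (val : {rmorphism subring_type -> S}).
split=> [|v|x Ax]; [exact: val_inj | exact: valP |].
by exists (SubringElt Ax).
Qed.
End SubringType.

Section Places.
Variables (K : fieldType) (F : closedFieldType).
Local Notation S := (K * F)%type.
Implicit Types (A : S -> Prop) (P : {poly S}).

(** The graph of a ring homomorphism from a subring of [K] to [F]; [fsub_fun] is single-valuedness,
    which for an additive subgroup need only be asked at 0. *)
Record functional_subring A : Prop := FunctionalSubring {
  fsub1 : A 1;
  fsubB : forall a b, A a -> A b -> A (a - b);
  fsubM : forall a b, A a -> A b -> A (a * b);
  fsub_fun : forall y, A (0, y) -> y = 0 }.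

Section Theory.
Variables (A : S -> Prop) (fA : functional_subring A).
Let A0 : A 0. Proof. by rewrite -(subrr 1); apply: fsubB; case: fA. Qed.
Let AN a : A a -> A (- a). Proof. by rewrite -sub0r; apply: fsubB. Qed.
Let AD a b : A a -> A b -> A (a + b).
Proof. by move=> Aa Ab; rewrite -[b]opprK; apply: fsubB => //; apply: AN. Qed.
Let AX a n : A a -> A (a ^+ n).
Proof.
move=> Aa; elim: n => [|n IH]; first by rewrite expr0; apply: fsub1.
by rewrite exprS; apply: fsubM.
Qed.
Let Asum I (r : seq I) (Q : pred I) E :
  (forall i, Q i -> A (E i)) -> A (\sum_(i <- r | Q i) E i).
Proof. by move=> AE; apply: (big_ind A) => //; apply: AD. Qed.

Let over P := forall i, A P`_i.
Let over1 : over 1.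
Proof. by move=> i; rewrite coef1; case: (i == 0)%N; rewrite ?mulr0n //; apply: fsub1. Qed.
Let overB P Q : over P -> over Q -> over (P - Q).
Proof. by move=> oP oQ i; rewrite coefB; apply: fsubB. Qed.
Let overM P Q : over P -> over Q -> over (P * Q).
Proof. by move=> oP oQ i; rewrite coefM; apply: Asum => j _; apply: fsubM. Qed.
Let overC c : A c -> over c%:P.
Proof. by move=> Ac i; rewrite coefC; case: ifP. Qed.
Let overXn n : over 'X^n.
Proof. by move=> i; rewrite coefXn; case: (i == n); rewrite ?mulr0n //; apply: fsub1. Qed.

(** Extending a partial homomorphism to [s.1] with value [s.2] is consistent exactly when every
    polynomial over [A] that kills [s.1] has an image that kills [s.2]. *)
Lemma functional_subring_adjoin s :
    (forall P, over P -> P.[s].1 = 0 -> P.[s].2 = 0) ->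
  functional_subring (fun a => exists2 P, over P & a = P.[s]).
Proof.
move=> fun_s; split.
- by exists 1; rewrite ?hornerC.
- by move=> _ _ [P oP ->] [Q oQ ->]; exists (P - Q); rewrite ?hornerD ?hornerN //; apply: overB.
- by move=> _ _ [P oP ->] [Q oQ ->]; exists (P * Q); rewrite ?hornerM //; apply: overM.
- by move=> y [P oP defy]; have := fun_s P oP; rewrite -defy; apply.
Qed.

Hypothesis maxA : forall B, functional_subring B ->
  (forall a, A a -> B a) -> forall a, B a -> A a.

Let adjoin_in s : (forall P, over P -> P.[s].1 = 0 -> P.[s].2 = 0) -> A s.
Proof.
move=> fun_s; apply: (maxA (functional_subring_adjoin fun_s)) => [a Aa|].
  by exists a%:P; rewrite ?hornerC //; apply: overC.
by exists 'X; rewrite ?hornerX // -['X]expr1; apply: overXn.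
Qed.

(** Maximality makes the domain a local ring: an element with nonzero image has its inverse in the
    domain. *)
Let Ainv a b : A (a, b) -> b != 0 -> A (a^-1, b^-1).
Proof.
move=> Aab nzb.
have nza: a != 0 by apply: contraNneq nzb => a0; move: Aab; rewrite a0 => /(fsub_fun fA) ->.
apply: adjoin_in => P oP /eqP P0; apply/eqP; move: P0.
(* Clearing denominators turns the value of [P] at the inverse into an element of [A], where
   single-valuedness applies. *)
pose c := P.[(a^-1, b^-1)] * (a, b) ^+ size P.
have Ac : A c.
  rewrite /c horner_coef mulr_suml; apply: Asum => i _; rewrite -mulrA; apply: fsubM => //.
  suff ->: (a^-1, b^-1) ^+ i * (a, b) ^+ size P = (a, b) ^+ (size P - i) :> S.
    exact: AX.
  have lti := ltn_ord i; move: (size P) (nat_of_ord i) lti => n j /ltnW lejn.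
  rewrite -{1}(subnKC lejn) exprD mulrA -exprMn.
  by rewrite [_ * (a, b)](_ : _ = 1) ?expr1n ?mul1r //; congr (_, _); rewrite /= mulVf.
have c1 : c.1 = P.[(a^-1, b^-1)].1 * a ^+ size P.
  by rewrite /c /=; congr (_ * _); rewrite (rmorphXn (@fst K F)).
have c2 : c.2 = P.[(a^-1, b^-1)].2 * b ^+ size P.
  by rewrite /c /=; congr (_ * _); rewrite (rmorphXn (@snd K F)).
move=> /eqP P0; have: c = (0, c.2) by rewrite [LHS]surjective_pairing c1 P0 mul0r.
move=> defc; rewrite defc in Ac; have /eqP := fsub_fun fA Ac.
by rewrite c2 mulf_eq0 expf_eq0 (negPf nzb) andbF orbF.
Qed.

Let p1 (P : {poly S}) : {poly K} := map_poly (@fst K F) P.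
Let p2 (P : {poly S}) : {poly F} := map_poly (@snd K F) P.
Let p1E P x y : P.[(x, y)].1 = (p1 P).[x].
Proof. exact: (esym (horner_map (@fst K F) P (x, y))). Qed.
Let p2E P x y : P.[(x, y)].2 = (p2 P).[y].
Proof. exact: (esym (horner_map (@snd K F) P (x, y))). Qed.

Let p2CX c e : p2 (c%:P * 'X^e) = c.2 *: 'X^e.
Proof. by rewrite /p2 rmorphM /= map_polyC map_polyXn mul_polyC. Qed.

(** [P] is 1 plus a polynomial with coefficients in the maximal ideal: a relation says that this
    ideal becomes the unit ideal once [x] is adjoined. *)
Let relation x P := [/\ over P, (p1 P).[x] = 0 & p2 P = 1].

(** The polynomials over [A] killing [x] reduce to an ideal of [F[X]]. A common root [y] would allow
    [(x, y)] to be adjoined; since [F] is closed, a generator without roots is constant, so the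
    ideal contains 1. *)
Let relation_exists x : (forall y, ~ A (x, y)) -> exists P, relation x P.
Proof.
move=> notAx; pose I P := over P /\ (p1 P).[x] = 0.
have escape y : exists2 P, I P & (p2 P).[y] != 0.
  apply: boolp.contrapT => noP; apply: (notAx y); apply: adjoin_in => P oP.
  rewrite p1E p2E => Px0; apply: boolp.contrapT => /eqP nz.
  by apply: noP; exists P.
pose Im m := boolp.asbool (exists2 P, I P & (p2 P != 0) && (size (p2 P) == m)).
have exIm : exists m, Im m.
  have [P IP nzP] := escape 0; exists (size (p2 P)); apply/boolp.asboolP.
  by exists P => //; rewrite eqxx andbT; apply: contraNneq nzP => ->; rewrite horner0.
case: (ex_minnP exIm) => m /boolp.asboolP[P IP /andP[nzP /eqP szP]] minm.
have{minm} minI Q : I Q -> (size (p2 Q) < m)%N -> p2 Q = 0.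
  move=> IQ; case: (eqVneq (p2 Q) 0) => // nzQ.
  by rewrite ltnNge minm //; apply/boolp.asboolP; exists Q => //; rewrite nzQ eqxx.
have{P nzP szP IP} [P [IP szP monP]] :
    exists P, [/\ I P, size (p2 P) = m & p2 P \is monic].
  have nzl : lead_coef (p2 P) != 0 by rewrite lead_coef_eq0.
  have Al : A (P`_m.-1) by case: IP.
  have l2 : (P`_m.-1).2 = lead_coef (p2 P) by rewrite lead_coefE szP coef_map.
  have AlV : A ((P`_m.-1).1^-1, (P`_m.-1).2^-1).
    by apply: Ainv; [case: (P`_m.-1) Al | rewrite l2].
  pose d : S := ((P`_m.-1).1^-1, (P`_m.-1).2^-1).
  have p2dP : p2 (d%:P * P) = (lead_coef (p2 P))^-1 *: p2 P.
    by rewrite /p2 rmorphM /= map_polyC /= l2 mul_polyC.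
  exists (d%:P * P); rewrite p2dP size_scale ?invr_eq0 //; split=> //.
    case: IP => oP P0; split; first by apply: overM => //; apply: overC.
    by rewrite /p1 rmorphM hornerM [_.[x] in X in _ * X]P0 mulr0.
  by rewrite monicE lead_coefZ mulVf.
have [sz1 | sz1] := eqVneq (size (p2 P)) 1%N.
  exists P; case: IP => oP P0; split=> //.
  move/monicP: monP; rewrite lead_coefE sz1 /= => P1.
  by rewrite (size1_polyC (eq_leq sz1)) P1.
have /closed_rootP[y Py0] := sz1.
suff Iy0 Q : I Q -> (p2 Q).[y] = 0.
  by have [Q IQ] := escape y; rewrite Iy0 ?eqxx.
have [k] := ubnP (size (p2 Q)); elim: k => // k IHk in Q *; rewrite ltnS => szQ IQ.
have [/(minI _ IQ)-> | lemQ] := ltnP (size (p2 Q)) m; first by rewrite horner0.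
have nzQ : p2 Q != 0.
  rewrite -size_poly_gt0 (leq_trans _ lemQ) // -szP size_poly_gt0.
  exact: monic_neq0.
pose c := Q`_(size (p2 Q)).-1; pose e := (size (p2 Q) - m)%N.
pose R := Q - c%:P * 'X^e * P.
have p2R : p2 R = p2 Q - lead_coef (p2 Q) *: ('X^e * p2 P).
  rewrite /p2 /R rmorphB !rmorphM /= map_polyC map_polyXn -mul_polyC mulrA /=.
  by rewrite lead_coefE coef_map.
have IR : I R.
  case: IQ IP => oQ Q0 [oP P0]; split.
    by apply: overB => //; apply: overM => //; apply: overM => //; apply/overC/oQ.
  by rewrite /p1 /R rmorphB !rmorphM /= hornerD hornerN hornerM [X in X - _]Q0 [X in _ * X]P0 mulr0 subr0.
have szR : (size (p2 R) < size (p2 Q))%N.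
  have nzl : lead_coef (p2 Q) != 0 by rewrite lead_coef_eq0.
  have szXP : size (lead_coef (p2 Q) *: ('X^e * p2 P)) = size (p2 Q).
    rewrite size_scale // mulrC size_mulXn ?monic_neq0 // szP.
    by rewrite subnK.
  rewrite -[X in (_ < X)%N]prednK ?size_poly_gt0 // ltnS; apply/leq_sizeP => j.
  rewrite leq_eqVlt => /predU1P[<-| ltj]; rewrite p2R coefB.
    have -> : (lead_coef (p2 Q) *: ('X^e * p2 P))`_(size (p2 Q)).-1 = lead_coef (p2 Q).
      rewrite -szXP -lead_coefE lead_coefZ lead_coef_Mmonic // lead_coefXn mulr1.
      by [].
    by rewrite -lead_coefE subrr.
  rewrite prednK ?size_poly_gt0 // in ltj.
  by rewrite !nth_default ?subr0 // szXP.
have := IHk R (leq_trans szR szQ) IR; rewrite p2R hornerD hornerN hornerZ hornerM.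
by rewrite (rootP Py0) !mulr0 subr0.
Qed.

(* Subtract from a degree-n relation for x a multiple of the reversed         *)
(* relation for x^-1, whose leading coefficient is a unit of A.               *)
Let relation_shorten x P Q : x != 0 -> relation x P -> relation x^-1 Q ->
  (size Q <= size P)%N -> exists2 P', relation x P' & (size P' < size P)%N.
Proof.
move=> nzx [oP P0 P1] [oQ Q0 Q1] leQP.
have szP : (0 < size P)%N.
  by rewrite size_poly_gt0; apply: contra_eq_neq P1 => ->; rewrite /p2 rmorph0 eq_sym oner_neq0.
have Q02 : (Q`_0).2 = 1 by rewrite -(coef_map (@snd K F)) [map_poly _ _]Q1 coef1.
have AV : A ((Q`_0).1^-1, 1).
  by rewrite -[1]invr1 -Q02; apply: Ainv; [case: (Q`_0) (oQ 0%N) | rewrite Q02 oner_neq0].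
pose k := (size Q).-1; have szQ : (0 < size Q)%N.
  by rewrite size_poly_gt0; apply: contra_eq_neq Q1 => ->; rewrite /p2 rmorph0 eq_sym oner_neq0.
have Q2 j : (Q`_j).2 = (j == 0%N)%:R.
  by rewrite -(coef_map (@snd K F)) [map_poly _ _]Q1 coef1.
have P2 j : (P`_j).2 = (j == 0%N)%:R.
  by rewrite -(coef_map (@snd K F)) [map_poly _ _]P1 coef1.
have lejk (j : 'I_(size Q)) : (j <= k)%N by rewrite -ltnS /k prednK.
pose B : {poly S} := \sum_(j < size Q) (Q`_j)%:P * 'X^(k - j).
have oB : over B.
  move=> i; rewrite coef_sum; apply: Asum => j _; by apply: overM => //; apply/overC/oQ.
have B0 : (p1 B).[x] = 0.
  have -> : (p1 B).[x] = x ^+ k * (p1 Q).[x^-1]; last by rewrite Q0 mulr0.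
  rewrite [(p1 Q).[_]](@horner_coef_wide _ (size Q)) ?size_poly // mulr_sumr.
  rewrite /p1 /B rmorph_sum horner_sum; apply: eq_bigr => j _.
  rewrite rmorphM /= map_polyC map_polyXn hornerM hornerC hornerXn coef_map /=.
  by rewrite mulrCA exprVn -expfB_cond ?(negPf nzx) // lejk.
have Bk : B`_k = Q`_0.
  rewrite coef_sum (bigD1 (Ordinal szQ)) //= subn0 coefCM coefXn eqxx mulr1.
  rewrite big1 ?addr0 // => j nzj; rewrite coefCM coefXn.
  suff /negPf->: k != (k - j)%N by rewrite mulr0.
  rewrite neq_ltn orbC ltn_subrL; apply/orP; left; apply/andP; split.
    by rewrite lt0n; apply: contraNneq nzj => j0; apply/eqP/val_inj.
  by apply: leq_trans (lejk j); rewrite lt0n; apply: contraNneq nzj => j0; apply/eqP/val_inj.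
have szB : (size B <= k.+1)%N.
  apply/leq_sizeP => j ltkj; rewrite coef_sum big1 // => i _.
  rewrite coefCM coefXn (_ : (j == _) = false) ?mulr0 //.
  by rewrite gtn_eqF // (leq_ltn_trans (leq_subr _ _)).
have B2 : p2 B = 'X^k.
  have ->: p2 B = \sum_(j < size Q) p2 ((Q`_j)%:P * 'X^(k - j)) by rewrite /p2 rmorph_sum.
  rewrite (bigD1 (Ordinal szQ)) //= big1 ?addr0 => [|j nzj].
    by rewrite p2CX Q2 eqxx scale1r subn0.
  rewrite p2CX Q2 (_ : (_ == _) = false) ?scale0r //.
  by apply/negbTE; apply: contraNneq nzj => j0; apply/eqP/val_inj.
pose n := (size P).-1; have szPn : size P = n.+1 by rewrite prednK.
(* A constant relation would put [(0, 1)] in [A]. *)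
have nz_n : n != 0%N.
  apply/eqP => n0; have defP : P = (P`_0)%:P by apply: size1_polyC; rewrite szPn n0.
  move: P0; rewrite defP /p1 map_polyC hornerC /= => P01.
  have := oP 0%N; rewrite [P`_0]surjective_pairing P01 P2 eqxx => /(fsub_fun fA)/eqP.
  by rewrite oner_eq0.
pose d : S := ((Q`_0).1^-1, 1).
have dQ : d * Q`_0 = 1.
  have nzQ : (Q`_0).1 != 0.
    apply/eqP => Q01; have := oQ 0%N; rewrite [Q`_0]surjective_pairing Q01 Q2 eqxx.
    by move/(fsub_fun fA)/eqP; rewrite oner_eq0.
  by congr (_, _); rewrite /= ?mulVf // Q2 mul1r.
have lekn : (k <= n)%N by rewrite -ltnS -szPn /k prednK.
pose P' := P - (P`_n * d)%:P * 'X^(n - k) * B.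
exists P'; last first.
  rewrite szPn ltnS; apply/leq_sizeP => j; rewrite leq_eqVlt => /predU1P[<-|ltj].
    rewrite coefB -mulrA coefCM coefXnM ltnNge leq_subr /= subKn // Bk -mulrA dQ.
    by rewrite mulr1 subrr.
  rewrite coefB [P`_j]nth_default ?szPn // -mulrA coefCM coefXnM ltnNge.
  rewrite (leq_trans (leq_subr _ _) (ltnW ltj)) /= [B`__]nth_default ?mulr0 ?subr0 //.
  by rewrite (leq_trans szB) // ltn_subRL subnK.
split.
- by apply: overB => //; apply: overM => //; apply: overM => //; apply: overC; apply: fsubM; [|apply: oP|].
- by rewrite /p1 /P' rmorphB !rmorphM hornerD hornerN hornerM [X in X - _]P0 [X in _ * X]B0 mulr0 subr0.
by rewrite /p2 /P' rmorphB !rmorphM /= map_polyC /= P2 (negPf nz_n) mul0r !mul0r subr0.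
Qed.

(** Chevalley's argument: if neither [x] nor its inverse is in the domain, both have relations, and
    the longer one can always be shortened, which cannot go on forever. *)
Lemma maximal_functional_subring_total x :
  (exists y, A (x, y)) \/ (exists y, A (x^-1, y)).
Proof.
have [-> | nzx] := eqVneq x 0; first by left; exists 0; apply: A0.
apply: boolp.contrapT => /boolp.not_orP[nAx nAxV].
have [P RP] := relation_exists (fun y Axy => nAx (ex_intro _ y Axy)).
have [Q RQ] := relation_exists (fun y Axy => nAxV (ex_intro _ y Axy)).
have [m] := ubnP (size P + size Q)%N; elim: m => // m IHm in P Q RP RQ *.
rewrite ltnS => leszm; have [leQP | /ltnW lePQ] := leqP (size Q) (size P).
  have [P' RP' ltP'] := relation_shorten nzx RP RQ leQP.
  by apply: (IHm P' Q) => //; apply: leq_trans leszm; rewrite ltn_add2r.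
have nzxV : x^-1 != 0 by rewrite invr_eq0.
have [|Q' RQ' ltQ'] := relation_shorten nzxV RQ _ lePQ; first by rewrite invrK.
by apply: (IHm P Q') => //; apply: leq_trans leszm; rewrite ltn_add2l.
Qed.
End Theory.

Lemma place_exists (A0 : S -> Prop) : functional_subring A0 ->
  exists (V : comNzRingType) (f : {rmorphism V -> K}) (rho : {rmorphism V -> F}),
    [/\ injective f, forall x, exists v, f v = x \/ f v = x^-1
      & forall x y, A0 (x, y) -> exists2 v, f v = x & rho v = y].
Proof.
move=> fA0; pose good (B : classical_sets.set S) :=
  functional_subring B /\ (forall s, A0 s -> B s).
have [C CF totC|A [[A_0|[fA sA0A]] maxA]] := @classical_sets.Zorn_bigcup _ (fun B => (forall s, ~ B s) \/ good B).
- have [[B CB [s Bs]]|noB] := boolp.pselect (exists2 B, C B & exists s, B s).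
    have gB B' s' : C B' -> B' s' -> good B'.
      by move=> CB' B's'; case: (CF _ CB') => [/(_ s')/(_ B's')|].
    have [fB sA0B] := gB B s CB Bs.
    right; split=> [|s' /sA0B Bs']; last by exists B.
    have chain a b : (exists2 B, C B & B a) -> (exists2 B, C B & B b) ->
        exists B, [/\ C B, B a & B b].
      case=> B1 CB1 B1a [B2 CB2 B2b]; case: (totC _ _ CB1 CB2) => sB12.
        by exists B2; split=> //; apply: sB12.
      by exists B1; split=> //; apply: sB12.
    split=> [|a b|a b|y].
    - by exists B => //; apply: fsub1.
    - move=> Ua Ub; have [B1 [CB1 Ba Bb]] := chain a b Ua Ub; exists B1 => //.
      by have [fB1 _] := gB _ _ CB1 Ba; apply: fsubB.
    - move=> Ua Ub; have [B1 [CB1 Ba Bb]] := chain a b Ua Ub; exists B1 => //.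
      by have [fB1 _] := gB _ _ CB1 Ba; apply: fsubM.
    case=> B1 CB1 B1y; have [fB1 _] := gB _ _ CB1 B1y; exact: fsub_fun B1y.
  by left=> s [B CB Bs]; apply: noB; exists B => //; exists s.
- exfalso; apply: (maxA A0); last by right; split.
  split=> [s /A_0//|]; move/(_ 1 (fsub1 fA0)); exact: A_0.
have{}maxA B : functional_subring B -> (forall a, A a -> B a) -> forall a, B a -> A a.
  move=> fB sAB a Ba; apply: boolp.contrapT => nAa.
  apply: (maxA B); last by right; split=> // s /sA0A/sAB.
  by split=> // sBA; apply/nAa/sBA.
pose Ab : {pred S} := fun s => boolp.asbool (A s).
have subA : subring_closed Ab.
  by split=> [|a b|a b]; rewrite ?inE; [|move=> /boolp.asboolP Aa /boolp.asboolP Ab'..]; apply/boolp.asboolP; [apply: fsub1|apply: fsubB|apply: fsubM].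
have [V [g [inj_g Ag g_onto]]] := subring_type_exists subA.
exists V, (@fst K F \o g : {rmorphism V -> K}), (@snd K F \o g : {rmorphism V -> F}).
split=> [u v /= eq_uv|x|x y /sA0A Axy].
- apply/inj_g/eqP; rewrite -subr_eq0 -rmorphB; apply/eqP.
  have /boolp.asboolP := Ag (u - v); rewrite rmorphB [g u - g v]surjective_pairing /=.
  by rewrite eq_uv subrr => /(fsub_fun fA)->.
- have [[y Axy]|[y Axy]] := maximal_functional_subring_total fA maxA x.
    by have [|v defv] := g_onto (x, y); [apply/boolp.asboolP | exists v; left; rewrite /= defv].
  by have [|v defv] := g_onto (x^-1, y); [apply/boolp.asboolP | exists v; right; rewrite /= defv].
by have [|v defv] := g_onto (x, y); [apply/boolp.asboolP | exists v; rewrite /= defv].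
Qed.
End Places.

(** * Roots of unity in characteristic p and a place with a prescribed value at one of them *)

Section RootsOfUnity.
Variables (F : closedFieldType) (p : nat).
Hypotheses (p_pr : prime p) (pF : p \in [pchar F]).

Lemma closed_prim_root n : (0 < n)%N -> ~~ (p %| n)%N ->
  exists z : F, n.-primitive_root z.
Proof.
move=> n_gt0 p'n; have nzn : n%:R != 0 :> F by rewrite -(dvdn_pcharf pF).
have [r defr] := closed_field_poly_normal ('X^n - 1 : {poly F}).
have monXn : ('X^n - 1 : {poly F}) \is monic by rewrite monicXnsubC.
rewrite (monicP monXn) scale1r in defr.
have szr : size r = n.
  by apply: succn_inj; rewrite -(size_prod_XsubC r id) -defr size_XnsubC.
have ur : uniq r.
  by rewrite -separable_prod_XsubC -defr; apply: separable_Xn_sub_1.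
have /hasP[z _ prim_z] : has n.-primitive_root r.
  apply: has_prim_root => //; last by rewrite szr.
  by apply/allP=> z rz; rewrite /root_of_unity defr root_prod_XsubC.
by exists z.
Qed.

(** [X^n - 1] is the product of the cyclotomic polynomials of the divisors of n; a factor of index
    [d] that vanishes at [w] forces [w ^+ d = 1], hence [d = n]. *)
Lemma Cyclotomic_root n (w : F) : n.-primitive_root w ->
  root (map_poly intr 'Phi_n) w.
Proof.
move=> prim_w; have n_gt0 := prim_order_gt0 prim_w.
have: root (map_poly intr ('X^n - 1)) w.
  by rewrite rmorphB /= map_polyXn rmorph1 /root !hornerE (prim_expr_order prim_w) subrr.
rewrite -prod_Cyclotomic // rmorph_prod /root horner_prod prodf_seq_eq0.
case/hasP=> d; rewrite -dvdn_divisors // => dv_d_n /= Phid0.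
suff /eqP<-: d == n by [].
rewrite eqn_dvd dv_d_n (prim_order_dvd prim_w) -subr_eq0.
have d_gt0 := dvdn_gt0 n_gt0 dv_d_n.
have ->: w ^+ d - 1 = (map_poly intr ('X^d - 1)).[w].
  by rewrite rmorphB /= map_polyXn rmorph1 !hornerE.
rewrite -prod_Cyclotomic // (big_rem d) -?dvdn_divisors //= rmorphM hornerM.
by rewrite (eqP Phid0) mul0r.
Qed.

(** The place extends the map from the integer polynomials in [z] to those in [w]. That map is well
    defined because every integer relation of [z] is a multiple of the monic polynomial ['Phi_n],
    which also kills [w]. *)
Lemma cyclotomic_place n (z : algC) (w : F) :
  n.-primitive_root z -> n.-primitive_root w ->
  exists (V : comNzRingType) (f : {rmorphism V -> algC}) (rho : {rmorphism V -> F}),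
    [/\ injective f, forall x, exists v, f v = x \/ f v = x^-1
      & exists2 v, f v = z & rho v = w].
Proof.
move=> prim_z prim_w; pose s : algC * F := (z, w).
pose A a := exists P : {poly int}, a = (map_poly intr P).[s].
suff /place_exists[V [f [rho [inj_f totV Vs]]]] : functional_subring A.
  exists V, f, rho; split=> //; apply: Vs; exists 'X.
  by rewrite map_polyX hornerX.
split.
- by exists 1; rewrite rmorph1 hornerC.
- by move=> _ _ [P ->] [Q ->]; exists (P - Q); rewrite rmorphB hornerD hornerN.
- by move=> _ _ [P ->] [Q ->]; exists (P * Q); rewrite rmorphM hornerM.
move=> y [P defy].
have Pz : root (map_poly (intr : int -> algC) P) z.
  have /(congr1 (@fst _ _)) := defy; rewrite -[s]/(s) -(horner_map (@fst algC F)) /= => /esym/eqP.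
  rewrite -map_poly_comp (eq_map_poly (g := intr)) // => i /=.
  exact: (rmorph_int (@fst algC F)).
have Pw : y = (map_poly intr P).[w].
  have /(congr1 (@snd _ _)) := defy; rewrite -(horner_map (@snd algC F)) /= => ->.
  rewrite -map_poly_comp (eq_map_poly (g := intr)) // => i /=.
  exact: (rmorph_int (@snd algC F)).
have monPhi : 'Phi_n \is monic := Cyclotomic_monic n.
have defP := Pdiv.RingMonic.rdivp_eq monPhi P.
set R := Pdiv.Ring.rmodp P _ in defP; set Q := Pdiv.Ring.rdivp P _ in defP.
have PhiC := Cintr_Cyclotomic prim_z.
have Phiz : root (map_poly (intr : int -> algC) 'Phi_n) z.
  by rewrite PhiC root_cyclotomic.
have Rz : root (map_poly (intr : int -> algC) R) z.
  move: Pz; rewrite defP rmorphD rmorphM /root hornerD hornerM.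
  by rewrite [X in _ * X](eqP Phiz) mulr0 add0r.
(* The remainder vanishes at [z] but has smaller degree than the minimal polynomial of [z], which is
   ['Phi_n]. *)
have R0 : R = 0.
  have [q [defq mon_q] q_dv] := minCpolyP z.
  have: q %| map_poly intr R.
    rewrite -q_dv -map_poly_comp (eq_map_poly (g := intr)) // => i /=; exact: rmorph_int.
  have szq : size q = size ('Phi_n).
    rewrite -(size_map_poly (ratr : {rmorphism rat -> algC})) -defq (minCpoly_cyclotomic prim_z).
    by rewrite -PhiC size_map_inj_poly //; apply: intr_inj.
  move/dvdp_leq=> leqR; apply/eqP; apply: contraLR (Pdiv.Ring.ltn_rmodpN0 P (monic_neq0 monPhi)) => nzR.
  rewrite -leqNgt -szq -(@size_map_inj_poly _ _ (intr : int -> rat)) ?leqR //.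
    by rewrite map_poly_eq0_id0 // intr_eq0 lead_coef_eq0.
  exact: intr_inj.
by rewrite Pw defP R0 addr0 rmorphM hornerM (rootP (Cyclotomic_root prim_w)) mulr0.
Qed.
End RootsOfUnity.

(** * Reduction modulo p *)

Lemma char_poly_conj (R : comUnitRingType) n (A B B' : 'M[R]_n) :
  B' *m B = 1%:M -> char_poly (B *m A *m B') = char_poly A.
Proof.
move=> B'B; have BB' := mulmx1C B'B.
rewrite /char_poly; set P := map_mx polyC B; set P' := map_mx polyC B'.
have PP' : P *m P' = 1%:M by rewrite -map_mxM BB' map_mx1.
have -> : char_poly_mx (B *m A *m B') = P *m char_poly_mx A *m P'.
  rewrite /char_poly_mx mulmxBr mulmxBl !map_mxM; congr (_ - _).
  by rewrite scalar_mxC -mulmxA PP' mulmx1.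
by rewrite !det_mulmx mulrAC -det_mulmx PP' det1 mul1r.
Qed.

Lemma brauer_val_roots (F : closedFieldType) (lam : F -> algC) (gT : finGroupType)
    (G : {group gT}) n (rG : mx_representation F G n) x (s : seq F) :
  char_poly (rG x) = \prod_(z <- s) ('X - z%:P) ->
  brauer_val lam rG x = \sum_(z <- s) lam z.
Proof.
rewrite /brauer_val /roots_list; case: closed_field_poly_normal => r /= defr defs.
rewrite (monicP (char_poly_monic _)) scale1r in defr.
by apply: perm_big; apply: prod_XsubC_eq; rewrite -defr.
Qed.

Definition brauer_setup (F : fieldType) (p : nat) (lam : F -> algC) :=
  [/\ prime p, p \in [pchar F] & brauer_lift p lam].

Section Reduction.
Variables (F : closedFieldType) (p : nat) (lam : F -> algC).
Hypothesis setup : brauer_setup p lam.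

Let p_pr : prime p. Proof. by case: setup. Qed.
Let pF : p \in [pchar F]. Proof. by case: setup. Qed.
Let lamM : forall z w, p'_unity_root p z -> p'_unity_root p w -> lam (z * w) = lam z * lam w.
Proof. by case: setup => _ _ []. Qed.
Let lam_inj : forall z w, p'_unity_root p z -> p'_unity_root p w -> lam z = lam w -> z = w.
Proof. by case: setup => _ _ []. Qed.

Lemma p'_unity_root1 : p'_unity_root p (1 : F).
Proof. by exists 1%N; rewrite expr1n dvdn1 gtn_eqF ?prime_gt1. Qed.

(** [lam 1] is idempotent, so 0 or 1; if it were 0, multiplicativity would make [lam] vanish on all
    p'-roots of unity, against injectivity. *)
Lemma lam1 : lam 1 = 1.
Proof.
(* Some number above 1 and prime to p, so that [F] has a p'-root of unity other than 1. *)
pose q := (if p == 2 then 3 else 2)%N.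
have [q_gt0 p'q q_gt1] : [/\ (0 < q)%N, ~~ (p %| q)%N & (1 < q)%N].
  rewrite /q; case: eqP => [-> // | /eqP np2]; split=> //.
  by rewrite dvdn_prime2.
have [z prim_z] := closed_prim_root pF q_gt0 p'q.
have zq : p'_unity_root p z by exists q; rewrite prim_expr_order.
have /eqP := lamM p'_unity_root1 p'_unity_root1; rewrite mulr1 -subr_eq0.
rewrite -{1}[lam 1]mulr1 -mulrBr mulf_eq0 subr_eq0 => /orP[/eqP lam0|/eqP <- //].
have lamz : lam z = lam 1 by rewrite -[z]mulr1 lamM ?lam0 ?mulr0 //; apply: p'_unity_root1.
have z1 := lam_inj zq p'_unity_root1 lamz.
have := eq_prim_root_expr prim_z 1 0; rewrite z1 !expr1n eqxx => /esym.
by rewrite eqn_mod_dvd // subn0 dvdn1 => /eqP q1; rewrite q1 in q_gt1.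
Qed.

Lemma lamX z k : p'_unity_root p z -> lam (z ^+ k) = lam z ^+ k.
Proof.
move=> zp; elim: k => [|k IHk]; first by rewrite !expr0 lam1.
rewrite !exprS lamM ?IHk //; case: zp => n [n_gt0 p'n zn]; exists n; split=> //.
by rewrite exprAC zn expr1n.
Qed.

Lemma lam_prim_root n : (0 < n)%N -> ~~ (p %| n)%N ->
  exists2 w : F, n.-primitive_root w & n.-primitive_root (lam w).
Proof.
move=> n_gt0 p'n; have [w prim_w] := closed_prim_root pF n_gt0 p'n; exists w => //.
have wp : p'_unity_root p w by exists n; rewrite prim_expr_order.
have wXp k : p'_unity_root p (w ^+ k).
  by exists n; split=> //; rewrite exprAC (prim_expr_order prim_w) expr1n.
apply/andP; split=> //; apply/forallP=> i; rewrite unity_rootE -lamX // -lam1.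
rewrite (_ : (lam _ == _) = (w ^+ i.+1 == 1)).
  by have /andP[_ /forallP/(_ i)] := prim_w; rewrite unity_rootE.
by apply/eqP/eqP=> [/lam_inj->|->] //; apply: p'_unity_root1.
Qed.

Section Rep.
Variables (gT : finGroupType) (G : {group gT}) (d : nat).
Variable rG : mx_representation algC G d.

Section Place.
Variables (V : comNzRingType) (f : {rmorphism V -> algC}) (rho : {rmorphism V -> F}).
Hypotheses (inj_f : injective f) (totV : forall x, exists v, f v = x \/ f v = x^-1).

Let inV x := exists v, f v = x.

(** In a valuation ring divisibility is total, so among finitely many nonzero elements one divides
    all the others over [V]. *)
Let inV_max (T : eqType) (D : T -> algC) (s : seq T) :
  s != [::] -> {in s, forall t, D t != 0} ->
  exists2 t, t \in s & {in s, forall t', inV (D t' / D t)}.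
Proof.
elim: s => // t s IHs _ nzD.
have [->|nzs] := eqVneq s [::].
  exists t; rewrite ?mem_seq1 // => t'; rewrite mem_seq1 => /eqP->.
  by exists 1; rewrite rmorph1 divff // nzD ?mem_head.
have [|t0 st0 maxt0] := IHs nzs; first by move=> t' st'; rewrite nzD ?in_cons ?st' ?orbT.
have nzDt0 : D t0 != 0 by rewrite nzD ?in_cons ?st0 ?orbT.
have nzDt : D t != 0 by rewrite nzD ?mem_head.
have [v [defv|defv]] := totV (D t / D t0).
  exists t0; first by rewrite in_cons st0 orbT.
  by move=> t'; rewrite in_cons => /predU1P[->|/maxt0//]; exists v.
exists t; first exact: mem_head.
move=> t'; rewrite in_cons => /predU1P[->|/maxt0[v' defv']].
  by exists 1; rewrite rmorph1 divff.
by exists (v' * v); rewrite rmorphM defv' defv invf_div mulrA divfK.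
Qed.

(** The valuation ring [V] need not be principal, so a basis of an invariant lattice is found by
    hand: among the d-tuples of rows of the matrices [rG g], take one whose determinant divides all
    the others. By Cramer's rule the coordinates of any translate in this basis are quotients of two
    such determinants. *)
Lemma rep_integral_form : exists2 C : 'M[algC]_d, C \in unitmx &
  exists A : gT -> 'M[V]_d, {in G, forall x, map_mx f (A x) = C *m rG x *m invmx C}.
Proof.
pose T := {ffun 'I_d -> subg_of G * 'I_d}.
pose M (h : T) : 'M[algC]_d := \matrix_i row (h i).2 (rG (sgval (h i).1)).
have [] := @inV_max T (fun h => \det (M h)) [seq h <- enum T | \det (M h) != 0].
- have: [ffun i => (subg G 1, i)] \in [seq h <- enum T | \det (M h) != 0].
    rewrite mem_filter mem_enum andbT (_ : M _ = 1%:M) ?det1 ?oner_eq0 //.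
    by apply/row_matrixP=> i; rewrite rowK ffunE /= subgK ?group1 // repr_mx1.
  by case: [seq _ <- _ | _].
- by move=> h; rewrite mem_filter => /andP[].
move=> h0; rewrite mem_filter => /andP[nzM _] maxM.
have uM : M h0 \in unitmx by rewrite unitmxE unitfE.
exists (M h0) => //.
(* A row of [rG g] times [rG x] is a row of [rG (g * x)], so replacing the k-th member of the tuple
   by the translate of the i-th gives another tuple of the same kind. *)
have cramer x i k : x \in G -> inV ((M h0 *m rG x *m invmx (M h0)) i k).
  move=> Gx; pose r := (M h0 *m rG x).
  have Gh : (sgval (h0 i).1 * x)%g \in G by rewrite groupM ?subgP.
  pose h1 : T := [ffun l => if l == k then (subg G (sgval (h0 i).1 * x), (h0 i).2) else h0 l].
  have rowk : row k (M h1) = row i r.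
    by rewrite row_mul !rowK ffunE eqxx /= subgK // repr_mxM ?subgP // row_mul.
  have ->: (r *m invmx (M h0)) i k = \det (M h1) / \det (M h0).
    rewrite /invmx uM -scalemxAr mxE mulrC; congr (_ * _).
    rewrite (expand_det_row _ k) mxE; apply: eq_bigr => j _.
    have -> : M h1 k j = r i j by have /rowP/(_ j) := rowk; rewrite !mxE.
    congr (_ * _); rewrite [(\adj _) j k]mxE /cofactor; congr (_ * \det _).
    by apply/matrixP=> a b; rewrite !mxE ffunE eq_sym (negPf (neq_lift _ _)).
  have [D0|nzD] := eqVneq (\det (M h1)) 0; first by exists 0; rewrite rmorph0 D0 mul0r.
  by apply: maxM; rewrite mem_filter nzD mem_enum.
have exA (x : gT) : exists A : 'M[V]_d, x \in G -> map_mx f A = M h0 *m rG x *m invmx (M h0).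
  have [Gx|] := boolP (x \in G); last by exists 0.
  have [a Da] := fin_all_exists (fun ik => cramer x ik.1 ik.2 Gx).
  by exists (\matrix_(i, k) a (i, k)) => _; apply/matrixP=> i k; rewrite !mxE Da mxE.
by have [A DA] := fin_all_exists exA; exists A => x Gx; apply: DA.
Qed.

Lemma rep_residue : exists2 C : 'M[algC]_d, C \in unitmx &
  exists (A : gT -> 'M[V]_d) (rF : mx_representation F G d),
  {in G, forall x, rF x = map_mx rho (A x) /\ map_mx f (A x) = C *m rG x *m invmx C}.
Proof.
have [C uC [A DA]] := rep_integral_form; exists C => //; exists A.
have inj_mf m n : injective (map_mx f : 'M_(m, n) -> 'M_(m, n)).
  by move=> B1 B2 /matrixP eqB; apply/matrixP=> i j; apply: inj_f; have := eqB i j; rewrite !mxE.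
have A1 : A 1%g = 1%:M.
  by apply: inj_mf; rewrite DA // repr_mx1 mulmx1 mulmxV // map_mx1.
have AM : {in G &, forall x y, A (x * y)%g = A x *m A y}.
  move=> x y Gx Gy; apply: inj_mf; rewrite map_mxM !DA ?groupM // repr_mxM //.
  by rewrite !mulmxA mulmxKV.
have rF_repr : mx_repr G (fun x => map_mx rho (A x)).
  by split=> [|x y Gx Gy]; rewrite ?A1 ?map_mx1 // AM // map_mxM.
by exists (MxRepresentation rF_repr) => x Gx; split=> //; apply: DA.
Qed.
End Place.

(** Irreducibility does not survive reduction in general, so identities over [V] that do descend are
    recorded instead. The vanishing of traces serves the regular representation; the averaging
    identity is the Schur relation with [k = #|G| / d], which keeps p'-groups irreducible. The place
    is chosen for the p'-part of the order, so that it undoes [lam] on all eigenvalues of p-regular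
    elements. *)
Lemma rep_reduction : exists rF : mx_representation F G d,
  {in G, forall x, p^'.-elt%g x -> brauer_val lam rF x = \tr (rG x)} /\
  {in G, forall x, \tr (rG x) = 0 -> \tr (rF x) = 0} /\
  forall k : nat,
    (forall X, \sum_(x in G) rG x^-1%g *m X *m rG x = (k%:R * \tr X)%:M) ->
    forall X, \sum_(x in G) rF x^-1%g *m X *m rF x = (k%:R * \tr X)%:M.
Proof.
pose n := (#|G|`_p^')%N.
have n_gt0 : (0 < n)%N by rewrite part_gt0.
have p'n : ~~ (p %| n)%N by rewrite -p'natE ?part_pnat.
have [w prim_w prim_z] := lam_prim_root n_gt0 p'n.
have [V [f [rho [inj_f totV [v fv rv]]]]] := cyclotomic_place prim_z prim_w.
have wp : p'_unity_root p w by exists n; rewrite prim_expr_order.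
have [C uC [A [rF rFP]]] := rep_residue rho inj_f totV.
have inj_mf m1 m2 : injective (map_mx f : 'M_(m1, m2) -> 'M_(m1, m2)).
  by move=> B1 B2 /matrixP eqB; apply/matrixP=> i j; apply: inj_f; have := eqB i j; rewrite !mxE.
exists rF; split=> [x Gx|]; last split=> [x Gx tr0|k schur X].
- have [rFx Ax'] := rFP x Gx.
  have Ax : map_poly f (char_poly (A x)) = char_poly (rG x).
    by rewrite map_char_poly -(char_poly_conj (rG x) (mulVmx uC)) -Ax'.
  move=> p'x; have [e [[B uB defx] [e1 _] [_ _] _]] := repr_rsim_diag rG Gx.
  have ex i : exists k, e 0 i = lam w ^+ k.
    have en : e 0 i ^+ n = 1.
      have /dvdnP[c ->] : (#[x]%g %| n)%N.
        by rewrite /n -(part_pnat_id p'x) partn_dvd // order_dvdG.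
      by rewrite mulnC exprM e1 expr1n.
    have [k defk] := prim_rootP prim_z en; by exists k.
  have [k defk] := fin_all_exists ex.
  have cpx : char_poly (rG x) = \prod_(i < d) ('X - (e 0 i)%:P).
    rewrite defx char_poly_conj; last by rewrite mulmxV.
    rewrite char_poly_trig ?diag_mx_is_trig //.
    by apply: eq_bigr => i _; rewrite mxE eqxx.
  have cpA : char_poly (A x) = \prod_(i < d) ('X - (v ^+ k i)%:P).
    apply: (map_inj_poly inj_f (rmorph0 f)); rewrite Ax cpx rmorph_prod.
    by apply: eq_bigr => i _; rewrite rmorphB /= map_polyX map_polyC /= rmorphXn fv defk.
  have cpF : char_poly (rF x) = \prod_(z <- [seq w ^+ k i | i : 'I_d]) ('X - z%:P).
    rewrite big_image rFx -map_char_poly cpA rmorph_prod.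
    by apply: eq_bigr => i _; rewrite rmorphB /= map_polyX map_polyC /= rmorphXn rv.
  rewrite (brauer_val_roots lam cpF) big_image /= defx mxtrace_mulC mulmxA mulmxV //.
  by rewrite mul1mx mxtrace_diag; apply: eq_bigr => i _; rewrite lamX // defk.
- have [rFx Ax] := rFP x Gx; rewrite rFx trace_map_mx; suff ->: \tr (A x) = 0 by rewrite rmorph0.
  by apply: inj_f; rewrite rmorph0 -trace_map_mx Ax mxtrace_mulC mulmxA mulVmx // mul1mx.
(* Elementary matrices have entries in [V], so the identity descends for them; the general case
   follows by linearity over [F]. *)
have schurE i j : \sum_(x in G) rF x^-1%g *m delta_mx i j *m rF x = (k%:R * (i == j)%:R)%:M.
  have : \sum_(x in G) A x^-1%g *m delta_mx i j *m A x = (k%:R * (i == j)%:R)%:M.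
    apply: inj_mf; rewrite raddf_sum map_scalar_mx rmorphM !rmorph_nat.
    rewrite (eq_bigr (fun x => C *m (rG x^-1%g *m (invmx C *m delta_mx i j *m C) *m rG x) *m invmx C)).
      rewrite -mulmx_suml -mulmx_sumr schur mul_mx_scalar -scalemxAl mulmxV //.
      rewrite -mulmxA mxtrace_mulC -mulmxA mulmxV // mulmx1 scalemx1.
      by congr (_ * _)%:M; rewrite /mxtrace (bigD1 i) //= !mxE eqxx big1 ?addr0 // => l /negPf nl; rewrite mxE nl.
    move=> x Gx; rewrite -[LHS]/(map_mx f (A x^-1%g *m delta_mx i j *m A x)) !map_mxM map_delta_mx.
    have [_ ->] := rFP x Gx; have [_ ->] := rFP x^-1%g (groupVr Gx).
    by rewrite !mulmxA.
  move=> /(congr1 (map_mx rho)); rewrite raddf_sum map_scalar_mx rmorphM !rmorph_nat => <-.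
  apply: eq_bigr => x Gx; rewrite -[RHS]/(map_mx rho (A x^-1%g *m delta_mx i j *m A x)) !map_mxM map_delta_mx.
  by have [-> _] := rFP x Gx; have [-> _] := rFP x^-1%g (groupVr Gx).
rewrite [in LHS](matrix_sum_delta X).
rewrite (eq_bigr (fun x => \sum_i \sum_j X i j *: (rF x^-1%g *m delta_mx i j *m rF x))) => [|x _]; last first.
  rewrite mulmx_sumr mulmx_suml; apply: eq_bigr => i _; rewrite mulmx_sumr mulmx_suml.
  by apply: eq_bigr => j _; rewrite -scalemxAr -scalemxAl.
rewrite exchange_big /=; apply: etrans (_ : \sum_i (k%:R * X i i)%:M = _).
  apply: eq_bigr => i _; rewrite exchange_big /= (bigD1 i) //= [X in _ + X]big1 ?addr0 => [|j nj].
    by rewrite -scaler_sumr schurE eqxx mulr1 scale_scalar_mx mulrC.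
  by rewrite -scaler_sumr schurE eq_sym (negPf nj) mulr0 scale_scalar_mx mulr0 -scalemx1 scale0r.
by rewrite -raddf_sum -mulr_sumr.
Qed.
End Rep.
End Reduction.

(** * Irreducible representations over algebraically closed fields *)

Lemma char_poly_conj_rect (R : comUnitRingType) m n (A : 'M[R]_n) (B : 'M[R]_(m, n)) B' :
  m = n -> B' *m B = 1%:M -> char_poly (B *m A *m B') = char_poly A.
Proof. by move=> eq_mn; case: _ / eq_mn A B B' => A B B'; apply: char_poly_conj. Qed.

Lemma char_poly_lblock (R : comNzRingType) m n (A : 'M[R]_m) (C : 'M[R]_(n, m)) (D : 'M[R]_n) :
  char_poly (block_mx A 0 C D) = char_poly A * char_poly D.
Proof.
rewrite /char_poly -(det_lblock _ (- map_mx polyC C)); congr (\det _).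
rewrite /char_poly_mx map_block_mx scalar_mx_block opp_block_mx add_block_mx.
by rewrite map_mx0 subr0 add0r.
Qed.

Lemma mul_delta_mx_delta (R : pzRingType) m n q r (A : 'M[R]_(m, n)) (k : 'I_q) i j (l : 'I_r) :
  delta_mx k i *m A *m delta_mx j l = A i j *: delta_mx k l.
Proof.
have dA : delta_mx k i *m A = \matrix_(a, b) ((a == k)%:R * A i b).
  apply/matrixP=> a b; rewrite !mxE (bigD1 i) //= big1 ?addr0 => [|c neq].
    by rewrite mxE eqxx andbT.
  by rewrite mxE (negPf neq) andbF mul0r.
apply/matrixP=> a b; rewrite dA !mxE (bigD1 j) //= big1 ?addr0 => [|c neq].
  by rewrite !mxE eqxx; do 2!case: eqP; rewrite ?(mul1r, mul0r, mulr1, mulr0).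
by rewrite !mxE (negPf neq) mulr0.
Qed.

Section FieldReps.
Variables (F : fieldType) (gT : finGroupType) (G : {group gT}).
Local Notation aG := (regular_repr F G).
Local Notation ev rG := (gring_mx rG).

Lemma gring_mxE n (rG : mx_representation F G n) a :
  ev rG a = \sum_i a 0 i *: rG (enum_val i).
Proof.
rewrite /gring_mx /= mulmx_sum_row linear_sum; apply: eq_bigr => i _.
by rewrite linearZ /= rowK mxvecK.
Qed.

Lemma gring_mxG n (rG : mx_representation F G n) x : x \in G ->
  ev rG (gring_row (aG x)) = rG x.
Proof. by move=> Gx; rewrite -(gring_opG rG Gx). Qed.

Lemma gring_mx_sum n (rG : mx_representation F G n) I (r : seq I) (P : pred I) E :
  ev rG (\sum_(i <- r | P i) E i) = \sum_(i <- r | P i) ev rG (E i).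
Proof. exact: linear_sum. Qed.

Lemma gring_mxB n (rG : mx_representation F G n) a b : ev rG (a - b) = ev rG a - ev rG b.
Proof. exact: linearB. Qed.

Lemma gring_mxZ n (rG : mx_representation F G n) c a : ev rG (c *: a) = c *: ev rG a.
Proof. exact: linearZ. Qed.

Lemma gring_mx1 n (rG : mx_representation F G n) : ev rG (gring_row 1%:M) = 1%:M.
Proof. exact: gring_op1. Qed.

Lemma rsim_gring_mx n1 n2 (r1 : mx_representation F G n1) (r2 : mx_representation F G n2) a :
  mx_rsim r1 r2 -> (ev r1 a == 0) = (ev r2 a == 0).
Proof.
case=> B eqn; case: _ / eqn r2 B => r2 B freeB homB.
have uB: B \in unitmx by rewrite -row_free_unit.
have evB: ev r1 a *m B = B *m ev r2 a.
  rewrite !gring_mxE mulmx_suml mulmx_sumr; apply: eq_bigr => i _.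
  by rewrite -scalemxAl homB ?enum_valP // scalemxAr.
apply/eqP/eqP=> ev0; first by rewrite -[RHS](mulmx0 _ (invmx B)) -(mul0mx _ B) -ev0 evB mulKmx.
by apply: (can_inj (mulmxK uB)); rewrite evB ev0 mulmx0 mul0mx.
Qed.

Lemma gring_mx_submod n (rG : mx_representation F G n) U (modU : mxmodule rG U) a :
  ev (submod_repr modU) a = in_submod U (val_submod 1%:M *m ev rG a).
Proof.
rewrite !gring_mxE mulmx_sumr linear_sum; apply: eq_bigr => i _.
by rewrite -scalemxAr linearZ.
Qed.

Lemma gring_mx_factmod n (rG : mx_representation F G n) U (modU : mxmodule rG U) a :
  ev (factmod_repr modU) a = in_factmod U (val_factmod 1%:M *m ev rG a).
Proof.
rewrite !gring_mxE mulmx_sumr linear_sum; apply: eq_bigr => i _.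
by rewrite -scalemxAr linearZ.
Qed.

Lemma char_poly_sub_fact_mod n (rG : mx_representation F G n) U (modU : mxmodule rG U) x :
  x \in G -> char_poly (rG x) =
    char_poly (submod_repr modU x) * char_poly (factmod_repr modU x).
Proof.
move=> Gx; pose B := col_mx (val_submod (1%:M : 'M_(\rank U))) (val_factmod (1%:M : 'M_(\rank (cokermx U)))).
pose B' := row_mx (in_submod U (1%:M : 'M_n)) (in_factmod U (1%:M : 'M_n)).
have B'B : B' *m B = 1%:M.
  by rewrite mul_row_col -val_submodE -val_factmodE add_sub_fact_mod.
have eqn : (\rank U + \rank (cokermx U))%N = n.
  by rewrite mxrank_coker subnKC ?rank_leq_col.
rewrite -(char_poly_conj_rect (rG x) eqn B'B) -(char_poly_lblock _ (in_submod U (val_factmod 1%:M *m rG x))).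
congr char_poly; rewrite /B mul_col_mx mul_col_row -!in_submodE -!in_factmodE.
congr block_mx; apply/eqP; rewrite in_factmod_eq0.
by apply: (mxmodule_trans modU Gx); apply: val_submodP.
Qed.

Lemma irr_hom_rsim n1 n2 (r1 : mx_representation F G n1) (r2 : mx_representation F G n2) f :
    mx_irreducible r1 -> mx_irreducible r2 -> f != 0 ->
  (forall x, x \in G -> r1 x *m f = f *m r2 x) -> mx_rsim r1 r2.
Proof.
move=> /mx_irrP[n1_gt0 irr1] /mx_irrP[n2_gt0 irr2] nzf homf.
have free_f : row_free f.
  have modK : mxmodule r1 (kermx f).
    by apply/mxmoduleP=> x Gx; apply/sub_kermxP; rewrite -mulmxA homf // mulmxA mulmx_ker mul0mx.
  rewrite -kermx_eq0; apply: contraR nzf => /(irr1 _ modK) /row_fullP[g gK].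
  by rewrite -[f]mul1mx -gK -mulmxA mulmx_ker mulmx0.
have full_f : row_full f.
  have modI : mxmodule r2 <<f>>%MS.
    rewrite (eqmx_module _ (genmxE _)); apply/mxmoduleP=> x Gx.
    by rewrite -homf // submxMl.
  have := irr2 _ modI; rewrite -submx0 genmxE submx0 => /(_ nzf).
  by rewrite /row_full genmxE.
by exists f => //; rewrite -(eqP free_f) (eqP full_f).
Qed.
End FieldReps.

Section ClosedFieldReps.
Variables (F : closedFieldType) (gT : finGroupType) (G : {group gT}).
Local Notation aG := (regular_repr F G).
Local Notation ev rG := (gring_mx rG).
Local Notation reprG := (mx_representation F G).

(** Burnside's theorem on matrix algebras over an algebraically closed field. *)
Lemma irr_gring_onto n (rG : reprG n) : mx_irreducible rG ->
  forall A, exists a, ev rG a = A.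
Proof.
move=> irrG A; have /andP[_ /row_fullP[B BE]] := group_closure_closed_field irrG.
exists (mxvec A *m B); rewrite /gring_mx /= -mulmxA BE mulmx1 mxvecK //.
Qed.

(** Simplicity of the full matrix algebra: a nonzero entry is moved to each diagonal position by
    elementary matrices, which come from the group algebra. *)
Lemma gring_ideal_full n (rG : reprG n) a : mx_irreducible rG -> ev rG a != 0 ->
  exists b : 'I_n -> 'rV_(gcard G), exists c : 'I_n -> 'rV_(gcard G),
    \sum_k ev rG (b k) *m ev rG a *m ev rG (c k) = 1%:M.
Proof.
move=> irrG nza; have [i0 [j0 nzij]] : exists i j, ev rG a i j != 0.
  apply: boolp.contrapT => no; case/eqP: nza; apply/matrixP=> i j; rewrite [RHS]mxE.
  by apply: boolp.contrapT => /eqP nz; apply: no; exists i, j.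
have [b bP] := fin_all_exists (fun k => irr_gring_onto irrG ((ev rG a i0 j0)^-1 *: delta_mx k i0)).
have [c cP] := fin_all_exists (fun k => irr_gring_onto irrG (delta_mx j0 k)).
exists b, c; rewrite mx1_sum_delta; apply: eq_bigr => k _.
by rewrite bP cP -!scalemxAl mul_delta_mx_delta scalerA mulVf // scale1r.
Qed.

(** If something kills [r2] but not [r1], the ideal it generates contains an element acting as 1 on
    [r1]. Otherwise [r1] factors through the matrix algebra of [r2], and a row of that algebra maps
    onto [r1], so the two are similar. *)
Lemma irr_nonsim_separated n1 n2 (r1 : reprG n1) (r2 : reprG n2) :
    mx_irreducible r1 -> mx_irreducible r2 -> ~ mx_rsim r1 r2 ->
  exists a, ev r1 a = 1%:M /\ ev r2 a = 0.
Proof.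
move=> irr1 irr2 nsim.
have [[a r2a0 nz_r1a]|sub21] := boolp.pselect (exists2 a, ev r2 a = 0 & ev r1 a != 0).
  have [b [c Dbc]] := gring_ideal_full irr1 nz_r1a.
  exists (\sum_k b k *m ev aG a *m ev aG (c k)); rewrite !gring_mx_sum; split.
    by rewrite -Dbc; apply: eq_bigr => k _; rewrite !gring_mxA.
  by apply: big1 => k _; rewrite !gring_mxA r2a0 mulmx0 mul0mx.
case: nsim; apply: mx_rsim_sym.
have {}sub21 a : ev r2 a = 0 -> ev r1 a = 0.
  by move=> r2a0; apply/eqP/negPn/negP => nz; apply: sub21; exists a.
have /mx_irrP[n1_gt0 _] := irr1; have /mx_irrP[n2_gt0 _] := irr2.
pose k0 := Ordinal n2_gt0.
have [a Da] := fin_all_exists (fun j => irr_gring_onto irr2 (delta_mx k0 j)).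
have nz_ak0 : ev r1 (a k0) != 0.
  apply/eqP => ak0; have nzk0 : ev r2 (a k0) != 0.
    by rewrite Da; apply/eqP/matrixP => /(_ k0 k0)/eqP; rewrite !mxE !eqxx oner_eq0.
  have [b [c Dbc]] := gring_ideal_full irr2 nzk0.
  pose e := \sum_k b k *m ev aG (a k0) *m ev aG (c k) - gring_row 1%:M.
  have r2e : ev r2 e = 0.
    rewrite gring_mxB gring_mx_sum gring_mx1 -Dbc; apply/eqP; rewrite subr_eq0; apply/eqP.
    by apply: eq_bigr => k _; rewrite !gring_mxA.
  have := sub21 _ r2e; rewrite gring_mxB gring_mx_sum gring_mx1 big1 => [|k _].
    rewrite sub0r => /eqP; rewrite oppr_eq0 => /eqP/matrixP/(_ (Ordinal n1_gt0) (Ordinal n1_gt0))/eqP.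
    by rewrite !mxE eqxx oner_eq0.
  by rewrite !gring_mxA ak0 mulmx0 mul0mx.
pose u := nz_row (ev r1 (a k0)).
have /submxP[w Dw] : (u <= ev r1 (a k0))%MS := nz_row_sub _.
have nzu : u != 0 by rewrite nz_row_eq0.
(* The j-th basis vector of [r2] is the image of the [k0]-th under [a j]; [f] sends it to the image
   of [w] under the same element. *)
pose f := \matrix_(j < n2) (w *m ev r1 (a j)).
apply: (@irr_hom_rsim _ _ _ _ _ _ _ f) => //.
  by apply: contraNneq nzu => f0; rewrite Dw -[_ *m _](rowK (fun j => w *m ev r1 (a j))) -/f f0 row0.
move=> x Gx; apply/row_matrixP=> j; rewrite !row_mul rowK.
have r2d : ev r2 (a j *m aG x - \sum_l r2 x j l *: a l) = 0.
  rewrite gring_mxB gring_mx_sum gring_mxJ // Da; apply/eqP; rewrite subr_eq0; apply/eqP.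
  apply/matrixP=> i k; rewrite summxE mxE (bigD1 j) //= big1 ?addr0 => [|l neq_lj]; last first.
    by rewrite mxE (negPf neq_lj) andbF mul0r.
  rewrite mxE eqxx andbT (bigD1 k) //= big1 ?addr0 => [|l neq_lk]; last first.
    by rewrite gring_mxZ Da !mxE [k == l]eq_sym (negPf neq_lk) andbF mulr0.
  by rewrite gring_mxZ Da !mxE eqxx andbT mulrC.
have := sub21 _ r2d; rewrite gring_mxB gring_mx_sum gring_mxJ // => /eqP; rewrite subr_eq0 => /eqP r1d.
rewrite -mulmxA r1d mulmx_sumr mulmx_sum_row; apply: eq_bigr => l _.
by rewrite [row l f]rowK gring_mxZ -scalemxAr [row j _ _ _]mxE.
Qed.

(** A finite list of representatives of all irreducible representations up to similarity; it is
    extracted from a composition series of the regular module. *)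
Record irr_family := IrrFamily {
  fam_ix : finType;
  fam_dim : fam_ix -> nat;
  fam_repr : forall i, reprG (fam_dim i);
  fam_irr : forall i, mx_irreducible (fam_repr i);
  fam_inj : forall i j, mx_rsim (fam_repr i) (fam_repr j) -> i = j;
  fam_all : forall n (rG : reprG n), mx_irreducible rG -> exists i, mx_rsim rG (fam_repr i) }.

Lemma irr_family_exists : inhabited irr_family.
Proof.
have [U [compU lastU _]] : exists U : seq 'M[F]_(gcard G),
    [/\ mx_composition_series aG U, (last 0 U :=: 1%:M)%MS & subseq [::] U].
  (* The existence statement lies under [classically], which eliminates only into booleans;
     [boolp.asbool] turns the goal into one. *)
  have := @mx_Schreier _ _ _ _ aG [::] isT isT => /(_ (boolp.asbool _)) h.
  by apply: (boolp.asboolW (h _ (fun e => boolp.asboolT e))).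
pose sim (i j : 'I_(size U)) := boolp.asbool (mx_rsim (series_repr i compU) (series_repr j compU)).
pose least (i : 'I_(size U)) := [forall (j : 'I_(size U) | (j < i)%N), ~~ sim i j].
have all_least n (rG : reprG n) : mx_irreducible rG ->
    exists i : {i | least i}, mx_rsim rG (series_repr (val i) compU).
  move=> irrG; have [i simi] := rsim_regular_series irrG compU lastU.
  have: exists k : nat, [exists j : 'I_(size U), (k == j) && sim i j].
    by exists i; apply/existsP; exists i; rewrite eqxx; apply/boolp.asboolP/mx_rsim_refl.
  case/ex_minnP=> k /existsP[j /andP[/eqP-> /boolp.asboolP simij]] mink.
  suff lj : least j by exists (exist _ j lj); apply: mx_rsim_trans simij.
  apply/forall_inP => l ltlj; apply/negP => /boolp.asboolP simjl.
  have := mink l; rewrite leqNgt ltlj => /(_ _)/negP; apply=> //; apply/existsP; exists l.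
  by rewrite eqxx; apply/boolp.asboolP; apply: mx_rsim_trans simjl.
split; apply: (@IrrFamily {i | least i} _ (fun i => series_repr (val i) compU)) => //.
  by move=> i; apply: mx_series_repr_irr.
move=> [i li] [j lj] /= simij; apply: val_inj; apply: val_inj => /=.
case: (ltngtP i j) => // [ltij | ltji].
  by case/forall_inP/(_ i ltij)/boolp.asboolP: lj; apply: mx_rsim_sym.
by case/forall_inP/(_ j ltji)/boolp.asboolP: li.
Qed.

Section Family.
Variable fam : irr_family.
Local Notation I := (fam_ix fam).
Local Notation r := (@fam_repr fam).

Lemma fam_separated i (s : seq I) :
  exists a, ev (r i) a = 1%:M /\ (forall j, j \in s -> j != i -> ev (r j) a = 0).
Proof.
elim: s => [|j s [a [ai aj]]]; first by exists (gring_row 1%:M); rewrite gring_mx1.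
have [-> | neq_ji] := eqVneq j i.
  by exists a; split=> // k; rewrite in_cons => /predU1P[->|/aj//]; rewrite eqxx.
have [|b [bi bj]] := irr_nonsim_separated (fam_irr i) (fam_irr j).
  by move/fam_inj => eqij; rewrite eqij eqxx in neq_ji.
exists (a *m ev aG b); rewrite gring_mxA ai bi mulmx1; split=> // k.
by rewrite in_cons gring_mxA => /predU1P[-> _|/aj a0 /a0->]; rewrite ?bj ?mulmx0 ?mul0mx.
Qed.

(** Density: the group algebra maps onto the product of the matrix algebras of all its irreducible
    representations. *)
Lemma fam_onto (C : forall i, 'M[F]_(fam_dim i)) : exists a, forall i, ev (r i) a = C i.
Proof.
have [e De] := fin_all_exists (fun i => fam_separated i (enum I)).
have [b Db] := fin_all_exists (fun i => irr_gring_onto (fam_irr i) (C i)).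
exists (\sum_i e i *m ev aG (b i)) => i; have [ei _] := De i.
rewrite gring_mx_sum (bigD1 i) //= gring_mxA ei mul1mx Db big1 ?addr0 // => j neq_ji.
by have [_ ej] := De j; rewrite gring_mxA ej ?mem_enum ?mul0mx // eq_sym.
Qed.

(** The relation extends linearly to the group algebra, where some element acts as a diagonal
    elementary matrix on one member and as 0 on the others. *)
Lemma fam_trace_free (c : I -> F) :
  (forall x, x \in G -> \sum_i c i * \tr (r i x) = 0) -> forall i, c i = 0.
Proof.
move=> c0 i; have /mx_irrP[di _] := fam_irr i; pose k := Ordinal di.
have [a [ai aj]] := fam_separated i (enum I).
have [b Db] := irr_gring_onto (fam_irr i) (delta_mx k k).
have: \sum_j c j * \tr (ev (r j) (a *m ev aG b)) = 0.
  under eq_bigr do rewrite gring_mxE raddf_sum mulr_sumr.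
  rewrite exchange_big big1 //= => l _.
  under eq_bigr do rewrite mxtraceZ mulrCA.
  by rewrite -mulr_sumr c0 ?enum_valP ?mulr0.
rewrite (bigD1 i) //= big1 ?addr0 => [|j neq_ji]; last first.
  by rewrite gring_mxA aj ?mem_enum // mul0mx mxtrace0 mulr0.
rewrite gring_mxA ai mul1mx Db /mxtrace (bigD1 k) //= big1 => [|l /negPf neq_lk].
  by rewrite mxE eqxx addr0 mulr1.
by rewrite mxE neq_lk.
Qed.

(** Composition multiplicities, seen through characteristic polynomials (for Brauer characters),
    traces and annihilators. The last clause makes every factor that occurs a constituent in the
    sense of annihilators. *)
Lemma rep_decomposition n (rG : reprG n) : exists m : I -> nat,
  [/\ forall x, x \in G -> char_poly (rG x) = \prod_i char_poly (r i x) ^+ m i,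
      forall x, x \in G -> \tr (rG x) = \sum_i \tr (r i x) *+ m i
    & forall a, ev rG a = 0 -> forall i, (0 < m i)%N -> ev (r i) a = 0].
Proof.
have [k] := ubnP n; elim: k => // k IHk in n rG *; rewrite ltnS => lenk.
have [n0|n_gt0] := posnP n.
  exists (fun=> 0%N); split=> // x Gx; last first.
    by rewrite big1 // /mxtrace; move: (rG x); rewrite n0 => A; rewrite big_ord0.
  rewrite big1 //.
  by move: (rG x); rewrite n0 => A; rewrite /char_poly det_mx00.
have [irrG|nirrG] := boolp.pselect (mx_irreducible rG).
  have [i sim_i] := fam_all fam irrG; exists (fun j => (j == i)%N : nat); split=> [x Gx|x Gx|a a0 j].
  - rewrite (bigD1 i) //= big1 => [|j /negPf->]; last by rewrite expr0.
    rewrite eqxx expr1 mulr1; have [B [B' B'B DrG]] := mx_rsim_def sim_i.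
    by rewrite DrG // char_poly_conj_rect //; case: sim_i.
  - rewrite (bigD1 i) //= big1 => [|j /negPf->]; last by rewrite mulr0n.
    by rewrite eqxx addr0; apply: mxtrace_rsim.
  by rewrite lt0b => /eqP->; apply/eqP; rewrite -(rsim_gring_mx a sim_i) a0.
have [U [modU nzU nfullU]] : exists U : 'M_n, [/\ mxmodule rG U, U != 0 & ~~ row_full U].
  apply: boolp.contrapT => noU; apply: nirrG; apply/mx_irrP; split=> // U modU nzU.
  by apply/negPn/negP => nfullU; apply: noU; exists U.
have ltU : (\rank U < n)%N by rewrite ltn_neqAle rank_leq_col andbT.
have ltUc : (\rank (cokermx U) < n)%N.
  by rewrite mxrank_coker ltn_subrL n_gt0 lt0n mxrank_eq0 nzU.
have [m1 [cp1 tr1 ev1]] := IHk _ (submod_repr modU) (leq_trans ltU lenk).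
have [m2 [cp2 tr2 ev2]] := IHk _ (factmod_repr modU) (leq_trans ltUc lenk).
exists (fun i => m1 i + m2 i)%N; split=> [x Gx|x Gx|a a0 i].
- rewrite (char_poly_sub_fact_mod modU Gx) cp1 // cp2 // -big_split /=.
  by apply: eq_bigr => i _; rewrite exprD.
- rewrite -(mxtrace_sub_fact_mod modU) tr1 // tr2 // -big_split /=.
  by apply: eq_bigr => i _; rewrite mulrnDr.
rewrite addn_gt0 => /orP[/ev1->//|/ev2->//].
  by rewrite gring_mx_submod a0 mulmx0 linear0.
by rewrite gring_mx_factmod a0 mulmx0 linear0.
Qed.
End Family.
End ClosedFieldReps.

(** * Brauer characters *)

Lemma linear_pchar_pelt (F : fieldType) (p : nat) (pF : p \in [pchar F]) (z : F) k :
  z ^+ (p ^ k) = 1 -> z = 1.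
Proof.
elim: k z => [|k IHk] z; first by rewrite expn0 expr1.
rewrite expnS exprM => /IHk zp.
by apply: (fmorph_inj (pFrobenius_aut pF)); rewrite /= !pFrobenius_autE zp expr1n.
Qed.

Section BrauerValues.
Variables (F : closedFieldType) (p : nat) (lam : F -> algC).
Hypothesis setup : brauer_setup p lam.
Let p_pr : prime p. Proof. by case: setup. Qed.
Let pF : p \in [pchar F]. Proof. by case: setup. Qed.
Variable gT : finGroupType.
Implicit Types (G H N : {group gT}).
Local Notation bval := (brauer_val lam).
Local Notation ev rG := (gring_mx rG).

Lemma eigenvalue_repr_order G n (rG : mx_representation F G n) x z :
  x \in G -> root (char_poly (rG x)) z -> z ^+ #[x]%g = 1.
Proof.
move=> Gx; rewrite -eigenvalue_root_char => /eigenvalueP[v vx nzv].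
have vxk k : v *m rG (x ^+ k)%g = z ^+ k *: v.
  elim: k => [|k IHk]; first by rewrite expg0 repr_mx1 mulmx1 scale1r.
  by rewrite expgSr repr_mxM ?groupX // mulmxA IHk -scalemxAl vx scalerA exprSr.
have := vxk #[x]%g; rewrite expg_order repr_mx1 mulmx1 => /eqP.
by rewrite -{1}[v]scale1r -subr_eq0 -scalerBl scaler_eq0 (negPf nzv) orbF subr_eq0 eq_sym => /eqP.
Qed.

(** On the cyclic group of [x] all composition factors have dimension 1, and there a p-element acts
    as a p-power root of unity, which is 1 in characteristic p. *)
Lemma trace_p'part G n (rG : mx_representation F G n) x :
  x \in G -> \tr (rG x) = \tr (rG x.`_p^')%g.
Proof.
move=> Gx; have sxG : <[x]>%G \subset G by rewrite cycle_subG.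
have [fam] := irr_family_exists F <[x]>%G.
have [m [_ trm _]] := rep_decomposition fam (subg_repr rG sxG).
have xx : x \in <[x]>%G by exact: cycle_id.
have xx' : (x.`_p^' \in <[x]>)%g by exact: groupX.
have := trm _ xx; have /= -> := trm _ xx'; move=> /= ->; apply: eq_bigr => i _; congr (_ *+ _).
have irri := fam_irr i; have dim1 : fam_dim i = 1%N.
  exact: (mx_irr_abelian_linear (@group_closure_closed_field F gT _) irri (cycle_abelian x)).
move: (fam_repr i) irri; rewrite dim1 => r _.
have xp : (x.`_p \in <[x]>)%g by exact: groupX.
have ->: r x = r (x.`_p)%g *m r (x.`_p^')%g by rewrite -repr_mxM // consttC.
suff ->: r (x.`_p)%g = 1%:M by rewrite mul1mx.
rewrite [r _]mx11_scalar; congr _%:M; set z := r _ _ _.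
have rk k : r (x.`_p ^+ k)%g = (z ^+ k)%:M.
  elim: k => [|k IHk]; first by rewrite expg0 repr_mx1 expr0.
  by rewrite expgS repr_mxM ?groupX // IHk [r (x.`_p)%g]mx11_scalar -scalar_mxM exprS.
have [k ordk] := p_natP (p_elt_constt p x).
apply: (linear_pchar_pelt pF (k := k)); rewrite -ordk.
have := rk #[x.`_p]%g; rewrite expg_order repr_mx1 => /matrixP/(_ 0 0).
by rewrite !mxE eqxx !mulr1n.
Qed.

Lemma brauer_valE G n (rG : mx_representation F G n) x :
  exists s : seq F, [/\ char_poly (rG x) = \prod_(z <- s) ('X - z%:P),
    bval rG x = \sum_(z <- s) lam z & \tr (rG x) = \sum_(z <- s) z].
Proof.
have [s] := closed_field_poly_normal (char_poly (rG x)).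
rewrite (monicP (char_poly_monic _)) scale1r => defs; exists s.
split=> //; first exact: brauer_val_roots.
have [n0|n_gt0] := posnP n.
  have: size s = 0%N.
    by apply: succn_inj; rewrite -(size_prod_XsubC s id) -defs size_char_poly n0.
  move/size0nil->; rewrite big_nil /mxtrace; move: (rG x); rewrite n0 => A.
  by rewrite big_ord0.
have := char_poly_trace (rG x) n_gt0; rewrite defs.
have szs : size s = n.
  by apply: succn_inj; rewrite -(size_prod_XsubC s id) -defs size_char_poly.
have -> : n.-1 = (size s).-1 by rewrite szs.
by rewrite coefPn_prod_XsubC ?szs -?lt0n // => /oppr_inj->.
Qed.

(** One place serves all representations of [G] at once: Brauer values lie in [V] and reduce to
    traces. This carries a linear relation between Brauer characters to [F]. *)
Lemma brauer_trace_lift G :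
  exists (V : comNzRingType) (f : {rmorphism V -> algC}) (rho : {rmorphism V -> F}),
    injective f /\ forall n (rG : mx_representation F G n) x, x \in G -> p^'.-elt%g x ->
      exists v, f v = bval rG x /\ rho v = \tr (rG x).
Proof.
pose n := (#|G|`_p^')%N.
have n_gt0 : (0 < n)%N by rewrite part_gt0.
have p'n : ~~ (p %| n)%N by rewrite -p'natE ?part_pnat.
have [w prim_w prim_z] := lam_prim_root setup n_gt0 p'n.
have [V [f [rho [inj_f _ [v fv rv]]]]] := cyclotomic_place prim_z prim_w.
have wp : p'_unity_root p w by exists n; rewrite prim_expr_order.
exists V, f, rho; split=> // d rG x Gx p'x.
have [s [defs -> ->]] := brauer_valE rG x.
have roots z : z \in s -> exists k, z = w ^+ k.
  move=> sz; have: root (char_poly (rG x)) z by rewrite defs root_prod_XsubC.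
  move/(eigenvalue_repr_order Gx) => zx.
  suff zn : z ^+ n = 1 by have [k ->] := prim_rootP prim_w zn; exists k.
  have /dvdnP[c ->] : (#[x]%g %| n)%N.
    by rewrite /n -(part_pnat_id p'x) partn_dvd // order_dvdG.
  by rewrite mulnC exprM zx expr1n.
elim: s roots {defs} => [|z s IHs] roots; first by exists 0; rewrite !big_nil !rmorph0.
have [|u [fu ru]] := IHs; first by move=> y sy; apply: roots; rewrite in_cons sy orbT.
have [k ->] := roots z (mem_head _ _); exists (v ^+ k + u).
by rewrite !big_cons !rmorphD !rmorphXn fu ru fv rv (lamX setup).
Qed.

(** Descent: reduced to [F], an integral relation becomes one between traces, whose coefficients
    vanish; so p divides all the [a i], and dividing by p gives a smaller relation. *)
Lemma fam_brauer_free G (fam : irr_family F G) (a : fam_ix fam -> int) :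
    (forall x, x \in G -> p^'.-elt%g x -> \sum_i (a i)%:~R * bval (fam_repr i) x = 0) ->
  forall i, a i = 0.
Proof.
have [V [f [rho [inj_f lift]]]] := brauer_trace_lift G.
have [k] := ubnP (\sum_i `|a i|)%N; elim: k => // k IHk in a *; rewrite ltnS => lek a0.
have aF i : (a i)%:~R = 0 :> F.
  apply: (fam_trace_free (c := fun i => (a i)%:~R)) => x Gx.
  under eq_bigr do rewrite trace_p'part //.
  have Gx' : (x.`_p^' \in G)%g by rewrite groupX.
  have p'x : (p^'.-elt (x.`_p^'))%g by exact: p_elt_constt.
  have [u Du] := fin_all_exists (fun i : fam_ix fam => lift _ (fam_repr i) _ Gx' p'x).
  have: f (\sum_i (a i)%:~R * u i) = f 0.
    rewrite rmorph0 -(a0 _ Gx' p'x) rmorph_sum; apply: eq_bigr => j _.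
    by rewrite rmorphM rmorph_int; have [-> _] := Du j.
  move/inj_f/(congr1 rho); rewrite rmorph0 rmorph_sum => rho0; rewrite -[RHS]rho0.
  apply: eq_bigr => j _.
  by rewrite rmorphM rmorph_int; have [_ ->] := Du j.
have dv_a i : exists b : int, a i = b * p%:Z.
  by apply/dvdzP; have/eqP := aF i; rewrite -(dvdz_pcharf pF).
have [b Db] := fin_all_exists dv_a.
have b0 i : b i = 0.
  have [all0 | [j nzj]] : (forall j, a j = 0) \/ exists j, a j != 0.
    have [[j nzj]|no] := boolp.pselect (exists j, a j != 0); first by right; exists j.
    by left=> j; apply/eqP/negPn/negP => nz; apply: no; exists j.
    have/eqP := all0 i; rewrite Db mulf_eq0 => /orP[/eqP//|].
    by rewrite -[p%:Z]/(Posz p) eqz_nat gtn_eqF ?prime_gt0.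
  apply: IHk => [|x Gx p'x].
    apply: leq_trans lek; rewrite (bigD1 j) //= [X in (_ < X)%N](bigD1 j) //= -addSn leq_add //.
      rewrite Db abszM; have: (0 < `|b j|)%N.
        by rewrite absz_gt0; apply: contraNneq nzj => bj; rewrite Db bj mul0r.
      by move=> bj_gt0; rewrite ltn_Pmulr ?prime_gt1.
    by apply: leq_sum => l _; rewrite Db abszM leq_pmulr ?prime_gt0.
  apply/eqP; have := a0 x Gx p'x; under eq_bigr do rewrite Db rmorphM mulrAC /=.
  rewrite -mulr_suml => /eqP; rewrite mulf_eq0 => /orP[//|].
  by rewrite -pmulrn pnatr_eq0 gtn_eqF ?prime_gt0.
by move=> i; rewrite Db b0 mul0r.
Qed.

Lemma brauer_val1 G n (rG : mx_representation F G n) : bval rG 1%g = n%:R.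
Proof.
have cp1 : char_poly (rG 1%g) = \prod_(z <- nseq n 1) ('X - z%:P).
  rewrite repr_mx1 char_poly_trig ?scalar_mx_is_trig // big_nseq -Monoid.iteropE.
  rewrite (eq_bigr (fun _ => 'X - 1%:P)) => [|i _]; last by rewrite mxE eqxx.
  by rewrite prodr_const card_ord.
by rewrite (brauer_val_roots lam cp1) big_nseq (lam1 setup) iter_addr_0.
Qed.

Lemma brauer_val_rsim G n1 n2 (r1 : mx_representation F G n1) (r2 : mx_representation F G n2) :
  mx_rsim r1 r2 -> {in G, bval r1 =1 bval r2}.
Proof.
move=> sim12 x Gx; have eqn := mxrank_rsim sim12.
have [B [B' B'B Dr1]] := mx_rsim_def sim12.
by rewrite /brauer_val Dr1 // char_poly_conj_rect.
Qed.

Lemma rep_brauer_decomposition G (fam : irr_family F G) n (rG : mx_representation F G n) :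
  exists m : fam_ix fam -> nat,
  [/\ forall x, x \in G -> bval rG x = \sum_i bval (fam_repr i) x *+ m i,
      forall x, x \in G -> \tr (rG x) = \sum_i \tr (fam_repr i x) *+ m i
    & forall a, ev rG a = 0 -> forall i, (0 < m i)%N -> ev (fam_repr i) a = 0].
Proof.
have [m [cpm trm evm]] := rep_decomposition fam rG; exists m; split=> // x Gx.
have [s Ds] := fin_all_exists (fun i : fam_ix fam => brauer_valE (fam_repr i) x).
pose S := flatten [seq flatten (nseq (m i) (s i)) | i <- index_enum (fam_ix fam)].
have big_nseq_flatten (R : Type) (idx : R) (op : Monoid.com_law idx) (E : F -> R) k t :
    \big[op/idx]_(z <- flatten (nseq k t)) E z = iterop k op (\big[op/idx]_(z <- t) E z) idx.
  rewrite Monoid.iteropE; elim: k => [|k IHk]; first by rewrite /= big_nil.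
  by rewrite /= big_cat IHk.
have big_S (R : Type) (idx : R) (op : Monoid.com_law idx) (E : F -> R) :
    \big[op/idx]_(z <- S) E z = \big[op/idx]_i iterop (m i) op (\big[op/idx]_(z <- s i) E z) idx.
  rewrite big_flatten big_map; apply: eq_bigr => i _; exact: big_nseq_flatten.
have cpS : char_poly (rG x) = \prod_(z <- S) ('X - z%:P).
  rewrite cpm // big_S; apply: eq_bigr => i _; have [-> _ _] := Ds i.
  by [].
rewrite (brauer_val_roots lam cpS) big_S; apply: eq_bigr => i _; have [_ -> _] := Ds i.
by [].
Qed.

Lemma fam_mult_uniq G (fam : irr_family F G) (m m' : fam_ix fam -> nat) :
    (forall x, x \in G -> p^'.-elt%g x ->
      \sum_i bval (fam_repr i) x *+ m i = \sum_i bval (fam_repr i) x *+ m' i) ->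
  m =1 m'.
Proof.
move=> eqm i; apply/eqP; rewrite -eqz_nat -subr_eq0; apply/eqP.
apply: (fam_brauer_free (a := fun i => (m i)%:Z - (m' i)%:Z)) => x Gx p'x.
rewrite (eq_bigr (fun j => bval (fam_repr j) x *+ m j - bval (fam_repr j) x *+ m' j)).
  by rewrite sumrB eqm // subrr.
by move=> j _; rewrite rmorphB mulrBl /= -!pmulrn !mulr_natl.
Qed.

Lemma irr_brauer_rsim G n1 n2 (r1 : mx_representation F G n1) (r2 : mx_representation F G n2) :
    mx_irreducible r1 -> mx_irreducible r2 ->
    (forall x, x \in G -> p^'.-elt%g x -> bval r1 x = bval r2 x) ->
  mx_rsim r1 r2.
Proof.
move=> irr1 irr2 eq12; have [fam] := irr_family_exists F G.
have [i sim1] := fam_all fam irr1; have [j sim2] := fam_all fam irr2.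
suff eqij : i = j by apply: mx_rsim_trans sim1 _; rewrite eqij; apply: mx_rsim_sym.
have sum1 (k : fam_ix fam) x : \sum_l bval (fam_repr l) x *+ (l == k) = bval (fam_repr k) x.
  by rewrite (bigD1 k) //= eqxx big1 ?addr0 // => l /negPf->.
have eqm x : x \in G -> p^'.-elt%g x ->
    \sum_l bval (fam_repr l) x *+ (l == i) = \sum_l bval (fam_repr l) x *+ (l == j).
  by move=> Gx p'x; rewrite !sum1 -(brauer_val_rsim sim1) // -(brauer_val_rsim sim2) // eq12.
by have := fam_mult_uniq eqm i; rewrite eqxx; case: eqP.
Qed.
End BrauerValues.

(** * Vertices *)

Section CosetSums.
Variables (gT : finGroupType) (M : nmodType).
Implicit Types (G H K R P : {group gT}) (g : gT -> M).

Lemma sum_transversal_rcosets G H g : H \subset G ->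
    (forall h t, h \in H -> t \in G -> g (h * t)%g = g t) ->
  \sum_(t in transversal (rcosets H G) G) g t = \sum_(X in rcosets H G) g (repr X).
Proof.
move=> sHG gH; have partG := rcosets_partition sHG.
have trT := transversalP partG; set T := transversal _ _ in trT *.
rewrite -[in RHS](pblock_transversal trT) [RHS]big_imset /=; last exact: (pblock_inj trT).
apply: eq_bigr => t Tt; have Gt : t \in G := subsetP (transversal_sub trT) t Tt.
have ->: pblock (rcosets H G) t = (H :* t)%g.
  apply: def_pblock; last exact: rcoset_refl; last by apply/rcosetsP; exists t.
  by case/and3P: partG.
by case: repr_rcosetP => h Hh; rewrite gH.
Qed.

Lemma sum_rcosets_trans G K H g : H \subset K -> K \subset G ->
    (forall h t, h \in H -> t \in G -> g (h * t)%g = g t) ->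
  \sum_(X in rcosets H G) g (repr X) =
    \sum_(Y in rcosets K G) \sum_(X in rcosets H K) g (repr X * repr Y)%g.
Proof.
move=> sHK sKG gH; have sHG := subset_trans sHK sKG.
rewrite (partition_big (fun X => K :* repr X)%g (mem (rcosets K G))) /=; last first.
  move=> _ /rcosetsP[x Gx ->]; apply/rcosetsP; exists (repr (H :* x))%g => //.
  by case: repr_rcosetP => h Hh; rewrite groupM // (subsetP sHG).
apply: eq_bigr => Y /rcosetsP[y0 Gy0 defY].
have Gy : repr Y \in G.
  by rewrite defY; case: repr_rcosetP => k Kk; rewrite groupM // (subsetP sKG).
have defY' : Y = (K :* repr Y)%g.
  have Yr : repr Y \in (K :* y0)%g by rewrite -defY (mem_repr y0) // defY rcoset_refl.
  by rewrite (rcoset_eqP Yr).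
move: (repr Y) Gy defY' => y Gy {}defY.
rewrite (reindex_onto (fun X => X :* y)%g (fun X => X :* y^-1)%g) /=; last first.
  by move=> X _; rewrite -rcosetM mulVg mulg1.
apply: eq_big => [X|X].
  rewrite -rcosetM mulgV mulg1 eqxx andbT.
  apply/andP/idP=> [[/rcosetsP[x Gx defX] /eqP KY]|/rcosetsP[x Kx ->]].
    have DX : X = (H :* (x * y^-1))%g.
      by rewrite rcosetM -defX -rcosetM mulgV mulg1.
    rewrite DX; apply/rcosetsP; exists (x * y^-1)%g => //.
    rewrite -mem_rcoset -defY -KY defX; apply/rcosetP.
    case: repr_rcosetP => h Hh; exists h^-1%g; rewrite ?groupV ?(subsetP sHK) //.
    by rewrite mulKg.
  rewrite -rcosetM; split.
    by apply/rcosetsP; exists (x * y)%g; rewrite // groupM // (subsetP sKG).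
  rewrite defY; case: repr_rcosetP => h Hh; apply/eqP/rcoset_eqP.
  by rewrite mulgA mem_rcoset mulgK groupM // (subsetP sHK).
case/andP=> /andP[HX _] _; move/rcosetsP: HX => [x Gx defX].
have DX : X = (H :* (x * y^-1))%g.
  by rewrite rcosetM -defX -rcosetM mulgV mulg1.
rewrite DX -rcosetM mulgKV; case: repr_rcosetP => h Hh; case: repr_rcosetP => h' Hh'.
by rewrite -!mulgA mulVg mulg1 !gH.
Qed.

(** Left translation by [t] carries the right cosets of [H] to those of its conjugate; this is what
    makes relative projectivity invariant under conjugation. *)
Lemma sum_rcosetsJ G H g t : H \subset G -> t \in G ->
    (forall h x, h \in H -> x \in G -> g (h * x)%g = g x) ->
  \sum_(X in rcosets (H :^ t^-1)%g G) g (t^-1 * repr X)%g = \sum_(Y in rcosets H G) g (repr Y).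
Proof.
move=> sHG Gt gH; have Gt' := groupVr Gt.
have lK (A : {set gT}) : (t^-1 *: (t *: A))%g = A by rewrite -lcosetM mulVg mul1g.
have DJ x : (t *: (H :* x))%g = ((H :^ t^-1) :* (t * x))%g.
  by apply/setP=> z; rewrite mem_lcoset !mem_rcoset mem_conjgV conjgE invMg !mulgA mulgKV.
rewrite (reindex_onto (fun Y => t *: Y)%g (fun X => t^-1 *: X)%g) /=; last first.
  by move=> X _; rewrite -lcosetM mulgV mul1g.
apply: eq_big => [Y|Y].
  rewrite lK eqxx andbT; apply/rcosetsP/rcosetsP=> [[x Gx DY]|[x Gx ->]].
    exists (t^-1 * x)%g; rewrite ?groupM // -[Y]lK DY.
    by rewrite -[x in LHS](mulKVg t) -DJ lK.
  by exists (t * x)%g; rewrite ?groupM // DJ.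
case/andP=> /rcosetsP[x Gx DY] _.
have ->: Y = (H :* (t^-1 * x))%g by rewrite -[LHS]lK DY -[x in LHS](mulKVg t) -DJ lK.
rewrite DJ; case: repr_rcosetP => r; case: repr_rcosetP => h Hh.
rewrite mem_conjgV => Hr; rewrite (gH h) ?groupM //.
by rewrite -(gH _ (t^-1 * x)%g Hr) ?groupM // /conjg -!mulgA.
Qed.

(** [P] permutes the cosets of [R] by right multiplication and [g] is constant on orbits. A fixed
    coset [R t] would mean that [P] lies in [R :^ t], so every orbit has size divisible by p and
    contributes 0. *)
Lemma sum_pgroup_rcosets p G R P g : prime p -> (forall z : M, z *+ p = 0) ->
    R \subset G -> P \subset G -> (p.-group P)%g ->
    (forall r t, r \in R -> t \in G -> g (r * t)%g = g t) ->
    (forall t q, t \in G -> q \in P -> g (t * q)%g = g t) ->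
    (forall t, t \in G -> ~~ (P \subset R :^ t)%g) ->
  \sum_(X in rcosets R G) g (repr X) = 0.
Proof.
move=> p_pr pM sRG sPG pP gR gP nfix.
have actP : [acts P, on rcosets R G | 'Rs].
  by apply: subset_trans sPG _; apply: actsRs_rcosets.
have partO := orbit_partition actP.
rewrite (set_partition_big _ partO) /=; apply: big1 => O /imsetP[X RX ->{O}].
have gO Y : Y \in orbit 'Rs%act P X -> g (repr Y) = g (repr X).
  case/orbitP=> q Pq <- /=; case/rcosetsP: RX => x Gx ->; rewrite /= rcosetE -rcosetM.
  case: repr_rcosetP => r Rr; case: repr_rcosetP => r' Rr'.
  have Gq := subsetP sPG q Pq.
  by rewrite (gR r) ?groupM // (gR r') // gP.
rewrite (eq_bigr (fun=> g (repr X))) // sumr_const.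
have [k Dk] := p_natP (pnat_dvd (dvdn_orbit 'Rs%act P X) pP).
case: k Dk => [/card_orbit1 fixX | k ->]; last by rewrite expnS mulrnA pM mul0rn.
case/rcosetsP: RX fixX => x Gx -> fixX; case/negP: (nfix x Gx).
apply/subsetP=> q Pq; have: ('Rs%act (R :* x) q)%g \in orbit 'Rs%act P (R :* x)%g by apply: mem_orbit.
rewrite fixX inE /= rcosetE -rcosetM => /eqP/rcoset_eqP.
by rewrite mem_conjg /conjg invgK mem_rcoset mulgA.
Qed.
End CosetSums.

Section Vertices.
Variables (F : fieldType) (p : nat).
Hypotheses (p_pr : prime p) (pF : p \in [pchar F]).
Variables (gT : finGroupType) (G : {group gT}) (n : nat) (rG : mx_representation F G n).
Implicit Types (P Q R W : {group gT}) (e : 'M[F]_n).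

Definition mxconj e t := rG (t^-1)%g *m e *m rG t.

Lemma mxconj_cent W e : W \subset G -> (forall w, w \in W -> e *m rG w = rG w *m e) ->
  forall w t, w \in W -> t \in G -> mxconj e (w * t)%g = mxconj e t.
Proof.
move=> sWG cWe w t Ww Gt; have Gw := subsetP sWG w Ww.
rewrite /mxconj invMg !repr_mxM ?groupV // !mulmxA; congr (_ *m _).
by rewrite -!mulmxA cWe // (mulmxA (rG _) (rG w)) -repr_mxM ?groupV // mulVg repr_mx1 mul1mx.
Qed.

(** Trades the transversal for the canonical representatives [repr X], which makes sums over cosets
    easy to reindex. *)
Lemma rel_projP R : rel_proj rG R <->
  R \subset G /\ exists e, (forall w, w \in R -> e *m rG w = rG w *m e) /\
    \sum_(X in rcosets R G) mxconj e (repr X) = 1%:M.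
Proof.
split=> [] [sRG [e [cRe sum1]]]; split=> //; exists e; split=> //.
  by rewrite -sum1; apply/esym/sum_transversal_rcosets/mxconj_cent.
by rewrite -sum1; apply/sum_transversal_rcosets/mxconj_cent.
Qed.

(* Count tr e = tr (e Tr_R^G B) over the P-orbits on the cosets of R: a      *)
(* nontrivial orbit contributes a multiple of p, that is, 0.                 *)
Lemma rel_proj_sub P R e : P \subset G -> (p.-group P)%g -> rel_proj rG R ->
    (forall q, q \in P -> e *m rG q = rG q *m e) -> \tr e != 0 ->
  exists2 t, t \in G & P \subset (R :^ t)%g.
Proof.
move=> sPG pP /rel_projP[sRG [B [cRB sumB]]] cPe nz_tr.
apply: boolp.contrapT => nofix; case/eqP: nz_tr.
rewrite -[e]mulmx1 -sumB mulmx_sumr raddf_sum /=.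
apply: (@sum_pgroup_rcosets _ _ p G R P (fun t => \tr (e *m mxconj B t))) => //.
- by move=> z; rewrite -mulr_natl pcharf0 ?mul0r.
- by move=> r t Rr Gt; rewrite (mxconj_cent sRG cRB).
- move=> t q Gt Pq; have Gq := subsetP sPG q Pq.
  rewrite /mxconj invMg !repr_mxM ?groupV // !mulmxA mxtrace_mulC !mulmxA.
  rewrite -cPe // -!mulmxA (mulmxA (rG q)) -repr_mxM ?groupV // mulgV repr_mx1 mul1mx.
  by [].
by move=> t Gt; apply/negP => sPRt; apply: nofix; exists t.
Qed.

(** The model is a module induced from a [W]-module of dimension prime to p, with [e] the projection
    onto that summand: relative trace 1 gives projectivity relative to [W], and the nonzero trace
    keeps a Sylow p-subgroup of [W] from being too large to be a vertex. *)
Definition vertex_source W := [/\ W \subset G & exists e,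
  [/\ forall w, w \in W -> e *m rG w = rG w *m e,
      \sum_(X in rcosets W G) mxconj e (repr X) = 1%:M & \tr e != 0]].

(** The index of [Q] in [W] is invertible in [F], so [e] divided by that index has relative trace 1
    from [Q]. *)
Lemma vertex_source_rel_proj W Q : vertex_source W -> (p.-Sylow(W) Q)%g -> rel_proj rG Q.
Proof.
case=> sWG [e [cWe sum1 _]] sylQ; have sQW := pHall_sub sylQ.
apply/rel_projP; split; first exact: subset_trans sWG.
have nz : #|W : Q|%g%:R != 0 :> F.
  by rewrite -(dvdn_pcharf pF) -p'natE //; case/and3P: sylQ.
have cQe q : q \in Q -> e *m rG q = rG q *m e by move/(subsetP sQW)/cWe.
exists (#|W : Q|%g%:R^-1 *: e); split=> [q Qq|]; first by rewrite -scalemxAl -scalemxAr cQe.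
rewrite (eq_bigr (fun X => #|W : Q|%g%:R^-1 *: mxconj e (repr X))) => [|X _]; last first.
  by rewrite /mxconj -scalemxAr -scalemxAl.
rewrite -scaler_sumr (@sum_rcosets_trans _ _ G W Q (mxconj e)) //; last first.
  by apply: mxconj_cent cQe; apply: subset_trans sWG.
rewrite (eq_bigr (fun Y => #|W : Q|%g%:R *: mxconj e (repr Y))) => [|Y RY].
  by rewrite -scaler_sumr sum1 scalerA mulVf // scale1r.
have GY : repr Y \in G.
  case/rcosetsP: RY => y Gy ->; case: repr_rcosetP => w Ww; rewrite groupM //; exact: (subsetP sWG).
rewrite (eq_bigr (fun=> mxconj e (repr Y))) => [|X RX]; last first.
  rewrite (mxconj_cent sWG cWe) //; case/rcosetsP: RX => x Wx ->.
  by case: repr_rcosetP => q Qq; rewrite groupM // (subsetP sQW).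
by rewrite sumr_const scaler_nat.
Qed.

Lemma vertex_source_vertex W Q : vertex_source W -> (p.-Sylow(W) Q)%g -> is_vertex rG Q.
Proof.
move=> srcW sylQ; split; first exact: vertex_source_rel_proj sylQ.
move=> R prRQ projR; have [sWG [e [cWe _ nz_tr]]] := srcW.
have sQW := pHall_sub sylQ; have sQG := subset_trans sQW sWG.
have [|t _ sQRt] := rel_proj_sub sQG (pHall_pgroup sylQ) projR _ nz_tr.
  by move=> q /(subsetP sQW)/cWe.
by have := proper_card prRQ; rewrite ltnNge -(cardJg R t) subset_leq_card.
Qed.

(** The trace argument places [Q] inside a conjugate of [R]; moving [Q] back by that conjugation
    keeps it relatively projective, so minimality of [R] forces equality. *)
Lemma vertex_source_conj W Q R : vertex_source W -> (p.-Sylow(W) Q)%g -> is_vertex rG R ->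
  exists2 t, t \in G & Q :=: (R :^ t)%g.
Proof.
move=> srcW sylQ [projR minR]; have [sWG [e [cWe _ nz_tr]]] := srcW.
have sQW := pHall_sub sylQ; have sQG := subset_trans sQW sWG.
have [|t Gt sQRt] := rel_proj_sub sQG (pHall_pgroup sylQ) projR _ nz_tr.
  by move=> q /(subsetP sQW)/cWe.
exists t => //; apply/eqP; rewrite eqEsubset sQRt /=.
apply: contraT => nsRQ; case: (minR (Q :^ t^-1)%G).
  rewrite properE sub_conjgV sQRt /=; apply: contra nsRQ => sRQ.
  by rewrite -[(Q : {set _})](conjsgKV t) conjSg.
have /rel_projP[_ [B [cQB sumB]]] := vertex_source_rel_proj srcW sylQ.
apply/rel_projP; split; first by rewrite -(conjGid (groupVr Gt)) conjSg.
have Gt' := groupVr Gt.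
exists (mxconj B t^-1%g); split=> [r|].
  rewrite mem_conjgV => Qr; have Gr : r \in G by rewrite -(conjgK t r) groupJ // (subsetP sQG).
  have Dr : rG r = rG t *m rG (r ^ t)%g *m rG t^-1%g.
    by rewrite -!repr_mxM ?groupM ?groupJ // conjgE !mulgA mulgV mul1g mulgK.
  rewrite Dr /mxconj invgK !mulmxA; congr (_ *m _).
  by rewrite !(repr_mxKV rG Gt) -!mulmxA cQB.
rewrite -sumB -(sum_rcosetsJ sQG Gt) /=; last exact: mxconj_cent.
apply: eq_bigr => X RX; have GX : repr X \in G.
  case/rcosetsP: RX => x Gx ->; case: repr_rcosetP => r; rewrite mem_conjgV => Qr.
  by rewrite groupM // -(conjgK t r) groupJ // (subsetP sQG).
by rewrite /mxconj invMg !invgK !repr_mxM ?groupV // !mulmxA.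
Qed.
End Vertices.

(** * Modular Clifford theory *)

Section ConjRepr.
Variables (F : fieldType) (gT : finGroupType) (N : {group gT}) (n : nat).
Variable rN : mx_representation F N n.

Lemma conj_repr_proof y : y \in ('N(N))%g -> mx_repr N (fun h => rN (h ^ y^-1)%g).
Proof.
move=> nNy; split=> [|h k Nh Nk]; first by rewrite conj1g repr_mx1.
by rewrite conjMg repr_mxM // memJ_norm ?groupV.
Qed.
(** The exponent [y^-1] agrees with that of [(phi ^ y)%CF], so conjugation commutes with
    reduction. *)
Definition conj_repr y nNy := MxRepresentation (@conj_repr_proof y nNy).

Lemma conj_repr_irr y (nNy : y \in ('N(N))%g) :
  mx_irreducible rN -> mx_irreducible (conj_repr nNy).
Proof.
case/mx_irrP=> n_gt0 irrN; apply/mx_irrP; split=> // U modU nzU; apply: irrN => //.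
apply/mxmoduleP=> h Nh; have := mxmoduleP modU (h ^ y)%g.
by rewrite memJ_norm // /= conjgK => ->.
Qed.
End ConjRepr.

Lemma conj_repr_rsim (F : fieldType) (gT : finGroupType) (N : {group gT}) n1 n2
    (r1 : mx_representation F N n1) (r2 : mx_representation F N n2) y (nNy : y \in ('N(N))%g) :
  mx_rsim r1 r2 -> mx_rsim (conj_repr r1 nNy) (conj_repr r2 nNy).
Proof.
case=> B eqn freeB homB; exists B => // h Nh /=.
by rewrite homB // memJ_norm ?groupV.
Qed.

Section GringInclusion.
Variables (F : fieldType) (gT : finGroupType) (H G : {group gT}) (sHG : H \subset G).

Definition gring_incl (a : 'rV[F]_(gcard H)) : 'rV[F]_(gcard G) :=
  \sum_i a 0 i *: gring_row (regular_repr F G (enum_val i)).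

Lemma gring_inclE n (rG : mx_representation F G n) a :
  gring_mx rG (gring_incl a) = gring_mx (subg_repr rG sHG) a.
Proof.
rewrite gring_mx_sum gring_mxE; apply: eq_bigr => i _.
by rewrite gring_mxZ gring_mxG ?(subsetP sHG) ?enum_valP.
Qed.
End GringInclusion.

Lemma mul_gring_submod (F : fieldType) (gT : finGroupType) (H : {group gT}) n
    (rH : mx_representation F H n) U (modU : mxmodule rH U) a c m (V : 'M_(m, n)) :
  (V <= U)%MS -> gring_mx (submod_repr modU) a = c%:M -> V *m gring_mx rH a = c *: V.
Proof.
move=> sVU; rewrite gring_mx_submod => Dc.
have sub : (val_submod (1%:M : 'M_(\rank U)) *m gring_mx rH a <= U)%MS.
  rewrite gring_mxE mulmx_sumr summx_sub // => i _; rewrite -scalemxAr scalemx_sub //.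
  by apply: (mxmodule_trans modU (enum_valP i)); apply: val_submodP.
have {}Dc : val_submod (1%:M : 'M_(\rank U)) *m gring_mx rH a = c *: val_submod (1%:M : 'M_(\rank U)).
  by rewrite -(in_submodK sub) Dc -[c%:M]mulmx1 mul_scalar_mx linearZ.
rewrite -(in_submodK sVU) val_submodE -mulmxA Dc -scalemxAr.
by [].
Qed.

Section Clifford.
Variables (F : closedFieldType) (gT : finGroupType) (G N : {group gT}).
Hypothesis nsNG : (N <| G)%g.
Let sNG := normal_sub nsNG.
Let nNG := subsetP (normal_norm nsNG).
Variables (n : nat) (rG : mx_representation F G n).
Local Notation rN := (subg_repr rG sNG).
Local Notation ev r := (gring_mx r).

Lemma Clifford_conj_rsim M x (simM : mxsimple rN M) (Gx : x \in G) :
  mx_rsim (submod_repr (mxsimple_module (Clifford_simple simM Gx)))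
    (conj_repr (submod_repr (mxsimple_module simM)) (nNG Gx)).
Proof.
apply: mx_rsim_sym.
pose B := in_submod (M *m rG x) (val_submod (1%:M : 'M_(\rank M)) *m rG x).
have subB : (val_submod (1%:M : 'M_(\rank M)) *m rG x <= M *m rG x)%MS.
  by rewrite submxMr ?val_submodP.
have rkM : \rank M = \rank (M *m rG x) by rewrite mxrankMfree // repr_mx_free.
exists B => // [|h Nh].
  rewrite /row_free /B mxrank_in_submod // mxrankMfree ?repr_mx_free //.
  by rewrite val_submod1 eqxx.
have Gh := subsetP sNG h Nh; have nNx := nNG Gx.
have Nhx : (h ^ x^-1)%g \in N by rewrite memJ_norm // groupV.
have modMx := mxsimple_module (Clifford_simple simM Gx).
have AB (A : 'M_(\rank M)) : A *m B = in_submod (M *m rG x) (val_submod A *m rG x).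
  rewrite /B in_submodE [in RHS]in_submodE [val_submod A]val_submodE.
  by rewrite !mulmxA.
rewrite /= AB -[submod_mx _ _]mul1mx (val_submodJ (mxsimple_module simM) _ Nhx).
have E : rN (h ^ x^-1)%g *m rG x = rG x *m rG h by rewrite /= -(repr_mxM rG (subsetP sNG _ Nhx) Gx) -(repr_mxM rG Gx Gh) -conjgCV.
rewrite -[in LHS]mulmxA E mulmxA.
by rewrite (in_submodJ modMx).
Qed.

Hypothesis irrG : mx_irreducible rG.

Lemma Clifford_simple_exists : exists M : 'M_n, mxsimple rN M.
Proof.
have nz1 : (1%:M : 'M[F]_n) != 0 by case: irrG.
have := mxsimple_exists (mxmodule1 rN) nz1 => /(_ (boolp.asbool _)) h.
have [M simM _] := boolp.asboolW (h _ (fun e => boolp.asboolT e)); by exists M.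
Qed.

Section Orbit.
Variables (M : 'M[F]_n) (simM : mxsimple rN M).

Lemma Clifford_span m (A : 'M_(n, m)) : (forall x, x \in G -> M *m rG x *m A = 0) -> A = 0.
Proof.
move=> MA0; have [X sXG [def1 _]] := Clifford_basis irrG simM.
have: (1%:M *m A <= (0 : 'M[F]_m))%MS.
  apply: submx_trans (_ : _ <= (\sum_(x in X) M *m rG x)%MS *m A)%MS _; first by rewrite submxMr // def1.
  rewrite sumsmxMr_gen.
  by apply/sumsmx_subP=> x Xx; rewrite genmxE MA0 ?sub0mx // (subsetP sXG).
by rewrite mul1mx submx0 => /eqP.
Qed.

Variable T : {group gT}.
Hypotheses (sTG : T \subset G) (iT : forall x, x \in G -> (x \in T) <-> mx_iso rN M (M *m rG x)).
Local Notation rT := (subg_repr rG sTG).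

(** By density some element of the group algebra of [N] acts as 1 on the class of [M] and as 0 on
    the other classes of translates. On the whole module it is the projection onto the homogeneous
    component of [M]. *)
Lemma Clifford_projection : exists a : 'rV_(gcard N),
  (forall x, x \in G -> M *m rG x *m ev rN a = if x \in T then M *m rG x else 0) /\
  forall n' (r' : mx_representation F N n'),
    mx_rsim (submod_repr (mxsimple_module simM)) r' -> ev r' a = 1%:M.
Proof.
have [fam] := irr_family_exists F N.
have irrU U (simU : mxsimple rN U) : mx_irreducible (submod_repr (mxsimple_module simU)).
  exact/submod_mx_irr.
have [j0 simM0] := fam_all fam (irrU M simM).
have [a [a1 a0]] := fam_separated j0 (enum (fam_ix fam)); exists a.
have ra1 n' (r' : mx_representation F N n') :
    mx_rsim (submod_repr (mxsimple_module simM)) r' -> ev r' a = 1%:M.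
  move=> sim'; apply/eqP; rewrite -subr_eq0 -(gring_mx1 r') -gring_mxB.
  rewrite (rsim_gring_mx _ (r2 := fam_repr j0)) ?gring_mxB ?gring_mx1 ?a1 ?subrr //.
  by apply: mx_rsim_trans simM0; apply: mx_rsim_sym.
split=> // x Gx.
have simMx := Clifford_simple simM Gx.
have [j simMxj] := fam_all fam (irrU _ simMx).
have [Tx|nTx] := boolP (x \in T).
  rewrite -[RHS]scale1r; apply: (mul_gring_submod (modU := mxsimple_module simMx) (submx_refl _)).
  by apply: ra1; have /iT/mx_rsim_iso iso := Tx; exact: iso.
rewrite -[RHS](scale0r (M *m rG x)); apply: (mul_gring_submod (modU := mxsimple_module simMx) (submx_refl _)).
rewrite -scalemx1 scale0r; apply/eqP; rewrite (rsim_gring_mx _ simMxj) a0 ?mem_enum //.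
apply: contraNneq nTx => eqj; rewrite eqj in simMxj.
apply/(iT Gx)/(mx_rsim_iso (mxsimple_module simM) (mxsimple_module simMx)).
by apply: mx_rsim_trans simM0 _; apply: mx_rsim_sym.
Qed.

Section Projection.
Variables (a : 'rV[F]_(gcard N)).
Hypothesis aP : forall x, x \in G -> M *m rG x *m ev rN a = if x \in T then M *m rG x else 0.
Let e := ev rN a.

Let eq_on_orbit (A B : 'M_n) : (forall x, x \in G -> M *m rG x *m A = M *m rG x *m B) -> A = B.
Proof.
move=> eqAB; apply/eqP; rewrite -subr_eq0; apply/eqP; apply: Clifford_span => x Gx.
by rewrite mulmxBr eqAB // subrr.
Qed.

Let actJ x y : x \in G -> y \in G ->
  M *m rG x *m mxconj rG e y = if (x * y^-1)%g \in T then M *m rG x else 0.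
Proof.
move=> Gx Gy; have Gy' := groupVr Gy; have Gxy := groupM Gx Gy'.
rewrite /mxconj !mulmxA -(mulmxA M) -repr_mxM // aP //.
by case: ifP => _; rewrite ?mul0mx // -mulmxA -repr_mxM ?groupM // mulgKV.
Qed.

Lemma Clifford_proj_cent y : y \in T -> e *m rG y = rG y *m e.
Proof.
move=> Ty; have Gy := subsetP sTG y Ty; apply: eq_on_orbit => x Gx; rewrite !mulmxA.
have Gxy := groupM Gx Gy.
rewrite aP // -(mulmxA M (rG x) (rG y)) -repr_mxM // aP // groupMr //.
by case: ifP => _; rewrite ?mul0mx // -mulmxA -repr_mxM.
Qed.

Lemma Clifford_proj_ortho y : y \in G -> y \notin T -> mxconj rG e y *m e = 0.
Proof.
move=> Gy nTy; apply: Clifford_span => x Gx; rewrite mulmxA actJ //.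
have [Txy|] := boolP (x * y^-1 \in T)%g; last by rewrite mul0mx.
rewrite aP //; case: ifP => // Tx; case/negP: nTy.
by rewrite -groupV -(groupMl _ Tx).
Qed.

Lemma Clifford_proj_idem : e *m e = e.
Proof. by apply: eq_on_orbit => x Gx; rewrite mulmxA !aP //; case: ifP => Tx; rewrite ?mul0mx // aP ?Tx. Qed.

Lemma Clifford_proj_sum : \sum_(X in rcosets T G) mxconj rG e (repr X) = 1%:M.
Proof.
apply: eq_on_orbit => x Gx; rewrite mulmx1 mulmx_sumr.
have RTx : (T :* x)%g \in rcosets T G by apply/rcosetsP; exists x.
rewrite (bigD1 _ RTx) /= big1 ?addr0 => [|X /andP[/rcosetsP[y Gy ->] neq]].
  case: repr_rcosetP => t Tt; have Gt := subsetP sTG t Tt.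
  by rewrite (actJ Gx (groupM Gt Gx)) invMg mulKVg groupV Tt.
case: repr_rcosetP => t Tt; have Gt := subsetP sTG t Tt; rewrite (actJ Gx (groupM Gt Gy)).
case: ifP => //; rewrite invMg mulgA groupMr ?groupV // => Txy.
by case/eqP: neq; apply/rcoset_eqP; rewrite mem_rcoset -groupV invMg invgK.
Qed.

Lemma Clifford_proj_module : mxmodule rT e.
Proof. by apply/mxmoduleP=> y Ty /=; rewrite Clifford_proj_cent // submxMl. Qed.

Lemma Clifford_proj_sub : (M <= e)%MS.
Proof.
have := aP (group1 G); rewrite group1 repr_mx1 mulmx1 => <-; exact: submxMl.
Qed.

Lemma Clifford_proj_id m (V : 'M_(m, n)) : (V <= e)%MS -> V *m e = V.
Proof. by case/submxP=> w ->; rewrite -mulmxA Clifford_proj_idem. Qed.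

(** A nonzero [T]-submodule [U] of the component generates everything under [G]; cutting back with
    [e] kills the translates by elements outside [T] and leaves [U]. *)
Lemma Clifford_proj_simple : mxsimple rT e.
Proof.
split; first exact: Clifford_proj_module.
  apply: contraTneq Clifford_proj_sub => ->; rewrite submx0.
  by case: simM.
move=> U modU sUe nzU; have [_ _ minG] := irrG.
pose S := (\sum_(x : subg_of G) U *m rG (sgval x))%MS.
have S1 : (1%:M <= S)%MS.
  apply: minG; rewrite ?submx1 //.
    apply/mxmoduleP=> x Gx; rewrite sumsmxMr; apply/sumsmx_subP=> [[y Gy]] /= _.
    by rewrite (sumsmx_sup (subg G (y * x)%g)) // subgK ?groupM // -mulmxA repr_mxM.
  rewrite -submx0; apply: contra nzU => /sumsmx_subP/(_ (subg G 1%g) isT).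
  by rewrite subgK ?group1 // repr_mx1 mulmx1 submx0.
rewrite -[e]mul1mx; apply: submx_trans (submxMr e S1) _; rewrite sumsmxMr.
apply/sumsmx_subP=> [[x Gx]] /= _.
have [Tx|nTx] := boolP (x \in T).
  by rewrite -mulmxA -Clifford_proj_cent // mulmxA Clifford_proj_id // (mxmoduleP modU).
suff -> : U *m rG x *m e = 0 by rewrite sub0mx.
rewrite -{1}(Clifford_proj_id sUe).
have -> : U *m e *m rG x *m e = U *m rG x *m (mxconj rG e x *m e).
  by rewrite /mxconj !mulmxA (repr_mxK rG Gx).
by rewrite Clifford_proj_ortho // mulmx0.
Qed.
End Projection.
End Orbit.
End Clifford.

(** * Systems of imprimitivity: modules induced from the image of an idempotent *)

Section Component.
Variables (F : fieldType) (gT : finGroupType) (G T : {group gT}) (sTG : T \subset G).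
Variables (n : nat) (rG : mx_representation F G n) (e : 'M[F]_n).
Local Notation rT := (subg_repr rG sTG).
Hypotheses (eC : forall y, y \in T -> e *m rG y = rG y *m e) (ee : e *m e = e).
Hypothesis eO : forall y, y \in G -> y \notin T -> mxconj rG e y *m e = 0.
Hypothesis eS : \sum_(X in rcosets T G) mxconj rG e (repr X) = 1%:M.

Let e_mid y : y \in G -> y \notin T -> e *m rG y *m e = 0.
Proof.
move=> Gy nTy; have -> : e *m rG y = rG y *m mxconj rG e y.
  by rewrite /mxconj !mulmxA -repr_mxM ?groupV // mulgV repr_mx1 mul1mx.
by rewrite -mulmxA eO ?mulmx0.
Qed.

Let reprG X : X \in rcosets T G -> repr X \in G.
Proof. by case/rcosetsP=> x Gx ->; case: repr_rcosetP => y Ty; rewrite groupM // (subsetP sTG). Qed.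

Lemma component_dim : n = (#|G : T|%g * \rank e)%N.
Proof.
have rk y : y \in G -> \rank (mxconj rG e y) = \rank e.
  move=> Gy; rewrite /mxconj mxrankMfree ?repr_mx_free //.
  by rewrite eqmxMfull // row_full_unit repr_mx_unit ?groupV.
have ortho X Y : X \in rcosets T G -> Y \in rcosets T G -> X != Y ->
    mxconj rG e (repr X) *m mxconj rG e (repr Y) = 0.
  move=> RX RY neq; have [GX GY] := (reprG RX, reprG RY).
  have nT : (repr X * (repr Y)^-1)%g \notin T.
    apply: contra neq => Txy; case/rcosetsP: RX GX Txy => x Gx ->; case/rcosetsP: RY GY => y Gy ->.
    case: repr_rcosetP => t Tt _; case: repr_rcosetP => u Tu _.
    rewrite invMg -mulgA groupMl // mulgA groupMr ?groupV // => Txy.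
    by apply/eqP/rcoset_eqP; rewrite mem_rcoset.
  rewrite /mxconj !mulmxA -(mulmxA _ (rG (repr X))) -repr_mxM ?groupV //.
  set z := (_ * _)%g; have -> : rG (repr X)^-1%g *m e *m rG z *m e = rG (repr X)^-1%g *m (e *m rG z *m e).
    by rewrite !mulmxA.
  by rewrite (e_mid (groupM GX (groupVr GY)) nT) mulmx0 mul0mx.
have idem X : X \in rcosets T G -> mxconj rG e (repr X) *m mxconj rG e (repr X) = mxconj rG e (repr X).
  move=> RX; rewrite /mxconj !mulmxA -(mulmxA _ (rG (repr X))) -repr_mxM ?groupV ?reprG //.
  by rewrite mulgV repr_mx1 mulmx1 -(mulmxA _ e e) ee.
have dx : mxdirect (\sum_(X in rcosets T G) mxconj rG e (repr X)).
  apply/mxdirect_sumsP=> X RX; apply/eqP; rewrite -submx0; apply/rV_subP=> v.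
  rewrite sub_capmx => /andP[/submxP[u Dv] /sub_sumsmxP[w Dv']].
  have vX : v *m mxconj rG e (repr X) = v by rewrite Dv -mulmxA idem.
  rewrite -vX Dv' mulmx_suml big1 ?sub0mx // => Y /andP[RY neq].
  by rewrite -mulmxA ortho ?mulmx0.
have full : (1%:M <= \sum_(X in rcosets T G) mxconj rG e (repr X))%MS.
  by rewrite -eS summx_sub // => X RX; apply: (sumsmx_sup X).
have/eqP := mxrankS full; rewrite mxrank1 => le_n.
apply: (@etrans _ _ (\rank (\sum_(X in rcosets T G) mxconj rG e (repr X))%MS)).
  by apply/eqP; rewrite eqn_leq rank_leq_row andbT -[n in (n <= _)%N](mxrank1 F) mxrankS.
rewrite (mxdirectP dx) /= (eq_bigr (fun=> \rank e)) => [|X RX]; last by rewrite rk ?reprG.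
by rewrite sum_nat_const.
Qed.

Variable modE : mxmodule rT e.
Local Notation rE := (submod_repr modE).

(** [V] is the inclusion of the image of [e] and [P] the projection onto it, in coordinates of that
    image. *)
Lemma component_coords : exists P : 'M_(n, \rank e), exists V : 'M_(\rank e, n),
  [/\ V *m P = 1%:M, P *m V = e, V *m e = V, e *m P = P & forall y, y \in T -> rE y = V *m rG y *m P].
Proof.
pose V1 := val_submod (1%:M : 'M[F]_(\rank e)).
have V1in : V1 *m e = V1.
  by rewrite /V1; have /submxP[w ->] := val_submodP (1%:M : 'M[F]_(\rank e)); rewrite -mulmxA ee.
have inP m (A : 'M_(m, n)) : A *m e *m in_submod e (1%:M : 'M_n) = in_submod e (A *m e).
  by rewrite [RHS]in_submodE.
exists (e *m in_submod e 1%:M), V1; split.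
- by rewrite mulmxA inP V1in val_submodK.
- have -> : e *m in_submod e 1%:M = in_submod e e by rewrite [RHS]in_submodE.
  by rewrite -val_submodE in_submodK.
- exact: V1in.
- by rewrite mulmxA ee.
move=> y Ty; rewrite -[rE y]mul1mx -[LHS]val_submodK (val_submodJ modE _ Ty).
by rewrite -[in RHS]mulmxA (mulmxA (rG y)) -eC // mulmxA mulmxA V1in in_submodE.
Qed.

Lemma component_trace x : x \in G -> \tr (rG x) =
  \sum_(X in rcosets T G) (if (x ^ (repr X)^-1)%g \in T then \tr (rE (x ^ (repr X)^-1)%g) else 0).
Proof.
move=> Gx; rewrite -[rG x]mul1mx -eS mulmx_suml raddf_sum /=; apply: eq_bigr => X RX.
have GX := reprG RX.
rewrite /mxconj -!mulmxA mxtrace_mulC -!mulmxA -(repr_mxM rG Gx (groupVr GX)) -(repr_mxM rG GX (groupM Gx (groupVr GX))).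
have -> : (repr X * (x * (repr X)^-1))%g = (x ^ (repr X)^-1)%g by rewrite conjgE invgK !mulgA.
have Gy : (x ^ (repr X)^-1)%g \in G by rewrite groupJ ?groupV.
move: (x ^ _)%g Gy => y Gy.
case: ifP => [Ty | /negbT nTy]; last by rewrite -ee -mulmxA mxtrace_mulC e_mid // mxtrace0.
have [P [V [_ PV _ _ rEE]]] := component_coords; rewrite -[X in \tr (X *m _) = _]PV -[submod_mx _ _]/(rE y) rEE // [RHS]mxtrace_mulC mulmxA. by [].
Qed.

(** Transitivity of the relative trace: the witness of the component, extended by 0, has relative
    trace [e] up to [T] and then 1 up to [G], and its trace does not change. *)
Lemma component_vertex_source W : vertex_source rE W -> vertex_source rG W.
Proof.
case=> sWT [b [cWb sumb nz_tr]]; split; first exact: subset_trans sTG.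
have [P [V [VP PV Ve eP rEE]]] := component_coords; pose c := P *m b *m V; exists c.
have Gw w : w \in T -> w \in G by apply: (subsetP sTG).
have inJ w : w \in T -> rG w *m P = P *m rE w.
  by move=> Tw; rewrite rEE // !mulmxA PV eC // -mulmxA eP.
have VJ w : w \in T -> V *m rG w = rE w *m V.
  by move=> Tw; rewrite rEE // -(mulmxA _ P) PV -mulmxA -eC // mulmxA Ve.
have cJ w : w \in W -> c *m rG w = rG w *m c.
  move=> Ww; have Tw := subsetP sWT w Ww.
  by rewrite /c -mulmxA VJ // mulmxA -(mulmxA P b) cWb // (mulmxA P) -inJ // -!mulmxA.
split=> //.
  rewrite (@sum_rcosets_trans _ _ G T W (mxconj rG c)) //; last first.
    by apply: mxconj_cent cJ; apply: subset_trans sTG.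
  rewrite -eS; apply: eq_bigr => X RX; have GX := reprG RX.
  rewrite (eq_bigr (fun Y => rG (repr X)^-1%g *m (P *m mxconj rE b (repr Y) *m V) *m rG (repr X))).
    by rewrite -mulmx_suml -mulmx_sumr -mulmx_suml -mulmx_sumr sumb mulmx1 PV.
  move=> Y RY; have TY : repr Y \in T.
    case/rcosetsP: RY => y Ty ->; case: repr_rcosetP => w Ww; rewrite groupM //; exact: (subsetP sWT).
  rewrite /mxconj /c invMg !repr_mxM ?groupV ?(Gw _ TY) //.
  move: (inJ _ (groupVr TY)) (VJ _ TY); move: (rE (repr Y)) (rE (repr Y)^-1%g) => A1 A2 E2 E1.
  by rewrite !mulmxA -(mulmxA _ A1 V) -E1 -(mulmxA _ P A2) -E2 !mulmxA.
by rewrite /c mxtrace_mulC mulmxA VP mul1mx.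
Qed.
End Component.

Lemma vertex_source_rsim (F : fieldType) (gT : finGroupType) (G : {group gT}) n1 n2
    (r1 : mx_representation F G n1) (r2 : mx_representation F G n2) W :
  mx_rsim r1 r2 -> vertex_source r1 W -> vertex_source r2 W.
Proof.
case=> B eqn; case: _ / eqn in r2 B * => freeB homB [sWG [e [cWe sum1 nz_tr]]]; split=> //.
have uB : B \in unitmx by rewrite -row_free_unit.
have hom x : x \in G -> r2 x = invmx B *m r1 x *m B.
  by move=> Gx; rewrite -mulmxA homB // mulKmx.
exists (invmx B *m e *m B); split=> [w Ww||].
- by rewrite hom ?(subsetP sWG) // !mulmxA !mulmxK // -!(mulmxA (invmx B)) cWe.
- rewrite -(mulVmx uB) -[X in _ = X *m _]mulmx1 -sum1 mulmx_sumr mulmx_suml; apply: eq_bigr => X RX.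
  have GX : repr X \in G.
    case/rcosetsP: RX => x Gx ->; case: repr_rcosetP => w Ww; rewrite groupM //; exact: (subsetP sWG).
  by rewrite /mxconj !hom ?groupV // !mulmxA !mulmxK.
by rewrite mxtrace_mulC mulmxA mulmxV // mul1mx.
Qed.

Lemma p'dim_vertex_source (F : fieldType) (p : nat) (pF : p \in [pchar F]) (gT : finGroupType)
    (G : {group gT}) n (rG : mx_representation F G n) : ~~ (p %| n)%N -> vertex_source rG G.
Proof.
move=> p'n; split=> //; exists 1%:M; split=> [w _||]; first by rewrite mulmx1 mul1mx.
  rewrite rcosets_id big_set1 /mxconj mulmx1 -repr_mxM ?groupV ?mulVg ?repr_mx1 //; exact: mem_repr (group1 G).
by rewrite mxtrace1 -(dvdn_pcharf pF).
Qed.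

(** * Constituents through annihilators, and the modular Clifford correspondence *)

Section ConstituentRepr.
Variables (F : closedFieldType) (gT : finGroupType).
Implicit Types (G H K N T : {group gT}).

(* For irreducible s this says that s is a composition factor of r. *)
Definition constt_repr G n1 n2 (r : mx_representation F G n1) (s : mx_representation F G n2) :=
  forall a, gring_mx r a = 0 -> gring_mx s a = 0.

Lemma constt_repr_trans G n1 n2 n3 (r : mx_representation F G n1) (s : mx_representation F G n2)
    (t : mx_representation F G n3) : constt_repr r s -> constt_repr s t -> constt_repr r t.
Proof. by move=> rs st a /rs/st. Qed.

Lemma constt_repr_sub G H (sHG : H \subset G) n1 n2 (r : mx_representation F G n1)
    (s : mx_representation F G n2) :
  constt_repr r s -> constt_repr (subg_repr r sHG) (subg_repr s sHG).
Proof. by move=> rs a; rewrite -!(gring_inclE sHG); apply: rs. Qed.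

Lemma constt_repr_rsim G n1 n2 (r : mx_representation F G n1) (s : mx_representation F G n2) :
  mx_rsim r s -> constt_repr r s.
Proof. by move=> sim a ra0; apply/eqP; rewrite -(rsim_gring_mx a sim) ra0. Qed.

Lemma constt_repr_irr G n1 n2 (r : mx_representation F G n1) (s : mx_representation F G n2) :
  mx_irreducible r -> mx_irreducible s -> constt_repr r s -> mx_rsim r s.
Proof.
move=> irr_r irr_s rs; apply: boolp.contrapT => nsim.
have [|a [s1 r0]] := irr_nonsim_separated irr_s irr_r; first by move/mx_rsim_sym.
have /mx_irrP[n_gt0 _] := irr_s; have := rs a r0; rewrite s1 => /eqP.
by rewrite -mxrank_eq0 mxrank1 => /eqP n0; rewrite n0 in n_gt0.
Qed.

Lemma gring_mx_subg_trans G H K (sHK : H \subset K) (sKG : K \subset G) (sHG : H \subset G)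
    n (r : mx_representation F G n) a :
  gring_mx (subg_repr (subg_repr r sKG) sHK) a = gring_mx (subg_repr r sHG) a.
Proof. by rewrite !gring_mxE. Qed.

Section Clifford.
Variables (G N T : {group gT}) (nsNG : (N <| G)%g) (sTG : T \subset G) (sNT : N \subset T).
Let sNG := normal_sub nsNG.
Let nNG := subsetP (normal_norm nsNG).
Variables (d : nat) (s : mx_representation F N d).
Hypothesis irr_s : mx_irreducible s.

(** Otherwise an element acting as 1 on [s] and as 0 on the other classes of irreducibles would kill
    all translates of a simple [N]-submodule, hence [M], hence [s]. *)
Lemma Clifford_simple_constt n (M : mx_representation F G n) : mx_irreducible M ->
    constt_repr (subg_repr M sNG) s ->
  exists (U : 'M_n) (simU : mxsimple (subg_repr M sNG) U),
    mx_rsim (submod_repr (mxsimple_module simU)) s.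
Proof.
move=> irrM cMs; have [U simU] := Clifford_simple_exists nsNG irrM.
have [fam] := irr_family_exists F N; have [j sim_sj] := fam_all fam irr_s.
have [a [a1 a0]] := fam_separated j (enum (fam_ix fam)).
apply: boolp.contrapT => no.
have /cMs : gring_mx (subg_repr M sNG) a = 0.
  apply: (Clifford_span irrM simU) => x Gx.
  have simUx := Clifford_simple simU Gx.
  have [i simi] := fam_all fam ((submod_mx_irr (mxsimple_module simUx)).2 simUx).
  rewrite -[RHS](scale0r (U *m M x)).
  apply: (mul_gring_submod (modU := mxsimple_module simUx) (submx_refl _)).
  rewrite -scalemx1 scale0r; apply/eqP; rewrite (rsim_gring_mx _ simi) a0 ?mem_enum //.
  apply/eqP => eqij; apply: no; exists (U *m M x), simUx.
  by apply: mx_rsim_trans simi _; rewrite eqij; apply: mx_rsim_sym.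
move/eqP; rewrite (rsim_gring_mx _ sim_sj) a1 => /eqP/matrixP E.
have /mx_irrP[n_gt0 _] := fam_irr j; have := E (Ordinal n_gt0) (Ordinal n_gt0).
by rewrite !mxE eqxx => /eqP; rewrite oner_eq0.
Qed.

Hypothesis iT : forall x (Gx : x \in G), x \in T <-> mx_rsim (conj_repr s (nNG Gx)) s.

(** The formula for an induced character, summed over cosets instead of over [G] with a factor
    [1 / #|T|], since [#|T|] may vanish in [F]. *)
Definition induced_trace n1 (r : mx_representation F T n1) x :=
  \sum_(X in rcosets T G) (if (x ^ (repr X)^-1)%g \in T then \tr (r (x ^ (repr X)^-1)%g) else 0).

(** The correspondent is the homogeneous component. For uniqueness, suppose [r] is not similar to
    it: the projection times an element acting as 1 on [r] and as 0 on the component kills [M],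
    hence [r]; so the projection kills [r] and [s], although it acts as 1 on [s]. *)
Lemma Clifford_correspondence n (M : mx_representation F G n) : mx_irreducible M ->
    constt_repr (subg_repr M sNG) s ->
  exists n1 (r1 : mx_representation F T n1),
  [/\ mx_irreducible r1 /\ n = (#|G : T|%g * n1)%N,
      constt_repr (subg_repr M sTG) r1, constt_repr (subg_repr r1 sNT) s,
      (forall W, vertex_source r1 W -> vertex_source M W) /\
      (forall x, x \in G -> \tr (M x) = induced_trace r1 x) &
      forall n2 (r : mx_representation F T n2), mx_irreducible r ->
        constt_repr (subg_repr M sTG) r -> constt_repr (subg_repr r sNT) s -> mx_rsim r r1].
Proof.
move=> irrM cMs; have [U [simU simUs]] := Clifford_simple_constt irrM cMs.
pose modU := mxsimple_module simU.
have iTU x : x \in G -> (x \in T) <-> mx_iso (subg_repr M sNG) U (U *m M x).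
  move=> Gx; rewrite (iT Gx).
  have simUx := Clifford_conj_rsim simU Gx.
  have simJ := conj_repr_rsim (nNG Gx) simUs.
  pose modUx := mxsimple_module (Clifford_simple simU Gx).
  apply: iff_trans (mx_rsim_iso modU modUx); split=> sim.
    apply: mx_rsim_trans simUs _; apply: mx_rsim_sym; apply: mx_rsim_trans simUx _.
    exact: mx_rsim_trans sim.
  apply: mx_rsim_trans (mx_rsim_sym simJ) _; apply: mx_rsim_trans (mx_rsim_sym simUx) _.
  by apply: mx_rsim_trans (mx_rsim_sym sim) _.
have [a [aP a1]] := Clifford_projection simU iTU.
set e := gring_mx _ a in aP.
have eC := Clifford_proj_cent irrM simU sTG aP.
have eO := Clifford_proj_ortho irrM simU aP.
have ee := Clifford_proj_idem irrM simU aP.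
have eS := Clifford_proj_sum irrM simU sTG aP.
have sUe := Clifford_proj_sub aP.
have simE := Clifford_proj_simple irrM simU sTG aP.
have modE := mxsimple_module simE.
exists (\rank e), (submod_repr modE).
have irrE := (submod_mx_irr modE).2 simE.
split=> [||||n2 r irr_r cr csr].
- by split=> //; apply: (component_dim sTG ee eO eS).
- by move=> b b0; rewrite gring_mx_submod b0 mulmx0 linear0.
- move=> b b0; apply: (constt_repr_rsim simUs).
  have U0 : U *m gring_mx (subg_repr M sNG) b = 0 *: U.
    rewrite -(gring_mx_subg_trans sNT sTG) -gring_inclE.
    by apply: (mul_gring_submod (modU := modE)) => //; rewrite gring_inclE b0 -scalemx1 scale0r.
  rewrite gring_mx_submod; have /submxP[w ->] := val_submodP (1%:M : 'M[F]_(\rank U)).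
  by rewrite -mulmxA U0 scale0r mulmx0 linear0.
- by split; [apply: (component_vertex_source eC ee eS) | apply: (component_trace eC ee eO eS)].
apply: boolp.contrapT => nsim; have [b [rb1 eb0]] := irr_nonsim_separated irr_r irrE nsim.
pose c := gring_incl T a *m gring_mx (regular_repr F T) b.
have /cr : gring_mx (subg_repr M sTG) c = 0.
  rewrite gring_mxA gring_inclE (gring_mx_subg_trans sNT sTG sNG) -/e.
  by rewrite -[RHS](scale0r e); apply: (mul_gring_submod (modU := modE)); rewrite // eb0 -scalemx1 scale0r.
rewrite gring_mxA rb1 mulmx1 gring_inclE => ra0.
have /matrixP := csr a ra0; rewrite a1 // => E.
have /mx_irrP[n_gt0 _] := irr_s; have := E (Ordinal n_gt0) (Ordinal n_gt0).
by rewrite !mxE eqxx => /eqP; rewrite oner_eq0.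
Qed.

Lemma irr_trace_rsim H n1 n2 (r1 : mx_representation F H n1) (r2 : mx_representation F H n2) :
    mx_irreducible r1 -> mx_irreducible r2 ->
    (forall x, x \in H -> \tr (r1 x) = \tr (r2 x)) ->
  mx_rsim r1 r2.
Proof.
move=> irr1 irr2 eqtr; have [fam] := irr_family_exists F H.
have [i sim1] := fam_all fam irr1; have [j sim2] := fam_all fam irr2.
have [eqij|neq] := eqVneq i j.
  by apply: mx_rsim_trans sim1 _; rewrite eqij; apply: mx_rsim_sym.
suff /(_ i)/eqP : forall k : fam_ix fam, (k == i)%:R - (k == j)%:R = 0 :> F.
  by rewrite eqxx (negPf neq) subr0 oner_eq0.
apply: fam_trace_free => x Hx.
under eq_bigr do rewrite mulrBl; rewrite sumrB.
rewrite (bigD1 i) //= big1 => [|k /negPf->]; last by rewrite mul0r.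
rewrite (bigD1 j) //= big1 => [|k /negPf->]; last by rewrite mul0r.
by rewrite !eqxx !mul1r !addr0 -(mxtrace_rsim sim1) // -(mxtrace_rsim sim2) // eqtr // subrr.
Qed.

Lemma induced_trace_rsim n1 n2 (r1 : mx_representation F T n1) (r2 : mx_representation F T n2) x :
  mx_rsim r1 r2 -> induced_trace r1 x = induced_trace r2 x.
Proof. by move=> sim; apply: eq_bigr => X _; case: ifP => // Tx; apply: mxtrace_rsim. Qed.

(** Both traces are induced from the same correspondent, and an irreducible representation over a
    closed field is determined by its trace, even in characteristic p. *)
Lemma Clifford_rsim n1 n2 (M1 : mx_representation F G n1) (M2 : mx_representation F G n2)
    m (r : mx_representation F T m) :
    mx_irreducible M1 -> mx_irreducible M2 -> mx_irreducible r -> constt_repr (subg_repr r sNT) s ->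
    constt_repr (subg_repr M1 sTG) r -> constt_repr (subg_repr M2 sTG) r ->
  mx_rsim M1 M2.
Proof.
move=> irr1 irr2 irr_r rs M1r M2r.
have over n (M : mx_representation F G n) : constt_repr (subg_repr M sTG) r -> constt_repr (subg_repr M sNG) s.
  move=> Mr a a0; apply: rs; apply: (constt_repr_sub (sHG := sNT) Mr).
  by rewrite (gring_mx_subg_trans sNT sTG sNG).
have [k1 [r1 [_ _ _ [_ tr1] u1]]] := Clifford_correspondence irr1 (over _ _ M1r).
have [k2 [r2 [_ _ _ [_ tr2] u2]]] := Clifford_correspondence irr2 (over _ _ M2r).
apply: irr_trace_rsim => // x Gx; rewrite tr1 // tr2 //; apply: induced_trace_rsim.
by apply: mx_rsim_trans (u2 _ _ irr_r M2r rs); apply: mx_rsim_sym; apply: u1.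
Qed.

Section Brauer.
Variables (p : nat) (lam : F -> algC).
Hypothesis setup : brauer_setup p lam.
Local Notation bval := (brauer_val lam).

(** [R] stands for the reduction of an induced character: it has the dimension of the induced
    module, and its restriction has [r] as a factor. A composition factor of [R] over [r] has [r] as
    its Clifford correspondent, so it already has the full dimension. *)
Lemma Clifford_induced n (R : mx_representation F G n) m (r : mx_representation F T m) :
    mx_irreducible r -> constt_repr (subg_repr r sNT) s -> n = (#|G : T|%g * m)%N ->
    (exists m' (r' : mx_representation F T m'),
      forall x, x \in T -> p^'.-elt%g x -> bval R x = bval r x + bval r' x) ->
  exists n1 (M : mx_representation F G n1),
    [/\ mx_irreducible M, forall x, x \in G -> bval M x = bval R x & constt_repr (subg_repr M sTG) r].
Proof.
move=> irr_r rs Dn [m' [r' DR]]; have [fG] := irr_family_exists F G; have [fT] := irr_family_exists F T.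
have [mR [bR _ _]] := rep_brauer_decomposition lam fG R.
have /fin_all_exists[mT DmT] := fun i : fam_ix fG =>
  rep_brauer_decomposition lam fT (subg_repr (fam_repr i) sTG).
have [mr' [br' _ _]] := rep_brauer_decomposition lam fT r'.
have [j simj] := fam_all fT irr_r.
have /(_ j) : (fun k => \sum_i mT i k * mR i)%N =1 (fun k => (k == j) + mr' k)%N.
  apply: (fam_mult_uniq setup) => x Tx p'x; transitivity (bval R x).
    rewrite bR ?(subsetP sTG) //; under eq_bigr do rewrite -sumrMnr.
    rewrite exchange_big /=; apply: eq_bigr => i _; have [/(_ x Tx) Di _ _] := DmT i.
    rewrite -[X in _ = X *+ _]/(bval (subg_repr (fam_repr i) sTG) x) Di.
    by rewrite -sumrMnl; apply: eq_bigr => k _; rewrite mulrnA.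
  rewrite DR // (brauer_val_rsim lam simj) // br' //.
  rewrite [X in X + _](_ : _ = \sum_k bval (fam_repr k) x *+ (k == j)); last first.
    rewrite (bigD1 j) //= eqxx big1 ?addr0 // => k /negPf->; exact: mulr0n.
  by rewrite -big_split /=; apply: eq_bigr => k _; rewrite mulrnDr.
rewrite eqxx => Dsum.
have [i] : exists i, (0 < mT i j * mR i)%N.
  apply/existsP; rewrite -[[exists _, _]]negbK negb_exists; apply/negP => /forallP all0.
  by move: Dsum; rewrite big1 // => i _; apply/eqP; rewrite eqn0Ngt all0.
rewrite muln_gt0 => /andP[mT_gt0 mR_gt0].
have irrM := fam_irr i.
have Mr : constt_repr (subg_repr (fam_repr i) sTG) r.
  move=> a a0; have [_ _ cT] := DmT i; apply: (constt_repr_rsim (mx_rsim_sym simj)).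
  exact: cT mT_gt0.
have Ms : constt_repr (subg_repr (fam_repr i) sNG) s.
  move=> a a0; apply: rs; apply: (constt_repr_sub (sHG := sNT) Mr).
  by rewrite (gring_mx_subg_trans sNT sTG sNG).
have [m1 [r1 [[irr1 Dm1] _ _ _ u1]]] := Clifford_correspondence irrM Ms.
have Em : m1 = m by case: (u1 _ _ irr_r Mr rs).
exists (fam_dim i), (fam_repr i); split=> // x Gx.
have dim_gt0 k : (0 < @fam_dim _ _ _ fG k)%N by have /mx_irrP[] := fam_irr k.
(* The factor [i] fills the dimension [n], which leaves room neither for a second copy nor for other
   factors. *)
have Dsum' : (n = n * mR i + \sum_(k | k != i) fam_dim k * mR k)%N.
  have := bR _ (group1 G); rewrite (brauer_val1 setup).
  rewrite (eq_bigr (fun k => (fam_dim k * mR k)%:R)) => [|k _]; last by rewrite (brauer_val1 setup) -mulrnA.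
  by move/eqP; rewrite -natr_sum Num.Theory.eqr_nat (bigD1 i) //= Dm1 Em -Dn => /eqP.
have [mR1 others] : mR i = 1%N /\ (\sum_(k | k != i) fam_dim k * mR k = 0)%N.
  have n_gt0 : (0 < n)%N by rewrite Dn -Em -Dm1.
  move: Dsum' mR_gt0; case: (mR i) => [|[|k]] // E _.
    by split=> //; apply/eqP; move/eqP: E; rewrite muln1 -{1}[n]addn0 eqn_add2l eq_sym.
  by move/eqP: E; rewrite !mulnS -!addnA -{1}[n]addn0 eqn_add2l eq_sym addn_eq0 eqn0Ngt n_gt0.
rewrite bR // (bigD1 i) //= mR1 mulr1n big1 ?addr0 // => k neq.
move/eqP: others; rewrite sum_nat_eq0 => /forallP/(_ k); rewrite neq muln_eq0 /=.
by rewrite eqn0Ngt dim_gt0 => /eqP->.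
Qed.
End Brauer.
End Clifford.
End ConstituentRepr.

Lemma idempotent_trace (F : fieldType) n (e : 'M[F]_n) : e *m e = e -> \tr e = (\rank e)%:R.
Proof.
move=> ee; have rc : row_base e *m col_base e = 1%:M.
  apply: (row_free_inj (row_base_free e)); apply: (row_full_inj (col_base_full e)).
  by rewrite mul1mx mulmx_base -mulmxA mulmx_base mulmxA mulmx_base.
by rewrite -[X in \tr X](mulmx_base e) mxtrace_mulC rc mxtrace1.
Qed.

(** * Consequences of semisimplicity on a normal subgroup: dimensions, vertices, p-quotients *)

Section Semisimple.
Variables (F : closedFieldType) (gT : finGroupType) (G N : {group gT}).
Hypothesis nsNG : (N <| G)%g.
Let sNG := normal_sub nsNG.

Lemma Clifford_projector n (M : mx_representation F G n) (U : 'M_n) :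
    mx_irreducible M -> mxsimple (subg_repr M sNG) U ->
  exists e : 'M_n, [/\ forall x, x \in N -> e *m M x = M x *m e, (e <= U)%MS, U *m e = U,
     e *m e = e & \tr e = (\rank U)%:R].
Proof.
move=> irrM simU; have [X /subsetP sXG [def1 _]] := Clifford_basis irrM simU.
have ss1 : mxsemisimple (subg_repr M sNG) 1%:M.
  by apply: intro_mxsemisimple def1 _ => x Xx _; apply: (Clifford_simple simU); apply: sXG.
have modU := mxsimple_module simU.
have [W modW defV /mxdirect_addsP dxUW] := mxsemisimple_reducible ss1 modU (submx1 U).
have UeU : U *m proj_mx U W = U by rewrite proj_mx_id.
have eU : (proj_mx U W <= U)%MS by rewrite -[proj_mx U W]mul1mx proj_mx_sub.
have ee : proj_mx U W *m proj_mx U W = proj_mx U W by rewrite proj_mx_id.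
exists (proj_mx U W); split=> // [x Nx|].
  have /hom_mxP hom : (1%:M <= dom_hom_mx (subg_repr M sNG) (proj_mx U W))%MS.
    by rewrite -defV proj_mx_hom.
  by have := hom x Nx; rewrite !mul1mx => ->.
rewrite idempotent_trace //; congr (_%:R); apply/eqP; rewrite eqn_leq mxrankS //=.
by rewrite -{1}UeU mxrankM_maxr.
Qed.

Lemma irr_cent_scalar n (M : mx_representation F G n) (A : 'M_n) : mx_irreducible M ->
  (forall x, x \in G -> A *m M x = M x *m A) -> exists c, A = c%:M.
Proof.
move=> irrM cA; apply/is_scalar_mxP.
apply: (mx_abs_irr_cent_scalar (group_closure_closed_field irrM)).
by apply/centgmxP=> x Gx; rewrite cA.
Qed.

Variable p : nat.
Hypotheses (p_pr : prime p) (pF : p \in [pchar F]).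

(** Sum the conjugates of a projector onto [s] over the cosets of [N]. By Schur's lemma the sum is a
    scalar, and its trace [#|G : N| * d] is nonzero in [F]; so [n] is nonzero in [F] too. *)
Lemma p'_quotient_p'dim n d (M : mx_representation F G n) (s : mx_representation F N d) :
    mx_irreducible M -> mx_irreducible s -> constt_repr (subg_repr M sNG) s ->
    ~~ (p %| #|G : N|%g)%N -> ~~ (p %| d)%N -> ~~ (p %| n)%N.
Proof.
move=> irrM irr_s Ms p'ind p'd.
have [U [simU [_ eqd _ _]]] := Clifford_simple_constt irr_s irrM Ms.
have [e [eC _ _ _ tr_e]] := Clifford_projector irrM simU.
pose A := \sum_(X in rcosets N G) mxconj M e (repr X).
have reprG X : X \in rcosets N G -> repr X \in G.
  by case/rcosetsP=> x Gx ->; case: repr_rcosetP => y Ny; rewrite groupM // (subsetP sNG).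
have gN := mxconj_cent sNG eC.
have [|c Dc] := irr_cent_scalar irrM (A := A).
  move=> x Gx; rewrite /A mulmx_suml mulmx_sumr.
  rewrite [in RHS](reindex_onto (fun X => X :* x)%g (fun X => X :* x^-1)%g) /=; last first.
    by move=> X _; rewrite -rcosetM mulVg mulg1.
  apply: eq_big => [X|X RX].
    rewrite -rcosetM mulgV mulg1 eqxx andbT; apply/rcosetsP/rcosetsP=> [[y Gy ->]|[y Gy DX]].
      by exists (y * x)%g; rewrite ?groupM // rcosetM.
    exists (y * x^-1)%g; rewrite ?groupM ?groupV // rcosetM -DX -rcosetM mulgV mulg1 //.
  case/rcosetsP: RX => y Gy ->; rewrite -rcosetM.
  case: repr_rcosetP => u Nu; case: repr_rcosetP => v Nv.
  rewrite gN // gN ?(groupM Gy Gx) // /mxconj invMg !repr_mxM ?groupV // !mulmxA.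
  by rewrite -repr_mxM ?groupV // mulgV repr_mx1 mul1mx.
have : \tr A != 0.
  rewrite raddf_sum /= (eq_bigr (fun=> d%:R)) => [|X RX]; last first.
    rewrite /mxconj -mulmxA mxtrace_mulC -mulmxA -repr_mxM ?groupV ?reprG //.
    by rewrite mulgV repr_mx1 mulmx1 tr_e eqd.
  by rewrite sumr_const -mulrnA -(dvdn_pcharf pF) Euclid_dvdM // negb_or p'd.
by rewrite Dc mxtrace_scalar (dvdn_pcharf pF); apply: contraNN => /eqP n0; rewrite -mulr_natr n0 mulr0.
Qed.

(** The projector onto [s] commutes with [P] and has trace [d], nonzero in [F]; the trace criterion
    then puts [P] inside a conjugate of [Q], and an order count finishes. *)
Lemma vertex_normal_sylow n d (M : mx_representation F G n) (s : mx_representation F N d) (Q P : {group gT}) :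
    mx_irreducible M -> mx_irreducible s -> constt_repr (subg_repr M sNG) s ->
    ~~ (p %| d)%N -> rel_proj M Q -> (p.-group Q)%g -> (p.-Sylow(N) P)%g ->
  (p.-Sylow(N) (Q :&: N))%g.
Proof.
move=> irrM irr_s Ms p'd projQ pQ sylP.
have [U [simU [_ eqd _ _]]] := Clifford_simple_constt irr_s irrM Ms.
have [e [eC _ _ _ tr_e]] := Clifford_projector irrM simU.
have sPN := pHall_sub sylP.
have [||t Gt sPQ] := rel_proj_sub p_pr pF (subset_trans sPN sNG) (pHall_pgroup sylP) projQ _ _ (e := e).
- by move=> x /(subsetP sPN)/eC.
- by rewrite tr_e eqd -(dvdn_pcharf pF).
have pQN := pgroupS (subsetIl Q N) pQ.
rewrite pHallE subsetIr /= eqn_leq; apply/andP; split.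
  by rewrite -(part_pnat_id pQN) dvdn_leq // partn_dvd ?cardG_gt0 // cardSg ?subsetIr.
rewrite -(card_Hall sylP) -(cardJg (Q :&: N) t) conjIg (normsP (normal_norm nsNG)) //.
by rewrite subset_leq_card // subsetI sPQ.
Qed.

(** The p-group [G / N] acts on the nonzero space of [N]-homomorphisms from [r1] to [r2]; in
    characteristic p it has a nonzero fixed point, which is a [G]-homomorphism. *)
Lemma p_quotient_irr_rsim n1 n2 d (r1 : mx_representation F G n1) (r2 : mx_representation F G n2)
    (s : mx_representation F N d) :
    (p.-group (G / N))%g -> mx_irreducible s -> mx_irreducible r1 -> mx_irreducible r2 ->
    constt_repr (subg_repr r1 sNG) s -> constt_repr (subg_repr r2 sNG) s ->
  mx_rsim r1 r2.
Proof.
move=> pGN irr_s irr1 irr2 r1s r2s.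
pose h x : 'M_(n1 * n2) := lin_mx ((mulmx (r1 x^-1%g) \o mulmxr (r2 x)) : 'M_(n1, n2) -> 'M_(n1, n2)).
have hE x B : mxvec B *m h x = mxvec (r1 x^-1%g *m (B *m r2 x)) by rewrite /h mul_vec_lin.
have h_repr : mx_repr G h.
  split=> [|x y Gx Gy]; apply/row_matrixP=> i; rewrite !rowE -[delta_mx _ _]vec_mxK.
    by rewrite hE invg1 !repr_mx1 mulmx1 mul1mx mulmx1.
  by rewrite mulmxA !hE invMg !repr_mxM ?groupV // !mulmxA.
pose rH := MxRepresentation h_repr; pose W := rfix_mx rH N.
have modW : mxmodule rH W by apply: normal_rfix_mx_module.
have nzW : W != 0.
  have [f nzf homf] : exists2 f : 'M_(n1, n2), f != 0 & forall x, x \in N -> f *m r2 x = r1 x *m f.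
    have [U1 [sim1 simU1]] := Clifford_simple_constt irr_s irr1 r1s.
    have [U2 [sim2 simU2]] := Clifford_simple_constt irr_s irr2 r2s.
    have [e [eC eU Ue _ _]] := Clifford_projector irr1 sim1.
    have [B eqr freeB homB] := mx_rsim_trans simU1 (mx_rsim_sym simU2).
    pose V := val_submod (1%:M : 'M_(\rank U2)).
    have VE m (A : 'M_(m, _)) : A *m V = val_submod A by rewrite [RHS]val_submodE.
    exists (in_submod U1 e *m B *m V).
      have [_ nzU1 _] := sim1; apply: contraNneq nzU1 => f0; rewrite -Ue.
      suff -> : e = 0 by rewrite mulmx0.
      rewrite -(in_submodK eU); suff -> : in_submod U1 e = 0 by rewrite linear0.
      apply: (row_free_inj freeB); rewrite mul0mx; apply: val_submod_inj.
      by rewrite linear0 -VE f0.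
    move=> x Nx; have : submod_mx (mxsimple_module sim1) x *m B = B *m submod_mx (mxsimple_module sim2) x := homB x Nx.
    have := val_submodJ (mxsimple_module sim2) (1%:M : 'M_(\rank U2)) Nx; rewrite mul1mx -/V -VE.
    have := in_submodJ (mxsimple_module sim1) x eU; rewrite [subg_repr _ _ x]/(r1 x) (eC x Nx).
    have -> : in_submod U1 (r1 x *m e) = r1 x *m in_submod U1 e by rewrite [LHS]in_submodE [in_submod U1 e]in_submodE [RHS]mulmxA.
    clearbody V; clear VE; move: (in_submod U1 e) => P; move: (submod_mx _ _) => S1; move: (submod_mx _ _) => S2 E1 E2 E3.
    by rewrite -!mulmxA -E2 (mulmxA (r1 x)) E1 -(mulmxA P) (mulmxA S1) E3 !mulmxA.
  apply/eqP => W0; case/eqP: nzf; apply: (can_inj mxvecK); rewrite linear0; apply/eqP.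
  rewrite -submx0 -W0; apply/rfix_mxP=> x Nx; have Gx := subsetP sNG x Nx.
  by rewrite hE homf // mulmxA -repr_mxM ?groupV // mulVg repr_mx1 mul1mx.
pose rU := submod_repr modW.
have rUE m (v : 'M_(m, \rank W)) x : x \in G -> val_submod (v *m rU x) = val_submod v *m rH x.
  by move=> Gx; apply: (val_submodJ modW).
have krU : N \subset rker rU.
  apply/subsetP=> x Nx; have Gx := subsetP sNG x Nx; rewrite inE Gx /= mul1mx; apply/eqP.
  rewrite -[submod_mx _ _]mul1mx; apply: val_submod_inj; rewrite rUE //.
  by move/rfix_mxP: (val_submodP (1%:M : 'M[F]_(\rank W))) => ->.
pose rQ := quo_repr krU (normal_norm nsNG).
have [v] : exists2 v : 'rV_(\rank W), (v <= rfix_mx rQ (G / N)%g)%MS & v != 0.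
  by apply/rowV0Pn; apply: (rfix_pgroup_pchar pF) => //; rewrite lt0n mxrank_eq0.
move/rfix_mxP=> fixv nzv; pose B := vec_mx (val_submod v) : 'M_(n1, n2).
apply: (irr_hom_rsim irr1 irr2 (f := B)).
  apply: contraNneq nzv => B0; apply/eqP/val_submod_inj; rewrite linear0.
  by rewrite -[LHS]vec_mxK -/B B0 linear0.
move=> x Gx; have := fixv (coset N x) (mem_quotient _ Gx).
rewrite [rQ _](quo_mx_coset krU (normal_norm nsNG) Gx) => /(congr1 (fun w => val_submod w)); rewrite rUE //.
rewrite -[val_submod v]vec_mxK -/B hE => /(can_inj mxvecK) {1}<-.
by rewrite !mulmxA -repr_mxM ?groupV // mulgV repr_mx1 mul1mx.
Qed.
End Semisimple.

(** * Restriction to a Hall p'-subgroup *)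

Section HomExtension.
Variables (F : closedFieldType) (gT : finGroupType) (G N H : {group gT}).
Hypotheses (nsNG : (N <| G)%g) (sHG : H \subset G) (defG : (N * H)%g = G).
Let sNG := normal_sub nsNG.
Let nNG := subsetP (normal_norm nsNG).
Local Notation D := (N :&: H)%G.
Let sDN : D \subset N := subsetIl N H.
Let sDH : D \subset H := subsetIr N H.
Let sDG : D \subset G. Proof. exact: subset_trans sDN sNG. Qed.
Variables (d : nat) (s : mx_representation F N d).
Hypothesis irr_s : mx_irreducible s.
Hypothesis irrD : forall g (Gg : g \in G), mx_irreducible (subg_repr (conj_repr s (nNG Gg)) sDN).
Hypothesis injD : forall g h (Gg : g \in G) (Gh : h \in G),
  mx_rsim (subg_repr (conj_repr s (nNG Gg)) sDN) (subg_repr (conj_repr s (nNG Gh)) sDN) ->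
  mx_rsim (conj_repr s (nNG Gg)) (conj_repr s (nNG Gh)).

(** The conjugates of [s] stay irreducible on [D] and stay dissimilar when they were so on [N], so
    density on [D] provides an element acting as [x] on all of them. It does not depend on [M],
    which lets it compare two modules. *)
Lemma restricted_gring_elt x : x \in N -> exists b : 'rV_(gcard D),
  forall n (M : mx_representation F G n), mx_irreducible M -> constt_repr (subg_repr M sNG) s ->
    gring_mx (subg_repr M sDG) b = M x.
Proof.
move=> Nx; have [fam] := irr_family_exists F D.
have exC (j : fam_ix fam) : exists C : 'M[F]_(fam_dim j), forall g (Gg : g \in G),
    mx_rsim (fam_repr j) (subg_repr (conj_repr s (nNG Gg)) sDN) ->
    forall b, gring_mx (fam_repr j) b = C -> exists h (Gh : h \in G),
      mx_rsim (fam_repr j) (subg_repr (conj_repr s (nNG Gh)) sDN) /\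
      gring_mx (subg_repr (conj_repr s (nNG Gh)) sDN) b = conj_repr s (nNG Gh) x.
  have [[h [Gh sim]]|no] := boolp.pselect (exists h (Gh : h \in G),
      mx_rsim (fam_repr j) (subg_repr (conj_repr s (nNG Gh)) sDN)); last first.
    by exists 0 => g Gg sim; case: no; exists g, Gg.
  have [B [B' B'B defr]] := mx_rsim_def (mx_rsim_sym sim).
  have [_ [_ BB' _]] : True /\ exists2 eqd : fam_dim j = d, B *m B' = 1%:M & True.
    split=> //; have [_ eqd _ _] := sim; exists eqd => //.
    by case: _ / eqd B B' B'B {defr} => B B'; apply: mulmx1C.
  exists (B' *m conj_repr s (nNG Gh) x *m B) => g Gg sim' b Db; exists h, Gh; split=> //.
  suff -> : gring_mx (subg_repr (conj_repr s (nNG Gh)) sDN) b = B *m gring_mx (fam_repr j) b *m B'.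
    by rewrite Db !mulmxA BB' mul1mx -mulmxA BB' mulmx1.
  rewrite !gring_mxE mulmx_sumr mulmx_suml; apply: eq_bigr => i _.
  by rewrite defr ?enum_valP // -scalemxAr -scalemxAl.
have [C CP] := fin_all_exists exC.
have [b Db] := fam_onto C; exists b => n M irrM Ms.
have conjb g (Gg : g \in G) :
    gring_mx (conj_repr s (nNG Gg)) (gring_incl N b - gring_row (regular_repr F N x)) = 0.
  have [j simj] := fam_all fam (irrD Gg).
  have [h [Gh [simh eqh]]] := CP j g Gg (mx_rsim_sym simj) b (Db j).
  apply/eqP; rewrite (rsim_gring_mx _ (r2 := conj_repr s (nNG Gh))).
    by rewrite gring_mxB (gring_inclE sDN) eqh gring_mxG // subrr.
  by apply: injD; apply: mx_rsim_trans simj simh.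
have [U [simU simUs]] := Clifford_simple_constt irr_s irrM Ms.
apply/eqP; rewrite -subr_eq0; apply/eqP.
have <- : gring_mx (subg_repr M sNG) (gring_incl N b - gring_row (regular_repr F N x)) =
    gring_mx (subg_repr M sDG) b - M x.
  by rewrite gring_mxB (gring_inclE sDN) (gring_mx_subg_trans sDN sNG sDG) gring_mxG.
apply: (Clifford_span irrM simU) => y Gy.
pose simUy := Clifford_simple simU Gy.
rewrite -[RHS](scale0r (U *m M y)).
apply: (mul_gring_submod (modU := mxsimple_module simUy) (submx_refl _)).
rewrite -scalemx1 scale0r; apply/eqP; rewrite (rsim_gring_mx _ (r2 := conj_repr s (nNG Gy))) ?conjb //.
by apply: mx_rsim_trans (Clifford_conj_rsim simU Gy) _; apply: conj_repr_rsim.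
Qed.

Lemma restricted_hom n1 n2 (M1 : mx_representation F G n1) (M2 : mx_representation F G n2) f :
    mx_irreducible M1 -> mx_irreducible M2 ->
    constt_repr (subg_repr M1 sNG) s -> constt_repr (subg_repr M2 sNG) s ->
    (forall h, h \in H -> M1 h *m f = f *m M2 h) ->
  forall g, g \in G -> M1 g *m f = f *m M2 g.
Proof.
move=> irr1 irr2 M1s M2s homf g Gg; have := Gg; rewrite -[in X in X -> _]defG => /mulsgP[x h Nx Hh ->].
have Gx := subsetP sNG x Nx; have Gh := subsetP sHG h Hh.
have homx : M1 x *m f = f *m M2 x.
  have [b Db] := restricted_gring_elt Nx; rewrite -(Db _ _ irr1 M1s) -(Db _ _ irr2 M2s).
  rewrite !gring_mxE mulmx_suml mulmx_sumr; apply: eq_bigr => i _.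
  by rewrite -scalemxAl -scalemxAr homf //; apply: (subsetP sDH); apply: enum_valP.
by rewrite !repr_mxM // -mulmxA homf // !mulmxA homx.
Qed.

(** Maschke's theorem gives an [H]-projection onto a submodule; it commutes with [G] by
    [restricted_hom], so it is a scalar. *)
Lemma restricted_irr n (M : mx_representation F G n) : [pchar F]^'.-group%g H ->
    mx_irreducible M -> constt_repr (subg_repr M sNG) s ->
  mx_irreducible (subg_repr M sHG).
Proof.
move=> F'H irrM Ms; have /mx_irrP[n_gt0 _] := irrM; apply/mx_irrP; split=> // U modU nzU.
have [W modW defV /mxdirect_addsP dxUW] :=
  mx_Maschke_pchar (subg_repr M sHG) F'H modU (submx1 U).
have UeU : U *m proj_mx U W = U by rewrite proj_mx_id.
have eU : (proj_mx U W <= U)%MS by rewrite -[proj_mx U W]mul1mx proj_mx_sub.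
have /hom_mxP hom : (1%:M <= dom_hom_mx (subg_repr M sHG) (proj_mx U W))%MS.
  by rewrite -defV proj_mx_hom.
have [|c Dc] := irr_cent_scalar irrM (A := proj_mx U W).
  move=> x Gx; apply/esym; apply: (restricted_hom irrM irrM Ms Ms _ Gx) => h Hh.
  by have := hom h Hh; rewrite !mul1mx.
have c1 : c != 0.
  by apply: contraNneq nzU => c0; rewrite -UeU Dc c0 -scalemx1 scale0r mulmx0.
by rewrite -sub1mx -(eqmx_scale _ c1) scalemx1 -Dc.
Qed.

Lemma restricted_rsim n1 n2 (M1 : mx_representation F G n1) (M2 : mx_representation F G n2) :
    mx_irreducible M1 -> mx_irreducible M2 ->
    constt_repr (subg_repr M1 sNG) s -> constt_repr (subg_repr M2 sNG) s ->
  mx_rsim (subg_repr M1 sHG) (subg_repr M2 sHG) -> mx_rsim M1 M2.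
Proof.
move=> irr1 irr2 M1s M2s [B eqd freeB homB].
apply: (irr_hom_rsim irr1 irr2 (f := B)); last exact: restricted_hom homB.
have /mx_irrP[n1_gt0 _] := irr1; rewrite -mxrank_eq0.
by move: freeB; rewrite /row_free => /eqP ->; rewrite -lt0n.
Qed.
End HomExtension.

(** For [X] with rows in a submodule [U] and nonzero trace, the average has its rows in [U] and is
    an invertible scalar. *)
Lemma averaging_irr (F : closedFieldType) (gT : finGroupType) (G : {group gT}) n
    (r : mx_representation F G n) (c : F) : (0 < n)%N -> c != 0 ->
    (forall X, \sum_(x in G) r x^-1%g *m X *m r x = (c * \tr X)%:M) ->
  mx_irreducible r.
Proof.
move=> n_gt0 nzc avg; apply/mx_irrP; split=> // U modU nzU.
have [i nzi] : exists i, row i U != 0.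
  by apply/existsP; apply: contraNT nzU; rewrite negb_exists => /forallP U0; apply/eqP/row_matrixP=> i; rewrite row0; apply/eqP; rewrite -[_ == _]negbK U0.
have [j nzj] : exists j, U i j != 0.
  apply/existsP; apply: contraNT nzi; rewrite negb_exists => /forallP U0; apply/eqP/rowP=> j.
  by rewrite !mxE; apply/eqP; rewrite -[_ == _]negbK U0.
pose X := delta_mx j 0 *m row i U : 'M_n.
have trX : \tr X = U i j.
  rewrite mxtrace_mulC /mxtrace big_ord1 mxE (bigD1 j) //= big1 => [|k /negPf nk]; rewrite !mxE ?eqxx.
    by rewrite mulr1 addr0.
  by rewrite nk mulr0.
have : ((c * U i j)%:M <= U)%MS.
  rewrite -trX -avg summx_sub // => x Gx; rewrite -mulmxA mulmx_sub //.
  by rewrite (mxmodule_trans modU Gx) // mulmx_sub // row_sub.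
by rewrite -scalemx1 eqmx_scale ?mulf_neq0 // sub1mx.
Qed.

(** * Characters and their reductions; the case of p'-groups *)

Section Reduction.
Variables (F : closedFieldType) (p : nat) (lam : F -> algC).
Hypothesis setup : brauer_setup p lam.
Let p_pr : prime p. Proof. by case: setup. Qed.
Let pF : p \in [pchar F]. Proof. by case: setup. Qed.
Variable gT : finGroupType.
Implicit Types (G H N : {group gT}).
Local Notation bval := (brauer_val lam).
Local Notation ev rG := (gring_mx rG).

(** This determines only the composition factors of [r], so it pins [r] down up to similarity when
    [r] is irreducible. *)
Definition reduces G (chi : 'CF(G)) n (r : mx_representation F G n) :=
  forall x, x \in G -> p^'.-elt%g x -> bval r x = chi x.

Lemma reduces_exists G (chi : 'CF(G)) : chi \is a character ->
  exists n (r : mx_representation F G n), reduces chi r.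
Proof.
case/char_reprP=> rG ->; have [r [Dr _]] := rep_reduction setup rG.
by exists (rdegree rG), r => x Gx p'x; rewrite Dr // cfunE Gx.
Qed.

Lemma reduces_deg G (chi : 'CF(G)) n (r : mx_representation F G n) : reduces chi r -> chi 1%g = n%:R.
Proof. by move=> red; rewrite -red ?group1 ?(brauer_val1 setup) // /p_elt order1. Qed.

Lemma reduces_sub G H (sHG : H \subset G) (chi : 'CF(G)) n (r : mx_representation F G n) :
  reduces chi r -> reduces ('Res[H] chi) (subg_repr r sHG).
Proof.
by move=> red x Hx p'x; rewrite cfResE // -red // (subsetP sHG).
Qed.

Lemma reduces_conj G N (nsNG : (N <| G)%g) (nu : 'CF(N)) n (r : mx_representation F N n) g
    (nNg : g \in ('N(N))%g) :
  reduces nu r -> reduces (nu ^ g)%CF (conj_repr r nNg).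
Proof.
move=> red x Nx p'x; rewrite cfConjgE // -red ?memJ_norm ?groupV //.
by rewrite /p_elt orderJ.
Qed.

Lemma reduces_irr_rsim G (chi : 'CF(G)) n1 n2 (r1 : mx_representation F G n1)
    (r2 : mx_representation F G n2) :
  mx_irreducible r1 -> mx_irreducible r2 -> reduces chi r1 -> reduces chi r2 -> mx_rsim r1 r2.
Proof.
move=> irr1 irr2 red1 red2; apply: (irr_brauer_rsim setup irr1 irr2) => x Gx p'x.
by rewrite red1 // red2.
Qed.

Lemma reduces_rsim G (chi : 'CF(G)) n1 n2 (r1 : mx_representation F G n1)
    (r2 : mx_representation F G n2) : mx_rsim r1 r2 -> reduces chi r1 -> reduces chi r2.
Proof. by move=> sim red x Gx p'x; rewrite -(brauer_val_rsim lam sim) // red. Qed.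

Lemma brauer_val_sub_fact G n (r : mx_representation F G n) U (modU : mxmodule r U) x :
  x \in G -> bval r x = bval (submod_repr modU) x + bval (factmod_repr modU) x.
Proof.
move=> Gx; have [s1 [D1 -> _]] := brauer_valE lam (submod_repr modU) x.
have [s2 [D2 -> _]] := brauer_valE lam (factmod_repr modU) x.
rewrite (brauer_val_roots lam (s := s1 ++ s2)) ?big_cat //=.
by rewrite (char_poly_sub_fact_mod modU Gx) D1 D2.
Qed.

Definition brauer_summand G n m (r : mx_representation F G n) (s : mx_representation F G m) :=
  exists k (t : mx_representation F G k),
    forall x, x \in G -> p^'.-elt%g x -> bval r x = bval s x + bval t x.

Lemma brauer_summand_constt G n m (r : mx_representation F G n) (s : mx_representation F G m) :
  mx_irreducible s -> brauer_summand r s -> constt_repr r s.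
Proof.
move=> irr_s [k [t Dr]]; have [fam] := irr_family_exists F G.
have [j simj] := fam_all fam irr_s.
have [mr [br _ cr]] := rep_brauer_decomposition lam fam r.
have [mt [bt _ _]] := rep_brauer_decomposition lam fam t.
have /(_ j) : mr =1 (fun i => (i == j) + mt i)%N.
  apply: (fam_mult_uniq setup) => x Gx p'x; rewrite -br // Dr // bt // (brauer_val_rsim lam simj) //.
  rewrite [X in X + _](_ : _ = \sum_i bval (fam_repr i) x *+ (i == j)); last first.
    by rewrite (bigD1 j) //= eqxx big1 ?addr0 // => i /negPf->; exact: mulr0n.
  by rewrite -big_split /=; apply: eq_bigr => i _; rewrite mulrnDr.
rewrite eqxx => mj a ra0; apply/eqP; rewrite (rsim_gring_mx a simj) cr ?eqxx // mj.
by [].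
Qed.

Lemma brauer_irr G n m (r : mx_representation F G n) (s : mx_representation F G m) :
    mx_irreducible s -> (forall x, x \in G -> p^'.-elt%g x -> bval r x = bval s x) ->
  mx_irreducible r.
Proof.
move=> irr_s eqb; have [fam] := irr_family_exists F G; have [j simj] := fam_all fam irr_s.
have eqd : n = m.
  apply/eqP; rewrite -(Num.Theory.eqr_nat algC) -(brauer_val1 setup r) -(brauer_val1 setup s).
  by rewrite eqb ?group1 // /p_elt order1.
have /mx_irrP[m_gt0 _] := irr_s; have n_gt0 : (0 < n)%N by rewrite eqd.
have nz1 : (1%:M : 'M[F]_n) != 0 by rewrite -mxrank_eq0 mxrank1 -lt0n.
have := mxsimple_exists (mxmodule1 r) nz1 => /(_ (boolp.asbool _)) h.
have [U simU _] := boolp.asboolW (h _ (fun e => boolp.asboolT e)).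
have modU := mxsimple_module simU; have irrU := (submod_mx_irr modU).2 simU.
have sU : constt_repr s (submod_repr modU).
  apply: brauer_summand_constt irrU _; exists (\rank (cokermx U)), (factmod_repr modU).
  by move=> x Gx p'x; rewrite -eqb // -brauer_val_sub_fact.
have [_ eqr _ _] := constt_repr_irr irr_s irrU sU.
have fullU : (1%:M <= U)%MS by rewrite sub1mx /row_full -eqr eqd.
have [_ _ minU] := simU; apply/mx_irrP; split=> // V modV nzV.
have sVU : (V <= U)%MS := submx_trans (submx1 V) fullU.
by rewrite -sub1mx; apply: submx_trans fullU (minU V modV sVU nzV).
Qed.

Lemma reduces_summand G (chi psi : 'CF(G)) n m (r : mx_representation F G n)
    (s : mx_representation F G m) : (chi - psi) \is a character ->
  reduces chi r -> reduces psi s -> brauer_summand r s.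
Proof.
case/reduces_exists=> k [t redt] redr reds; exists k, t => x Gx p'x.
by rewrite redr // reds // redt // !cfunE addrC subrK.
Qed.

Lemma reduces_irr G (chi : 'CF(G)) n m (r : mx_representation F G n) (s : mx_representation F G m) :
  mx_irreducible s -> reduces chi s -> reduces chi r -> mx_irreducible r.
Proof. by move=> irr_s reds redr; apply: brauer_irr irr_s _ => x Gx p'x; rewrite redr // reds. Qed.

Lemma reduces_constt G (chi : 'CF(G)) i n m (r : mx_representation F G n)
    (s : mx_representation F G m) : chi \is a character -> i \in irr_constt chi ->
    reduces chi r -> reduces 'chi_i s -> mx_irreducible s -> constt_repr r s.
Proof.
move=> Nchi ci redr reds irr_s; apply: brauer_summand_constt irr_s _.
apply: reduces_summand redr reds; have [psi Npsi ->] := constt_charP _ Nchi ci.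
by rewrite addrC addKr.
Qed.

(** The Schur relation of the ordinary representation has the factor [#|H| / d], which is prime to
    p; it descends to the reduction and gives irreducibility there. *)
Lemma p'group_reduces_irr H (i : Iirr H) n (r : mx_representation F H n) :
  p^'.-group%g H -> reduces 'chi_i r -> mx_irreducible r.
Proof.
move=> p'H red; have /irr_reprP[rG irrG Dchi] := mem_irr i.
have [r0 [Dr0 [_ schur]]] := rep_reduction setup rG.
have red0 : reduces 'chi_i r0 by move=> x Hx p'x; rewrite Dr0 // Dchi cfunE Hx.
have /mx_irrP[d_gt0 _] := irrG; set d := rdegree rG in r0 Dr0 schur red0 d_gt0.
have [k Dk] : exists k, #|H| = (k * d)%N.
  apply/dvdnP; rewrite -dvdC_nat; have := dvd_irr1_cardG i.
  by rewrite Dchi cfunE group1 repr_mx1 mxtrace1.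
suff irr0 : mx_irreducible r0 by apply: reduces_irr irr0 red0 red.
have nzk : k%:R != 0 :> F.
  rewrite -(dvdn_pcharf pF); apply: contraL p'H => pk; rewrite /pgroup p'natE // negbK Dk.
  exact: dvdn_mulr.
apply: (averaging_irr d_gt0 nzk); apply: schur => X.
have [|c Dc] := irr_cent_scalar irrG (A := \sum_(x in H) rG x^-1%g *m X *m rG x).
  move=> y Hy; rewrite mulmx_suml mulmx_sumr [RHS](reindex_inj (mulIg y)) /=.
  apply: eq_big => [x|x Hx]; first by rewrite groupMr.
  rewrite invMg !repr_mxM ?groupV // !mulmxA -repr_mxM ?groupV // mulgV repr_mx1 mul1mx.
  by [].
rewrite Dc; congr _%:M; have := congr1 mxtrace Dc; rewrite mxtrace_scalar raddf_sum /=.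
rewrite (eq_bigr (fun=> \tr X)) => [|x Hx]; last first.
  by rewrite mxtrace_mulC mulmxA -repr_mxM ?groupV // mulgV repr_mx1 mul1mx.
rewrite sumr_const Dk mulrnA -/d => E; apply: (@mulIf _ d%:R); first by rewrite pnatr_eq0 -lt0n.
by rewrite [LHS]mulr_natr -E mulr_natl mulr_natr.
Qed.

(** If [t] were no reduction, it would not occur in the reduction of the regular representation. An
    element acting as 1 on [t] and as 0 on the other irreducibles would then pair to 0 with
    everything under the regular trace; but that pairing is nondegenerate, since [#|H|] is
    invertible in [F]. *)
Lemma p'group_irr_lift H n (t : mx_representation F H n) : p^'.-group%g H -> mx_irreducible t ->
  exists i : Iirr H, reduces 'chi_i t.
Proof.
move=> p'H irr_t; apply: boolp.contrapT => no.
have /fin_all_exists[d exr] := fun i : Iirr H => reduces_exists (irr_char i).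
have {exr} /fin_all_exists[r redr] := exr.
have irr_r i : mx_irreducible (r i) := p'group_reduces_irr p'H (redr i).
have [fam] := irr_family_exists F H; have [j0 simt] := fam_all fam irr_t.
have /fin_all_exists[j simr] := fun i : Iirr H => fam_all fam (irr_r i).
have nj i : j i != j0.
  apply/eqP=> eqj; apply: no; exists i; apply: (@reduces_rsim _ _ _ _ (r i)) (redr i).
  by apply: mx_rsim_trans (simr i) _; rewrite eqj; apply: mx_rsim_sym.
have [R [bR [tR _]]] := rep_reduction setup (regular_repr algC H).
have [m [bm tm _]] := rep_brauer_decomposition lam fam R.
have m0 : m j0 = 0%N.
  have /(_ j0) : m =1 (fun k => \sum_i (j i == k) * d i)%N.
    apply: (fam_mult_uniq setup) => x Hx p'x; rewrite -bm // bR //.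
    transitivity (cfReg H x); first by rewrite -cfReprReg cfunE Hx.
    rewrite cfReg_sum sum_cfunE; under [RHS]eq_bigr do rewrite -sumrMnr.
    rewrite exchange_big /=; apply: eq_bigr => i _.
    rewrite (bigD1 (j i)) //= big1 ?addr0 => [|k /negPf nk]; last by rewrite eq_sym nk mulr0n.
    rewrite eqxx mul1n cfunE (reduces_deg (redr i)) mulr_natl; congr (_ *+ _).
    by rewrite -redr // (brauer_val_rsim lam (simr i)).
  by move=> ->; apply: big1 => i _; rewrite (negPf (nj i)).
have [a [a1 a0]] := fam_separated j0 (enum (fam_ix fam)).
suff az : a = 0.
  have /mx_irrP[n_gt0 _] := fam_irr j0; have /matrixP/(_ (Ordinal n_gt0) (Ordinal n_gt0)) := a1.
  by rewrite az linear0 !mxE eqxx => /eqP; rewrite eq_sym oner_eq0.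
have trRay y : y \in H -> \tr (ev R a *m R y) = 0.
  move=> Hy; transitivity (\sum_k \tr (ev (fam_repr k) a *m fam_repr k y) *+ m k).
    rewrite gring_mxE mulmx_suml raddf_sum /=.
    under [RHS]eq_bigr do rewrite gring_mxE mulmx_suml raddf_sum /= -sumrMnl.
    rewrite [RHS]exchange_big /=; apply: eq_bigr => i _; have Hi := enum_valP i.
    rewrite -scalemxAl -repr_mxM // mxtraceZ tm ?groupM // mulr_sumr; apply: eq_bigr => k _.
    by rewrite -scalemxAl -repr_mxM // mxtraceZ mulrnAr.
  apply: big1 => k _; have [->|nk] := eqVneq k j0; first by rewrite m0.
  by rewrite a0 ?mem_enum // mul0mx mxtrace0 mul0rn.
apply/rowP=> i; rewrite mxE; have Hi := enum_valP i.
have := trRay _ (groupVr Hi); rewrite gring_mxE mulmx_suml raddf_sum /=.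
rewrite (bigD1 i) //= -scalemxAl -repr_mxM ?groupV // mulgV repr_mx1 big1 => [|k nk].
  rewrite addr0 mxtraceZ mxtrace1 => /eqP; rewrite mulf_eq0 => /orP[/eqP //|].
  rewrite -(dvdn_pcharf pF) /gcard => pH; case/negP: (isT); move: p'H.
  by rewrite /pgroup p'natE // pH.
rewrite -scalemxAl -repr_mxM ?groupV ?enum_valP // mxtraceZ tR ?mulr0 ?groupM ?groupV ?enum_valP //.
have := cfReprReg H.
move/cfunP/(_ (enum_val k * (enum_val i)^-1)%g); rewrite cfRegE cfunE groupM ?groupV ?enum_valP // mulr1n => ->.
rewrite [_ == 1%g](_ : _ = false) ?mulr0n //; apply: contraNF nk => /eqP/eqP.
by rewrite -eq_mulgV1 => /eqP/enum_val_inj->.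
Qed.
End Reduction.

(** * p-solvable groups *)

Lemma path_switch (T : Type) (e : rel T) (P : pred T) x s :
  path e x s -> ~~ P x -> P (last x s) -> exists y z, [/\ e y z, ~~ P y & P z].
Proof.
elim: s x => [|y s IHs] x /=; first by move=> _ /negPf->.
case/andP=> exy es nPx Pl; have [Py|nPy] := boolP (P y); first by exists x, y.
exact: IHs es nPy Pl.
Qed.

Section PSolvable.
Local Open Scope group_scope.
Variables (gT : finGroupType) (p : nat).
Implicit Types (G H K L M N E A : {group gT}) (pi : nat_pred).

Lemma index_setI_dvd K L A : K <| L -> A \subset L -> (#|A : A :&: K| %| #|L : K|)%N.
Proof.
move=> nsKL sAL; have nKL := normal_norm nsKL.
rewrite indexgI -(card_quotient nKL).
have -> : #|A : K| = #|A / K|.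
  by rewrite card_quotient_subnorm (setIidPl (subset_trans sAL nKL)).
exact: cardSg (quotientS _ sAL).
Qed.

Lemma p_solvable_sub G H : p_solvable p G -> H \subset G -> p_solvable p H.
Proof.
case=> s [ps <-] sHG; exists [seq (K :&: H)%G | K <- s]; split.
  have {1}-> : 1%G = (1 :&: H)%G :> {group gT} by apply: val_inj; rewrite /= setI1g.
  apply: (homo_path _ ps) => K L /andP[nsKL idx] /=.
  have nsI : K :&: H <| L :&: H.
    apply/andP; split; first by rewrite setSI ?normal_sub.
    by apply: normsI; [rewrite subIset // normal_norm | rewrite normsG ?subsetIr].
  rewrite nsI /=; have : (#|L :&: H : K :&: H| %| #|L : K|)%N.
    have -> : K :&: H = (L :&: H) :&: K.
      by rewrite setIAC (setIidPr (normal_sub nsKL)).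
    exact: index_setI_dvd (subsetIl _ _).
  by move=> dv; case/orP: idx => /(pnat_dvd dv)->; rewrite ?orbT.
rewrite -[RHS](_ : (last 1%G s :&: H)%G = H); last by apply: val_inj; rewrite /= (setIidPr sHG).
by rewrite -(last_map (fun K => (K :&: H)%G)); congr (last _ _); apply: val_inj; rewrite /= setI1g.
Qed.

Lemma p_solvable_step G : p_solvable p G -> G :=: 1 \/
  exists N, [/\ N <| G, N \proper G, p_solvable p N & p.-nat #|G : N| || p^'.-nat #|G : N|].
Proof.
case=> s [ps <-] {G}; elim/last_ind: s ps => [|s G IHs]; first by left.
rewrite last_rcons -cats1 cat_path /= andbT => /andP[ps /andP[nsG idx]].
have := normal_sub nsG; rewrite subEproper => /predU1P[eqG|prG]; last first.
  by right; exists (last 1%G s); split=> //; exists s.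
by rewrite -(group_inj eqG); apply: IHs.
Qed.

(** A p-layer is refined to index exactly p, where an irreducible restriction either stays
    irreducible or splits into p conjugates. *)
Lemma p_solvable_prime_step G : prime p -> p_solvable p G -> G :=: 1 \/
  exists N, [/\ N <| G, N \proper G, p_solvable p N & (#|G : N| == p) || p^'.-nat #|G : N|].
Proof.
move=> p_pr psG; have [->|[N [nsNG prN psN /orP[]]]] := p_solvable_step psG; first by left.
  move=> pN; right; have nNG := normal_norm nsNG.
  have pGN : p.-group (G / N) by rewrite /pgroup card_quotient.
  have ntGN : (G / N)%G :!=: 1.
    rewrite -cardG_gt1 card_quotient // indexg_gt1; by case/andP: prN.
  have [eq1|[M maxM _]] := @maximal_exists _ 1%G (G / N)%G (sub1G _).
    by case/eqP: ntGN; rewrite -eq1.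
  have nsM := p_maximal_normal pGN maxM.
  exists (coset N @*^-1 M)%G; have nsMG : coset N @*^-1 M <| G.
    by rewrite -(quotientGK nsNG) cosetpre_normal.
  have idx : #|G : coset N @*^-1 M| = p.
    by rewrite -{1}(quotientGK nsNG) -(p_maximal_index pGN maxM) index_cosetpre ?(normal_sub nsM).
  split=> //; last by rewrite idx eqxx.
    by rewrite properEneq normal_sub // andbT; apply: contraTneq p_pr => eqG; rewrite -idx eqG indexgg.
  exact: p_solvable_sub psG (normal_sub nsMG).
by move=> pN; right; exists N; rewrite pN orbT.
Qed.

Lemma pi'_elt_quotient pi E A x : A <| E -> pi.-group (E / A) -> x \in E -> pi^'.-elt x -> x \in A.
Proof.
move=> nsAE piEA Ex pi'x; have nAx := subsetP (normal_norm nsAE) x Ex.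
apply: coset_idr => //; apply/eqP; rewrite -order_eq1; apply/eqP.
apply: (@pnat_1 pi); first exact: mem_p_elt piEA (mem_quotient _ Ex).
exact: morph_p_elt.
Qed.

Lemma quotient_pgroup_gen pi E N : N <| E ->
  (forall x, x \in E -> pi^'.-elt x -> x \in N) -> pi.-group (E / N).
Proof.
move=> nsNE pi'N; apply/pgroupP=> q q_pr /(Cauchy q_pr)[xb ENx oxb].
have /morphimP[x nNx Ex Dx] := ENx.
have : xb.`_pi^' = 1.
  rewrite Dx -morph_constt //; apply: coset_id; apply: pi'N; last exact: p_elt_constt.
  by rewrite groupX.
by move/constt1P; rewrite /p_elt oxb pnatNK pnatE.
Qed.

(** A minimal [E] has a proper normal subgroup [A] over [N] with a pi-quotient, pi being p or p'.
    The pi'-elements of [E] generate together with [N] a subgroup normal in [G] and contained in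
    [A], so it equals [N] by minimality; hence [E / N] is a pi-group. *)
Lemma chief_layer G N M : p_solvable p G -> N <| G -> M <| G -> N \proper M ->
  exists E, [/\ E <| G, N \proper E, E \subset M & p.-group (E / N) || p^'.-group (E / N)].
Proof.
move=> psG nsNG nsMG prNM.
pose P := [pred E : {group gT} | [&& E <| G, N \proper E & E \subset M]].
have PM : P M by rewrite /= nsMG prNM subxx.
case: (arg_minnP (fun E => #|E|) PM) => E /and3P[nsEG prNE sEM] minE; exists E; split=> //.
have sEG := normal_sub nsEG; have sNE := proper_sub prNE.
have [s [ps Ds]] := p_solvable_sub psG sEG.
(* The step of the series of [E] at which the join with [N] first reaches [E]; the term before it
   gives [A]. *)
have [||H [K [/andP[nsHK idx] nH /eqP K_E]]] := path_switch (P := fun K : {group gT} => N <*> K == E) ps.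
- by rewrite joingG1; apply: contraTneq prNE => ->; rewrite properxx.
- by rewrite Ds; apply/eqP/joing_idPr.
have sKE : K \subset E by rewrite -K_E joing_subr.
have sHK := normal_sub nsHK; pose A := (N <*> H)%G.
have nNE : E \subset 'N(N) := subset_trans sEG (normal_norm nsNG).
have sAE : A \subset E by rewrite join_subG sNE (subset_trans sHK).
have nsAE : A <| E.
  rewrite /normal sAE /= -{1}K_E join_subG (subset_trans (joing_subl N H)) ?normG //=.
  by rewrite normsY ?(normal_norm nsHK) // (subset_trans sKE).
have dvdi : (#|E : A| %| #|K : H|)%N.
  have -> : #|E : A| = #|K : K :&: A|.
    have defE : A * K = E.
      apply/eqP; rewrite eqEsubset mul_subG //= -{1}K_E.
      by rewrite (norm_joinEr (subset_trans sKE nNE)) mulSg ?joing_subl.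
    rewrite indexgI; apply/eqP; rewrite -(eqn_pmul2l (cardG_gt0 A)) Lagrange //.
    by rewrite mulnC LagrangeMr (normC (subset_trans sKE (normal_norm nsAE))) defE.
  have sHI : H \subset (K :&: A)%G by rewrite subsetI sHK joing_subr.
  by rewrite -(Lagrange_index (subsetIl K A : (K :&: A)%G \subset K) sHI) dvdn_mulr.
have key pi : pi.-nat #|K : H| -> pi.-group (E / N).
  move=> piKH; have piEA : pi.-group (E / A).
    by rewrite /pgroup card_quotient ?normal_norm // (pnat_dvd dvdi).
  apply: quotient_pgroup_gen => [|x Ex pi'x]; first exact: normalS sNE sEG nsNG.
  pose S := [set y in E | pi^'.-elt y]; pose L := (<<S>> <*> N)%G.
  have sLA : L \subset A.
    rewrite join_subG joing_subl andbT gen_subG; apply/subsetP=> y; rewrite inE => /andP[Ey pi'y].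
    exact: pi'_elt_quotient nsAE piEA Ey pi'y.
  have prLE : L \proper E.
    by apply: sub_proper_trans sLA _; rewrite properEneq sAE nH.
  have nsLG : L <| G.
    rewrite /normal (subset_trans (proper_sub prLE)) //= normsY ?(normal_norm nsNG) //.
    rewrite norms_gen //; apply/subsetP=> g Gg; rewrite inE; apply/subsetP=> _ /imsetP[y Sy ->].
    move: Sy; rewrite !inE /p_elt orderJ => /andP[Ey ->]; rewrite andbT memJ_norm //.
    by rewrite (subsetP (normal_norm nsEG)).
  have : ~~ (N \proper L).
    apply: contraTN (proper_card prLE) => prNL; rewrite -leqNgt; apply: minE.
    by rewrite /= nsLG prNL (subset_trans (proper_sub prLE)).
  rewrite properE joing_subr negbK; move/subsetP; apply; apply: (subsetP (joing_subl _ _)).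
  by rewrite mem_gen // inE Ex.
by case/orP: idx => /key ->; rewrite ?orbT.
Qed.

(** Existence of Hall p'-subgroups of [G / N], stated in [G] so that the induction climbs chief
    layers. A p'-layer is absorbed; over a p-layer the group found above is cut down to a
    Schur-Zassenhaus complement. *)
Lemma p'_Hall_above G N : p_solvable p G -> N <| G ->
  exists K, [/\ N \subset K, K \subset G, p^'.-nat #|K : N| & p.-nat #|G : K|].
Proof.
move=> psG; have [n] := ubnP #|G : N|; elim: n N => // n IHn N /ltnSE-le_n nsNG.
have := normal_sub nsNG; rewrite subEproper => /predU1P[eqNG|prNG].
  by exists G; rewrite (group_inj eqNG) subxx indexgg.
have [E [nsEG prNE _ piE]] := chief_layer psG nsNG (normal_refl G) prNG.
have [sNE sEG sNG] := And3 (proper_sub prNE) (normal_sub nsEG) (normal_sub nsNG).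
have [K [sEK sKG p'K pGK]] : exists K, [/\ E \subset K, K \subset G, p^'.-nat #|K : E| & p.-nat #|G : K|].
  apply: IHn nsEG; apply: leq_trans le_n.
  by rewrite -(Lagrange_index sEG sNE) -{1}[#|G : E|]muln1 ltn_pmul2l // indexg_gt1; case/andP: prNE.
have nNE : E \subset 'N(N) := subset_trans sEG (normal_norm nsNG).
have nNK : K \subset 'N(N) := subset_trans sKG (normal_norm nsNG).
case/orP: piE => piE; last first.
  exists K; split=> //; first exact: subset_trans sEK.
  by rewrite -(Lagrange_index sEK sNE) pnatM p'K /= -card_quotient.
have nsEK : E <| K := normalS sEK sKG nsEG.
have hallE : Hall (K / N) (E / N).
  rewrite /Hall quotientS //= -divgS ?quotientS // !card_quotient // -(Lagrange_index sEK sNE) mulnK //.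
  by apply: pnat_coprime p'K; rewrite -card_quotient.
have /splitsP[C /complP[tiC defK]] := SchurZassenhaus_split hallE (quotient_normal N nsEK).
have cardC : #|C| = #|K : E|.
  have := TI_cardMg tiC; rewrite defK !card_quotient // -(Lagrange_index sEK sNE) mulnC => /eqP.
  by rewrite eqn_pmul2l ?indexg_gt0 // => /eqP.
have sCK : C \subset K / N by rewrite -defK mulG_subr.
have nsNK : N <| K := normalS (subset_trans sNE sEK) sKG nsNG.
exists (coset N @*^-1 C)%G; split.
- exact: sub_cosetpre.
- by apply: subset_trans sKG; rewrite -(quotientGK nsNK) cosetpreSK.
- by rewrite -divgS ?sub_cosetpre // card_cosetpre mulKn // cardC.
rewrite -(Lagrange_index sKG) ?pnatM ?pGK //=; last by rewrite -(quotientGK nsNK) cosetpreSK.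
rewrite -{1}(quotientGK nsNK) index_cosetpre // -divgS // card_quotient // cardC.
by rewrite -(Lagrange_index sEK sNE) mulKn // -card_quotient.
Qed.

Lemma p_solvable_p'_Hall G : p_solvable p G -> exists H, p^'.-Hall(G) H.
Proof.
move=> psG; have [H [_ sHG p'H pGH]] := p'_Hall_above psG (normal1 G).
by exists H; rewrite /pHall sHG pnatNK pGH andbT /pgroup -indexg1.
Qed.
End PSolvable.

(** * Conjugate characters and special characters *)

Section Conjugation.
Variable gT : finGroupType.
Implicit Types (G H S : {group gT}) (g : gT).

(** Conjugation by an element that need not normalize [G]. It is a relation, so that [G'] may be any
    group equal to the conjugate and no class function is cast between equal groups. *)
Definition is_conj g G G' (chi : 'CF(G)) (chi' : 'CF(G')) :=
  G' :=: (G :^ g)%g /\ forall x, chi' (x ^ g)%g = chi x.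

Lemma is_conj_sym g G G' (chi : 'CF(G)) (chi' : 'CF(G')) :
  is_conj g chi chi' -> is_conj g^-1 chi' chi.
Proof.
case=> defG' eqc; split=> [|x]; first by rewrite defG' conjsgK.
by rewrite -eqc conjgKV.
Qed.

Lemma is_conj_trans g h G G' G'' (chi : 'CF(G)) (chi' : 'CF(G')) (chi'' : 'CF(G'')) :
  is_conj g chi chi' -> is_conj h chi' chi'' -> is_conj (g * h) chi chi''.
Proof.
case=> DG' e1 [DG'' e2]; split=> [|x]; first by rewrite DG'' DG' conjsgM.
by rewrite conjgM e2 e1.
Qed.

Lemma is_conj_id g G (chi : 'CF(G)) : g \in G -> is_conj g chi chi.
Proof. by move=> Gg; split=> [|x]; rewrite ?conjGid ?cfunJ. Qed.

Lemma is_conj_cfConjg G (nu : 'CF(G)) g : g \in ('N(G))%g -> is_conj g nu (nu ^ g)%CF.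
Proof. by move=> nNg; split=> [|x]; rewrite ?(normP nNg) ?cfConjgEJ. Qed.

Lemma is_conj_unique g G G' (chi : 'CF(G)) (chi1 chi2 : 'CF(G')) :
  is_conj g chi chi1 -> is_conj g chi chi2 -> chi1 = chi2.
Proof. by move=> [_ e1] [_ e2]; apply/cfunP=> x; rewrite -(conjgKV g x) e1 e2. Qed.

Lemma is_conj_exists g G (chi : 'CF(G)) : exists chi' : 'CF(G :^ g), is_conj g chi chi'.
Proof.
have ff : is_class_fun <<G :^ g>>%g [ffun x => chi (x ^ g^-1)%g].
  rewrite genGid; apply: intro_class_fun => [x y Gx Gy | x nGx].
    have [Gx' Gy'] : (x ^ g^-1)%g \in G /\ (y ^ g^-1)%g \in G by rewrite -!mem_conjg.
    by rewrite conjJg (cfunJ _ _ Gy').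
  by rewrite cfun0 // -mem_conjg.
exists (Cfun 0 ff); split=> // x; rewrite cfunElock conjgK //.
Qed.

Lemma is_conj_exists_to g G G' (chi : 'CF(G)) :
  G' :=: (G :^ g)%g -> exists chi' : 'CF(G'), is_conj g chi chi'.
Proof.
move=> DG'; have -> : G' = (G :^ g)%G by apply: group_inj.
exact: is_conj_exists.
Qed.

Lemma is_conj_dot g G G' (chi psi : 'CF(G)) (chi' psi' : 'CF(G')) :
  is_conj g chi chi' -> is_conj g psi psi' -> '[chi', psi'] = '[chi, psi].
Proof.
case=> DG' e1 [_ e2]; have cardE : #|G'| = #|G| by rewrite DG' cardJg.
rewrite !cfdotE cardE; congr (_ * _).
rewrite (reindex_inj (conjg_inj g)) /=; apply: eq_big => [x|x _]; first by rewrite DG' memJ_conjg.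
by rewrite e1 e2.
Qed.

Section OneConj.
Variables (g : gT) (G G' : {group gT}) (DG' : G' :=: (G :^ g)%g).

Lemma conj_to_proof n (rG : mx_representation algC G n) : mx_repr G' (fun x => rG (x ^ g^-1)%g).
Proof.
split=> [|x y]; first by rewrite conj1g repr_mx1.
by rewrite DG' !mem_conjg => Gx Gy; rewrite conjMg repr_mxM.
Qed.
Definition conj_to n (rG : mx_representation algC G n) := MxRepresentation (conj_to_proof rG).

Lemma is_conj_cfRepr n (rG : mx_representation algC G n) : is_conj g (cfRepr rG) (cfRepr (conj_to rG)).
Proof. by split=> // x; rewrite !cfunE /= conjgK DG' memJ_conjg. Qed.

Lemma is_conj_char (chi : 'CF(G)) (chi' : 'CF(G')) :
  is_conj g chi chi' -> chi \is a character -> chi' \is a character.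
Proof.
move=> cc /char_reprP[rG Dchi]; rewrite Dchi in cc.
by rewrite (is_conj_unique cc (is_conj_cfRepr rG)) cfRepr_char.
Qed.

Lemma is_conj_irr (chi : 'CF(G)) (chi' : 'CF(G')) :
  is_conj g chi chi' -> chi \in irr G -> chi' \in irr G'.
Proof.
move=> cc; rewrite !irrEchar => /andP[Nchi n1]; rewrite (is_conj_char cc) //=.
by rewrite (is_conj_dot cc cc).
Qed.

Lemma is_conj_Det (chi : 'CF(G)) (chi' : 'CF(G')) :
  is_conj g chi chi' -> chi \is a character -> is_conj g (cfDet chi) (cfDet chi').
Proof.
move=> cc /char_reprP[rG Dchi]; rewrite Dchi in cc *.
rewrite (is_conj_unique cc (is_conj_cfRepr rG)) !cfDetRepr; split=> // x.
by rewrite !cfunE !trace_mx11 !mxE /= conjgK DG' memJ_conjg.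
Qed.

Lemma is_conj_order (chi : 'CF(G)) (chi' : 'CF(G')) :
  is_conj g chi chi' -> #[chi']%CF = #[chi]%CF.
Proof.
case=> _ e; have eq1 k : (chi' ^+ k == 1) = (chi ^+ k == 1).
  have expE (L : {group gT}) (phi : 'CF(L)) m x : x \in L -> (phi ^+ m) x = phi x ^+ m.
    by move=> Lx; rewrite exp_cfunE.
  apply/eqP/eqP=> E; apply/cfun_inP=> x Lx.
    by rewrite expE // -e -expE ?DG' ?memJ_conjg // E !cfun1E Lx DG' memJ_conjg Lx.
  have Lx' : (x ^ g^-1)%g \in G by rewrite -mem_conjg -DG'.
  by rewrite expE // -[x](conjgKV g) e -expE // E !cfun1E DG' memJ_conjg.
apply/eqP; rewrite eqn_dvd !dvdn_cforder eq1 -dvdn_cforder dvdnn /=.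
by rewrite -eq1 -dvdn_cforder.
Qed.

Lemma is_conj_1 (chi : 'CF(G)) (chi' : 'CF(G')) : is_conj g chi chi' -> chi' 1%g = chi 1%g.
Proof. by case=> _ <-; rewrite conj1g. Qed.

Lemma is_conj_Res (chi : 'CF(G)) (chi' : 'CF(G')) (S S' : {group gT}) :
  S' :=: (S :^ g)%g -> S \subset G ->
  is_conj g chi chi' -> is_conj g ('Res[S] chi) ('Res[S'] chi').
Proof.
move=> DS' sSG [_ e]; split=> // x; have sSG' : S' \subset G' by rewrite DS' DG' conjSg.
have [Sx|nSx] := boolP (x \in S); last by rewrite !cfun0 // DS' memJ_conjg.
by rewrite !cfResE // DS' memJ_conjg.
Qed.

End OneConj.

Lemma is_conj_irr_constt g G G' (chi : 'CF(G)) (chi' : 'CF(G')) (i' : Iirr G') :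
  is_conj g chi chi' -> i' \in irr_constt chi' ->
  exists2 i, i \in irr_constt chi & is_conj g 'chi_i 'chi_i'.
Proof.
move=> cc ci'; have [DG _] := is_conj_sym cc.
have [nu cnu] := is_conj_exists_to 'chi_i' DG.
have /irrP[i Dnu] := is_conj_irr (proj1 cnu) cnu (mem_irr i').
have cnu' := is_conj_sym cnu; rewrite invgK Dnu in cnu'; exists i => //.
by rewrite irr_consttE -(is_conj_dot cc cnu').
Qed.

Lemma is_conj_subnormal g S G : ((S :^ g)%g <|<| (G :^ g)%g)%g -> (S <|<| G)%g.
Proof.
case/subnormalP=> s Hs defG; apply/subnormalP; exists [seq (K :^ g^-1)%G | K <- s].
  have -> : S = ((S :^ g) :^ g^-1)%G by apply: group_inj; rewrite /= conjsgK.
  rewrite (homo_path _ Hs) // => A B /= nsAB; by rewrite normalJ.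
have -> : S = ((S :^ g) :^ g^-1)%G by apply: group_inj; rewrite /= conjsgK.
by rewrite (last_map (fun K => (K :^ g^-1)%G)) defG; apply: group_inj; rewrite /= conjsgK.
Qed.

Lemma is_conj_special pi g G G' (chi : 'CF(G)) (chi' : 'CF(G')) :
  is_conj g chi chi' -> pi_special pi chi -> pi_special pi chi'.
Proof.
move=> cc [irr_chi [m [pi_m deg]] spec]; split.
- by have := is_conj_irr (proj1 cc) cc irr_chi.
- by exists m; rewrite (is_conj_1 cc).
move=> S' snS' i' ci'; have [DG' _] := cc.
pose S := (S' :^ g^-1)%G; have DS' : S' :=: (S :^ g)%g by rewrite /= conjsgKV.
have snS : (S <|<| G)%g by apply: (is_conj_subnormal (g := g)); rewrite -DS' -DG'.
have sSG := subnormal_sub snS.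
have [i ci cii] := is_conj_irr_constt (is_conj_Res (proj1 cc) DS' sSG cc) ci'.
by rewrite /cfDet_order (is_conj_order (proj1 (is_conj_Det (proj1 cii) cii (irr_char i))) (is_conj_Det (proj1 cii) cii (irr_char i))) spec.
Qed.
End Conjugation.

Section Constituents.
Variable gT : finGroupType.
Implicit Types (G H N S : {group gT}).

Lemma constt_Res_conj G N (i : Iirr G) (j k : Iirr N) : (N <| G)%g ->
    j \in irr_constt ('Res[N] 'chi_i) -> k \in irr_constt ('Res[N] 'chi_i) ->
  exists2 g, g \in G & 'chi_k = ('chi_j ^ g)%CF.
Proof.
move=> nsNG cj; rewrite irr_consttE (Clifford_Res_sum_cfclass nsNG cj) cfdotZl mulf_eq0 => /norP[_].
case: (altP (@cfclassP _ _ G 'chi_j 'chi_k)) => [[g Gg ->]|]; first by exists g.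
move=> notin; case/eqP; rewrite cfdot_suml big_seq big1 // => xi /cfclassP[g Gg Dxi].
rewrite Dxi -conjg_IirrE cfdot_irr; case: eqP => // eqk; case/negP: notin.
by rewrite -eqk conjg_IirrE; apply/cfclassP; exists g.
Qed.

Lemma constt_Res_above G (K : {group gT}) S (psi : 'CF(G)) (i : Iirr S) : (S \subset K)%g -> (K \subset G)%g ->
    psi \is a character -> i \in irr_constt ('Res[S] psi) ->
  exists2 j, j \in irr_constt ('Res[K] psi) & i \in irr_constt ('Res[S] 'chi_j).
Proof.
move=> sSK sKG Npsi ci; apply: boolp.contrapT => no; move: ci.
rewrite irr_consttE -(cfResRes psi sSK sKG) ['Res[K] psi]cfun_sum_constt linear_sum cfdot_suml.
rewrite big1 ?eqxx // => j cj; rewrite linearZ cfdotZl; apply/eqP.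
rewrite mulf_eq0 -[X in _ || X]negbK -irr_consttE; apply/orP; right; apply/negP=> cij.
by apply: no; exists j.
Qed.

Lemma constt_Res_below G (K : {group gT}) S (psi : 'CF(G)) (j : Iirr K) (i : Iirr S) :
    (S \subset K)%g -> (K \subset G)%g -> psi \is a character ->
    j \in irr_constt ('Res[K] psi) -> i \in irr_constt ('Res[S] 'chi_j) ->
  i \in irr_constt ('Res[S] psi).
Proof.
move=> sSK sKG Npsi cj ci; rewrite -(cfResRes psi sSK sKG).
by apply: constt_Res_trans cj _ ci; apply: cfRes_char.
Qed.

Lemma irr_constt_self G (i : Iirr G) (chi : 'CF(G)) : chi \in irr G -> i \in irr_constt chi -> 'chi_i = chi.
Proof. by case/irrP=> j ->; rewrite constt_irr inE => /eqP->. Qed.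
End Constituents.

Section Special.
Variables (gT : finGroupType) (pi : nat_pred).
Implicit Types (G H N S : {group gT}).

Lemma special_Res G N (chi : 'CF(G)) (i : Iirr N) : (N <| G)%g -> pi_special pi chi ->
  i \in irr_constt ('Res[N] chi) -> pi_special pi 'chi_i.
Proof.
move=> nsNG [/irrP[c ->] [m [pi_m deg]] spec] ci; split; first exact: mem_irr.
  have [n En] := dvdn_constt_Res1_irr1 nsNG ci.
  have /natrP[d Ed] := Cnat_irr1 i; exists d; split=> //.
  have Em : m = (n * d)%N by apply/eqP; rewrite -(eqr_nat algC) natrM -deg En Ed.
  by apply: pnat_dvd pi_m; rewrite Em dvdn_mull.
move=> S snS j cj; apply: spec; first exact: subnormal_trans snS (normal_subnormal nsNG).
exact: constt_Res_below (subnormal_sub snS) (normal_sub nsNG) (irr_char c) ci cj.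
Qed.

Lemma special_order G (chi : 'CF(G)) : pi_special pi chi -> pi.-nat ('o(chi))%CF.
Proof.
case=> /irrP[i ->] _ spec; apply: (spec G (subnormal_refl G)).
by rewrite cfRes_id constt_irr inE.
Qed.

Lemma special_deg G (chi : 'CF(G)) : pi_special pi chi -> exists2 m, pi.-nat m & chi 1%g = m%:R.
Proof. by case=> _ [m [pi_m deg]] _; exists m. Qed.

Lemma special_intro G (chi : 'CF(G)) : chi \in irr G ->
    (exists2 m, pi.-nat m & chi 1%g = m%:R) -> pi.-nat ('o(chi))%CF ->
    (forall M : {group gT}, (M <| G)%g -> (M \proper G)%g -> forall i : Iirr M,
      i \in irr_constt ('Res[M] chi) -> pi_special pi 'chi_i) ->
  pi_special pi chi.
Proof.
move=> irr_chi [m pi_m deg] ord spec; split=> //; first by exists m.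
move=> S snS i ci; have [eqSG|[K [snSK nsKG prK]]] := subnormalEr snS.
  move: i ci; rewrite (group_inj eqSG) => i; rewrite cfRes_id => ci.
  by rewrite (irr_constt_self irr_chi ci).
have [j cj cij] := constt_Res_above (subnormal_sub snSK) (normal_sub nsKG) (irrWchar irr_chi) ci.
by have [_ _ sp] := spec K nsKG prK j cj; apply: sp.
Qed.

Lemma cforder_dvd_pnat G (xi : 'CF(G)) k : xi ^+ k = 1 -> pi.-nat k -> pi.-nat #[xi]%CF.
Proof. by move=> /eqP; rewrite -dvdn_cforder => dv pik; apply: pnat_dvd pik. Qed.

Lemma cforder_Res_lin G H (xi : 'CF(G)) : pi.-nat #[xi]%CF -> pi.-nat #['Res[H] xi]%CF.
Proof.
by apply: cforder_dvd_pnat; rewrite -rmorphXn /= exp_cforder rmorph1.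
Qed.

Lemma cforderM_pnat G (xi eta : 'CF(G)) : pi.-nat #[xi]%CF -> pi.-nat #[eta]%CF -> pi.-nat #[xi * eta]%CF.
Proof.
move=> pix pie; apply: (@cforder_dvd_pnat _ _ (#[xi]%CF * #[eta]%CF)%N); last by rewrite pnatM pix.
by rewrite exprMn exprM exp_cforder expr1n mulnC exprM exp_cforder expr1n mulr1.
Qed.

Lemma cforderX_pnat G (xi : 'CF(G)) k : pi.-nat #[xi]%CF -> pi.-nat #[xi ^+ k]%CF.
Proof.
by apply: cforder_dvd_pnat; rewrite -exprM mulnC exprM exp_cforder expr1n.
Qed.

Lemma cforder_pi_pi'_1 G (xi : 'CF(G)) k : pi.-nat #[xi]%CF -> pi^'.-nat k -> xi ^+ k = 1 -> xi = 1.
Proof.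
move=> pix pi'k /eqP; rewrite -dvdn_cforder => dv.
have : #[xi]%CF = 1%N by apply: (@pnat_1 pi) => //; apply: pnat_dvd dv pi'k.
by move=> o1; rewrite -[LHS]expr1 -o1 exp_cforder.
Qed.

Lemma special_mul_lin G (chi lambda : 'CF(G)) : lambda \is a linear_char ->
  pi.-nat #[lambda]%CF -> pi_special pi chi -> pi_special pi (lambda * chi).
Proof.
move=> linl pil [irr_chi [m [pi_m deg]] spec]; split; first exact: mul_lin_irr.
  by exists m; rewrite cfunE lin_char1 // mul1r.
move=> S snS i ci; have sSG := subnormal_sub snS.
have linS : 'Res[S] lambda \is a linear_char by apply: cfRes_lin_char.
have /irrP[j Dj] : ('Res[S] lambda)^*%CF * 'chi_i \in irr S.
  by rewrite mul_lin_irr ?cfConjC_lin_char ?mem_irr.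
have Di : 'chi_i = 'Res[S] lambda * 'chi_j by rewrite -Dj mulrA mul_conjC_lin_char ?mul1r.
rewrite Di /cfDet_order cfDet_mul_lin ?irr_char //.
apply: cforderM_pnat; first by apply: cforderX_pnat; apply: cforder_Res_lin.
apply: spec => //; move: ci; rewrite !irr_consttE rmorphM /= Di !cfdotE.
congr (_ * _ != 0); apply: eq_bigr => x Sx; rewrite !cfunE rmorphM /=.
rewrite mulrACA -normCK normC_lin_char // expr1n mul1r; by [].
Qed.

Lemma special_lin G (lambda : 'CF(G)) : lambda \is a linear_char ->
  pi.-nat #[lambda]%CF -> pi_special pi lambda.
Proof.
move=> linl pil; split; first exact: lin_char_irr.
  by exists 1%N; rewrite lin_char1.
move=> S snS i ci; have linS : 'Res[S] lambda \is a linear_char by apply: cfRes_lin_char.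
rewrite (irr_constt_self (lin_char_irr linS) ci) /cfDet_order cfDet_id //.
exact: cforder_Res_lin.
Qed.
End Special.

Section OrdinaryRepr.
Variable gT : finGroupType.
Implicit Types (G H N : {group gT}).

Lemma cfRepr_irrP G n (r : mx_representation algC G n) : cfRepr r \in irr G <-> mx_irreducible r.
Proof.
split=> [/irr_reprP[r' irr' /eqP/cfRepr_rsimP sim]|irr_r].
  exact: mx_rsim_irr (mx_rsim_sym sim) irr'.
by apply/irr_reprP; exists (Representation r).
Qed.

Lemma cfRepr_subg G H (sHG : H \subset G) n (r : mx_representation algC G n) :
  cfRepr (subg_repr r sHG) = 'Res[H] (cfRepr r).
Proof. by apply/cfun_inP=> x Hx; rewrite cfResE // !cfunE Hx (subsetP sHG). Qed.

Lemma cfRepr_conj N n (r : mx_representation algC N n) g (nNg : g \in ('N(N))%g) :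
  cfRepr (conj_repr r nNg) = (cfRepr r ^ g)%CF.
Proof. by apply/cfun_inP=> x Nx; rewrite cfConjgE // !cfunE Nx memJ_norm ?groupV // Nx. Qed.

Lemma cfRepr_constt G n m (r : mx_representation algC G n) (s : mx_representation algC G m)
    (chi : 'CF(G)) i : cfRepr r = chi -> cfRepr s = 'chi_i -> i \in irr_constt chi -> constt_repr r s.
Proof.
move=> Dr Ds ci; have irr_s : mx_irreducible s by apply/cfRepr_irrP; rewrite Ds mem_irr.
have Nchi : chi \is a character by rewrite -Dr cfRepr_char.
have [psi /char_reprP[t ->] Dchi] := constt_charP _ Nchi ci.
have [fam] := irr_family_exists algC G; have [j simj] := fam_all fam irr_s.
have [mr [_ trr cr]] := rep_decomposition fam r; have [mt [_ trt _]] := rep_decomposition fam t.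
have E k : (mr k)%:R - ((k == j) + mt k)%:R = 0 :> algC.
  move: k; apply: fam_trace_free => x Gx.
  under eq_bigr do rewrite mulrBl natrD mulrDl opprD addrA.
  rewrite !sumrB.
  have -> : \sum_k (k == j)%:R * \tr (fam_repr k x) = \tr (s x).
    rewrite (bigD1 j) //= big1 ?addr0 => [|k /negPf->]; last by rewrite mul0r.
    by rewrite eqxx mul1r -(mxtrace_rsim simj).
  have := congr1 (fun f : 'CF(G) => f x) Dr; rewrite Dchi -Ds !cfunE Gx !mulr1n trr // trt // => E.
  under eq_bigr do rewrite mulr_natl; under [X in _ - X]eq_bigr do rewrite mulr_natl.
  by rewrite E addrAC addrK subrr.
move=> a a0; apply/eqP; rewrite (rsim_gring_mx a simj) cr ?eqxx //.
have /eqP := E j; rewrite eqxx subr_eq0 eqr_nat => /eqP ->; by [].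
Qed.

Section Restriction.
Variables (G N H : {group gT}) (t : Iirr N).
Hypotheses (nsNG : (N <| G)%g) (sHG : H \subset G) (defG : (N * H)%g = G).
Hypothesis irrD : forall g, g \in G -> 'Res[(N :&: H)%G] ('chi_t ^ g)%CF \in irr (N :&: H)%G.
Hypothesis injD : forall g h, g \in G -> h \in G ->
  'Res[(N :&: H)%G] ('chi_t ^ g)%CF = 'Res[(N :&: H)%G] ('chi_t ^ h)%CF -> ('chi_t ^ g)%CF = ('chi_t ^ h)%CF.
Let sNG := normal_sub nsNG.

(** The same extension of homomorphisms from [H] to [G] as for modules, here in characteristic 0. *)
Lemma restrict_over_irr :
  (forall i, t \in irr_constt ('Res[N] 'chi[G]_i) -> 'Res[H] 'chi_i \in irr H) /\
  (forall i j, t \in irr_constt ('Res[N] 'chi[G]_i) -> t \in irr_constt ('Res[N] 'chi[G]_j) ->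
    'Res[H] 'chi_i = 'Res[H] 'chi_j -> i = j).
Proof.
have /irr_reprP[s irr_s Ds] := mem_irr t.
have irrs g (Gg : g \in G) : mx_irreducible (subg_repr (conj_repr s (subsetP (normal_norm nsNG) g Gg)) (subsetIl N H : (N :&: H)%G \subset N)).
  by apply/cfRepr_irrP; rewrite cfRepr_subg cfRepr_conj -Ds irrD.
have injs g h (Gg : g \in G) (Gh : h \in G) :
  mx_rsim (subg_repr (conj_repr s (subsetP (normal_norm nsNG) g Gg)) (subsetIl N H : (N :&: H)%G \subset N))
   (subg_repr (conj_repr s (subsetP (normal_norm nsNG) h Gh)) (subsetIl N H : (N :&: H)%G \subset N)) ->
  mx_rsim (conj_repr s (subsetP (normal_norm nsNG) g Gg)) (conj_repr s (subsetP (normal_norm nsNG) h Gh)).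
  move=> /cfRepr_rsimP/eqP; rewrite !cfRepr_subg !cfRepr_conj -Ds => /(injD Gg Gh) E.
  by apply/cfRepr_rsimP; rewrite !cfRepr_conj -Ds E.
have char0 : [pchar algC]^'.-group%g H by apply: algC'G_pchar.
have exM i : t \in irr_constt ('Res[N] 'chi[G]_i) -> exists M : representation algC G,
    [/\ mx_irreducible M, 'chi_i = cfRepr M & constt_repr (subg_repr M sNG) s].
  have /irr_reprP[M irrM DM] := mem_irr i => ct; exists M; split=> //.
  apply: (cfRepr_constt (chi := 'Res[N] 'chi_i) (i := t)) => //; by rewrite cfRepr_subg DM.
split=> [i /exM[M [irrM -> Ms]] | i j /exM[M1 [irr1 D1 M1s]] /exM[M2 [irr2 D2 M2s]] E].
  by rewrite -(cfRepr_subg sHG); apply/cfRepr_irrP; apply: (restricted_irr sHG defG irr_s irrs injs).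
apply: irr_inj; rewrite D1 D2; apply/eqP/cfRepr_rsimP.
apply: (restricted_rsim (sHG := sHG) defG irr_s irrs injs) => //.
by apply/cfRepr_rsimP; rewrite !cfRepr_subg -D1 -D2 E.
Qed.
End Restriction.
End OrdinaryRepr.

(** * Special characters on Hall p'-subgroups *)

Section SpecialHall.
Variables (gT : finGroupType) (p : nat).
Hypothesis p_pr : prime p.
Implicit Types (G H N : {group gT}).
Local Notation special := (pi_special p^').

Lemma p'nat_not_dvd n : (p^'.-nat n) -> ~~ (p %| n)%N.
Proof. by move=> p'n; rewrite -p'natE // (pnat_not0 p'n); case: n p'n. Qed.

Lemma p'deg_Res_irr G N (i : Iirr G) m : (N <| G)%g -> #|G : N|%g = p -> p^'.-nat m ->
  'chi_i 1%g = m%:R -> 'Res[N] 'chi_i \in irr N.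
Proof.
move=> nsNG idx p'm deg; have [//|[c inj_c Dres]] := cfRes_prime_irr_cases i nsNG idx p_pr.
pose c0 := c (Ordinal (prime_gt0 p_pr)).
have cc k : c k \in irr_constt ('Res[N] 'chi_i).
  rewrite irr_consttE Dres cfdot_suml (bigD1 k) //= cfnorm_irr big1 ?addr0 ?oner_eq0 // => l nl.
  by rewrite cfdot_irr (inj_eq inj_c) (negPf nl).
have /natrP[d Dd] := Cnat_irr1 c0.
have : 'chi_i 1%g = (p * d)%:R.
  rewrite -(cfResE _ (normal_sub nsNG)) // Dres sum_cfunE (eq_bigr (fun=> d%:R)).
    by rewrite sumr_const card_ord mulrnA -[RHS]mulr_natr -natrM mulnC natrM mulr_natr.
  move=> k _; have [g Gg ->] := constt_Res_conj nsNG (cc (Ordinal (prime_gt0 p_pr))) (cc k).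
  by rewrite cfConjg1.
rewrite deg => /eqP; rewrite eqr_nat => /eqP Em; have := p'nat_not_dvd p'm.
by rewrite Em dvdn_mulr.
Qed.

Lemma special_constt_conj G N (i : Iirr G) (t u : Iirr N) : (N <| G)%g -> special 'chi_t ->
    t \in irr_constt ('Res[N] 'chi_i) -> u \in irr_constt ('Res[N] 'chi_i) -> special 'chi_u.
Proof.
move=> nsNG spt ct cu; have [g Gg ->] := constt_Res_conj nsNG ct cu.
by apply: is_conj_special spt; apply: is_conj_cfConjg; apply: (subsetP (normal_norm nsNG)).
Qed.

Lemma pHall_setI_normal pi G N H : (N <| G)%g -> (pi.-Hall(G) H)%g -> (pi.-Hall(N) (N :&: H))%g.
Proof.
move=> nsNG /and3P[sHG piH pi'i]; have nNH := subset_trans sHG (normal_norm nsNG).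
rewrite /pHall subsetIl (pgroupS (subsetIr N H)) //= indexgI; apply: pnat_dvd pi'i.
have -> : #|N : H|%g = #|N <*> H : H|%g.
  apply/eqP; rewrite -(eqn_pmul2r (cardG_gt0 H)) LagrangeMr -norm_joinEr //.
  by rewrite mulnC Lagrange ?joing_subr.
by apply: indexSg; rewrite ?joing_subr // join_subG (normal_sub nsNG).
Qed.

Lemma p'_index_mulHall G N H : (N <| G)%g -> (p^'.-Hall(G) H)%g -> p^'.-nat #|G : N|%g -> (N * H)%g = G.
Proof.
move=> nsNG hallH p'N; have sHG := pHall_sub hallH.
have nNH : H \subset ('N(N))%g := subset_trans sHG (normal_norm nsNG).
rewrite -(norm_joinEr nNH); apply/eqP; rewrite eqEsubset join_subG (normal_sub nsNG) sHG /=.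
rewrite -indexg_eq1; apply/eqP/(@pnat_1 p); last first.
  by apply: pnat_dvd p'N; apply: indexgS; apply: joing_subl.
have /and3P[_ _] := hallH; rewrite pnatNK; apply: pnat_dvd.
by apply: indexgS; apply: joing_subr.
Qed.

(** When [N] has index p it contains [H], and a special character is the only extension of its
    restriction with determinantal order prime to p. When the index is a p'-number, [G = N H] and
    homomorphisms extend from [H] to [G], by induction on [N :&: H] inside [N]. *)
Theorem special_Hall G H : p_solvable p G -> (p^'.-Hall(G) H)%g ->
  (forall chi : 'CF(G), special chi -> 'Res[H] chi \in irr H) /\
  (forall chi1 chi2 : 'CF(G), special chi1 -> special chi2 ->
     'Res[H] chi1 = 'Res[H] chi2 -> chi1 = chi2).
Proof.
have [n] := ubnP #|G|; elim: n G H => // n IHn G H /ltnSE-le_n psG hallH.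
have sHG := pHall_sub hallH.
have [G1|[N [nsNG prN psN]]] := p_solvable_prime_step p_pr psG.
  have defH : H = G by apply: group_inj; apply/eqP; rewrite eqEsubset sHG G1 sub1G.
  rewrite defH; split=> [chi [irr_chi _ _]|chi1 chi2 _ _]; first by rewrite cfRes_id.
  by rewrite !cfRes_id.
have lt_n : (#|N| < n)%N := leq_trans (proper_card prN) le_n.
have sNG := normal_sub nsNG.
case/orP=> [/eqP idx|p'idx].
  have sHN : H \subset N.
    apply/subsetP=> x Hx; apply: (@pi'_elt_quotient _ p G) => //.
    - by rewrite /pgroup card_quotient ?normal_norm // idx pnat_id.
    - exact: subsetP Hx.
    exact: mem_p_elt (pHall_pgroup hallH) Hx.
  have hallHN := pHall_subl sHN sNG hallH.
  have [irrN injN] := IHn N H lt_n psN hallHN.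
  have ResN (chi : 'CF(G)) : special chi -> 'Res[N] chi \in irr N /\ special ('Res[N] chi).
    move=> sp; have [/irrP[i Di] [m [p'm deg]] _] := sp.
    have irrR : 'Res[N] chi \in irr N by rewrite Di; apply: p'deg_Res_irr p'm _; rewrite -?Di.
    split=> //; have /irrP[t Dt] := irrR; rewrite Dt; apply: (special_Res nsNG sp).
    by rewrite Dt constt_irr inE.
  split=> [chi sp|chi1 chi2 sp1 sp2].
    by rewrite -(cfResRes _ sHN sNG); apply: irrN; case: (ResN _ sp).
  rewrite -![X in X = _ -> _](cfResRes _ sHN sNG) -![X in _ = X -> _](cfResRes _ sHN sNG) => eqH.
  have [irr1 spN1] := ResN _ sp1; have [_ spN2] := ResN _ sp2.
  have eqN := injN _ _ spN1 spN2 eqH; have /irrP[t Dt] := irr1.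
  have [/irrP[i1 D1] _ _] := sp1; have [/irrP[i2 D2] _ _] := sp2.
  have inv : (G \subset 'I['chi_t])%g.
    by apply: (extendible_irr_invariant (c := i1)) nsNG _; rewrite -D1.
  have [||c [_ _ uniq]] := extend_solvable_coprime_irr (t := t) nsNG _ inv.
  - apply: (@pgroup_sol _ p); rewrite /pgroup card_quotient ?normal_norm // idx pnat_id //.
  - have [m p'm deg] := special_deg spN1.
    rewrite idx -Dt deg natrK; apply: (@pnat_coprime p); first exact: pnat_id.
    by rewrite pnatM p'm andbT; apply: special_order.
  have cop (chi : 'CF(G)) : special chi -> coprime #|G : N|%g ('o(chi))%CF.
    by move=> sp; rewrite idx; apply: (@pnat_coprime p); [apply: pnat_id | apply: special_order].
  have Di1 : i1 = c by apply: uniq; rewrite -D1; [exact: Dt | exact: cop].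
  have Di2 : i2 = c by apply: uniq; rewrite -D2; [rewrite -eqN; exact: Dt | exact: cop].
  by rewrite D1 D2 Di1 Di2.
have defG := p'_index_mulHall nsNG hallH p'idx.
have hallD : (p^'.-Hall(N) (N :&: H)%G)%g by apply: pHall_setI_normal hallH.
have [irrN injN] := IHn N (N :&: H)%G lt_n psN hallD.
have spJ (t : Iirr N) g : g \in G -> special 'chi_t -> special ('chi_t ^ g)%CF.
  by move=> Gg; apply: is_conj_special; apply: is_conj_cfConjg; apply: (subsetP (normal_norm nsNG)).
have key (t : Iirr N) (spt : special 'chi_t) := @restrict_over_irr _ G N H t nsNG sHG defG
   (fun g Gg => irrN _ (spJ t g Gg spt)) (fun g h Gg Gh => injN _ _ (spJ t g Gg spt) (spJ t h Gh spt)).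
split=> [chi sp|chi1 chi2 sp1 sp2 eqH].
  have [/irrP[i Di] _ _] := sp; rewrite Di in sp *; have [t ct] := constt_cfRes_irr N i.
  by have [irrH _] := key t (special_Res nsNG sp ct); apply: irrH.
have [/irrP[i Di] _ _] := sp1; have [/irrP[j Dj] _ _] := sp2.
rewrite Di Dj in sp1 sp2 eqH *; have [t ct] := constt_cfRes_irr N i.
have spt := special_Res nsNG sp1 ct.
(* The characters agree on [N :&: H], where distinct special characters of [N] restrict to distinct
   irreducibles; so they lie over a common character of [N]. *)
suff ct2 : t \in irr_constt ('Res[N] 'chi_j) by have [_ inj] := key t spt; rewrite (inj i j).
have /irrP[d Dd] := irrN _ spt.
have cd : d \in irr_constt ('Res[(N :&: H)%G] 'chi_j).
  rewrite -(cfResRes _ (subsetIr N H) sHG) -eqH (cfResRes _ (subsetIr N H) sHG).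
  apply: (constt_Res_below (subsetIl N H) sNG (irr_char i) ct).
  by rewrite Dd constt_irr inE.
have [u cu cud] := constt_Res_above (subsetIl N H) sNG (irr_char j) cd.
have spu := special_Res nsNG sp2 cu.
have eqtu : 'chi_t = 'chi_u.
  by apply: injN => //; rewrite Dd (irr_constt_self (irrN _ spu) cud).
by rewrite (irr_inj eqtu).
Qed.
End SpecialHall.

Section Determinants.
Variables (gT : finGroupType) (pi : nat_pred).
Implicit Types (G H N : {group gT}).

Lemma det_order_constt G (psi : 'CF(G)) : psi \is a character ->
    (forall i, i \in irr_constt psi -> pi.-nat ('o('chi_i))%CF) -> pi.-nat #[cfDet psi]%CF.
Proof.
case/char_sum_irr=> r -> ord.
have {}ord i : i \in r -> pi.-nat ('o('chi_i))%CF.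
  move=> ri; apply: ord; rewrite irr_consttE cfdot_suml.
  rewrite (eq_bigr (fun j => (j == i)%:R)) => [|j _]; last by rewrite cfdot_irr.
  elim: r ri => // j r IHr; rewrite in_cons big_cons => /predU1P[->|/IHr nz].
    by rewrite eqxx -natr_sum -natrD pnatr_eq0.
  by move: nz; rewrite -!natr_sum -natrD !pnatr_eq0 addn_eq0 negb_and orbC => ->.
elim: r ord => [|i r IHr] ord; first by rewrite big_nil cfDet0; apply: (cforder_dvd_pnat (k := 1)).
have Nr : \sum_(j <- r) 'chi_j \is a character by apply: rpred_sum => j _; apply: irr_char.
rewrite big_cons cfDetD ?irr_char //.
apply: cforderM_pnat; first by apply: ord; rewrite mem_head.
by apply: IHr => j rj; apply: ord; rewrite in_cons rj orbT.
Qed.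

Lemma lin_char_exp G (xi : 'CF(G)) k : xi \is a linear_char -> xi ^+ k \is a linear_char.
Proof. by move=> linxi; apply: rpredX. Qed.

Lemma lin_char_index_exp G N (xi : 'CF(G)) : (N <| G)%g -> xi \is a linear_char ->
  'Res[N] xi = 1 -> xi ^+ #|G : N|%g = 1.
Proof.
move=> nsNG lin1 xiN; have [sNG nNG] := andP nsNG.
have kerN : N \subset cfker xi by rewrite -subsetIidl -cfker_Res ?lin_charW // xiN cfker_cfun1.
apply/eqP; rewrite -(cfQuoK nsNG kerN) -rmorphXn cfMod_eq1 //.
by rewrite -dvdn_cforder -card_quotient // cforder_lin_char_dvdG ?cfQuo_lin_char.
Qed.
End Determinants.

(** * Special characters above a special character of a normal subgroup *)

Section Special.
Variables (gT : finGroupType) (p : nat).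
Hypothesis p_pr : prime p.
Implicit Types (G H N M : {group gT}).
Local Notation special := (pi_special p^').

(** The restriction to a Hall p'-subgroup is irreducible, so the degree divides its order. The
    determinant has p'-order on [N], and the p'-index of [N] adds only p'-order. *)
Lemma special_p'_over G N (i : Iirr G) (t : Iirr N) : p_solvable p G -> (N <| G)%g ->
    p^'.-nat #|G : N|%g -> special 'chi_t -> t \in irr_constt ('Res[N] 'chi_i) ->
  special 'chi_i.
Proof.
have [n] := ubnP #|G|; elim: n G N i t => // n IHn G N i t /ltnSE-le_n psG nsNG p'idx spt ct.
have sNG := normal_sub nsNG; apply: special_intro; first exact: mem_irr.
- have [H hallH] := p_solvable_p'_Hall psG; have sHG := pHall_sub hallH.
  have defG := p'_index_mulHall nsNG hallH p'idx.
  have hallD : (p^'.-Hall(N) (N :&: H)%G)%g by apply: pHall_setI_normal hallH.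
  have [irrN injN] := special_Hall p_pr (p_solvable_sub psG sNG) hallD.
  have spJ g : g \in G -> special ('chi_t ^ g)%CF.
    by move=> Gg; apply: is_conj_special spt; apply: is_conj_cfConjg; apply: (subsetP (normal_norm nsNG)).
  have [irrH _] := @restrict_over_irr _ G N H t nsNG sHG defG
    (fun g Gg => irrN _ (spJ g Gg)) (fun g h Gg Gh => injN _ _ (spJ g Gg) (spJ h Gh)).
  have /irrP[j Dj] := irrH i ct; have /natrP[m Dm] := Cnat_irr1 j; exists m.
    by apply: pnat_dvd (pHall_pgroup hallH); rewrite -dvdC_nat; have := dvd_irr1_cardG j; rewrite Dm.
  by rewrite -Dm -Dj cfRes1.
- have ordN : p^'.-nat #['Res[N] (cfDet 'chi_i)]%CF.
    rewrite -cfDetRes ?irr_char //; apply: det_order_constt; first by rewrite cfRes_char ?irr_char.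
    by move=> u cu; apply: special_order; apply: special_constt_conj nsNG spt ct cu.
  set xi := cfDet _ in ordN; rewrite /cfDet_order -/xi.
  have linxi : xi \is a linear_char := cfDet_lin_char _.
  apply: (@cforder_dvd_pnat _ _ _ _ (#['Res[N] xi]%CF * #|G : N|%g)%N); last by rewrite pnatM ordN.
  rewrite exprM; apply: lin_char_index_exp (lin_char_exp _ linxi) _ => //.
  by rewrite rmorphXn /= exp_cforder.
move=> M nsMG prM j cj; have [sMG nMG] := andP nsMG.
have nsDM : (N :&: M <| M)%g by rewrite setIC; apply: normalGI sMG nsNG.
have [u cu] := constt_cfRes_irr (N :&: M)%G j.
apply: (IHn M (N :&: M)%G j u) => //.
- exact: leq_trans (proper_card prM) le_n.
- exact: p_solvable_sub psG sMG.
- by rewrite /= setIC; apply: pnat_dvd (index_setI_dvd nsNG sMG) p'idx.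
have cui : u \in irr_constt ('Res[(N :&: M)%G] 'chi_i).
  exact: constt_Res_below (subsetIr N M) sMG (irr_char i) cj cu.
have [v cv cvu] := constt_Res_above (subsetIl N M) sNG (irr_char i) cui.
have nsDN : (N :&: M <| N)%g by exact: normalGI sNG nsMG.
exact: special_Res nsDN (special_constt_conj nsNG spt ct cv) cvu.
Qed.

(** The candidate is the canonical extension, whose determinantal order is that of [chi_t]. What
    needs work is specialness on a proper normal [M] outside [N]: there the constituent extends a
    special character of [D], and it is the canonical extension once its determinant has
    p'-order. *)
Lemma special_extend G N (t : Iirr N) : (N <| G)%g -> #|G : N|%g = p ->
    special 'chi_t -> (G \subset 'I['chi_t])%g ->
  exists c : Iirr G, special 'chi_c /\ 'Res[N] 'chi_c = 'chi_t.
Proof.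
have [n] := ubnP #|G|; elim: n G N t => // n IHn G N t /ltnSE-le_n nsNG idx spt inv.
have [sNG nNG] := andP nsNG; have [m p'm deg] := special_deg spt.
have p'ord := special_order spt.
have solGN (G1 N1 : {group gT}) : (N1 <| G1)%g -> #|G1 : N1|%g = p -> solvable (G1 / N1)%g.
  move=> ns1 idx1; apply: (@pgroup_sol _ p); rewrite /pgroup card_quotient ?normal_norm // idx1 pnat_id //.
have cop (a : nat) : p^'.-nat a -> coprime p a by apply: pnat_coprime (pnat_id p_pr).
have [|c [Rc oc uc]] := extend_solvable_coprime_irr nsNG (solGN _ _ nsNG idx) inv.
  by rewrite idx deg natrK cop // pnatM p'ord.
exists c; split=> //; apply: special_intro; first exact: mem_irr.
- by exists m; rewrite // -deg -Rc cfRes1.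
- by rewrite oc.
move=> M nsMG prM k ck; have [sMG nMG] := andP nsMG.
have [sMN|nsMN] := boolP (M \subset N).
  apply: special_Res (normalS sMN sNG nsMG) spt _; by rewrite -Rc cfResRes.
pose D := (N :&: M)%G; have nsDM : (D <| M)%g by rewrite /= setIC; exact: normalGI sMG nsNG.
have sDM := normal_sub nsDM; have sDN : D \subset N := subsetIl N M.
have sNK : N \subset (N <*> M)%g := joing_subl N M.
have sKG : (N <*> M)%g \subset G by rewrite join_subG sNG.
have idxK : #|(N <*> M)%g : N|%g = p.
  apply/prime_nt_dvdP => //; first by rewrite indexg_eq1 join_subG subxx.
  by rewrite -idx; apply: indexSg.
have defG : (N <*> M)%g = G.
  apply/eqP; rewrite eqEsubset sKG -indexg_eq1 -(eqn_pmul2r (prime_gt0 p_pr)) mul1n -[in X in (_ * X)%N]idxK.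
  by rewrite andTb Lagrange_index // idx.
have idxD : #|M : D|%g = p.
  have -> : #|M : D|%g = #|M : N|%g by rewrite /D /= setIC indexgI.
  apply/eqP; rewrite -(eqn_pmul2r (cardG_gt0 N)) LagrangeMr -norm_joinEl ?(subset_trans sMG) //.
  by rewrite joingC -(Lagrange sNK) idxK mulnC.
have [u cu] := constt_cfRes_irr D k.
have [mk Dmk] : exists mk, 'chi_k 1%g = mk%:R by apply/natrP; apply: Cnat_irr1.
have [s Es] := dvdn_constt_Res1_irr1 nsMG ck.
have Em : m = (s * mk)%N.
  by apply/eqP; rewrite -(eqr_nat algC) natrM -Dmk -Es -(cfRes1 N) Rc deg.
have [p's p'mk] : p^'.-nat s /\ p^'.-nat mk by apply/andP; rewrite -pnatM -Em.
have irrD := p'deg_Res_irr p_pr nsDM idxD p'mk Dmk.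
have Du : 'Res[D] 'chi_k = 'chi_u by rewrite (irr_constt_self irrD cu).
have nsDN : (D <| N)%g by rewrite /=; exact: normalGI sNG nsMG.
have spu : special 'chi_u.
  apply: special_Res nsDN spt _; rewrite -Rc (cfResRes _ sDN sNG).
  exact: constt_Res_below sDM sMG (irr_char c) ck cu.
have invD : (M \subset 'I['chi_u])%g by apply: (extendible_irr_invariant (c := k)) nsDM Du.
have ltM : (#|M| < n)%N := leq_trans (proper_card prM) le_n.
have [k' [spk' Rk']] := IHn M D u ltM nsDM idxD spu invD.
have [mu p'mu degu] := special_deg spu.
have [|c' [_ _ uc']] := extend_solvable_coprime_irr nsDM (solGN _ _ nsDM idxD) invD.
  by rewrite idxD degu natrK cop // pnatM special_order.
suff p'ok : p^'.-nat ('o('chi_k))%CF.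
  have -> : k = k'; last exact: spk'.
  have copD (l : Iirr M) : p^'.-nat ('o('chi_l))%CF -> coprime #|M : D|%g ('o('chi_l))%CF.
    by rewrite idxD; apply: cop.
  have -> : k' = c' by apply: uc' Rk' _; apply: copD; apply: special_order.
  by apply: uc' Du _; apply: copD.
set a := ('o('chi_u))%CF; have p'a : p^'.-nat a := special_order spu.
(* This power is trivial on [D], so it has order dividing p. The determinant of the restriction of
   [chi_c] to [M] multiplies the determinants of all conjugates of [chi_k]; invariance of [lambda]
   turns this into a p'-power of [lambda] of p'-order. *)
pose lambda := cfDet 'chi_k ^+ a; have linl : lambda \is a linear_char by apply: lin_char_exp; apply: cfDet_lin_char.
have lD : 'Res[D] lambda = 1 by rewrite rmorphXn /= -cfDetRes ?irr_char // Du exp_cforder.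
suff l1 : lambda = 1 by apply: (cforder_dvd_pnat (k := a)).
have lp : lambda ^+ p = 1 by rewrite -idxD; apply: lin_char_index_exp.
(* Since [G] is the join of [N] and [M], only [N] matters, and its commutators with [M] lie in [D],
   where [lambda] is trivial. *)
have invl : (G \subset 'I[lambda])%g.
  rewrite -defG join_subG sub_inertia andbT; apply/subsetP=> y Ny.
  have Gy := subsetP sNG y Ny; have nMy := subsetP nMG y Gy.
  rewrite inE nMy; apply/eqP/cfun_inP=> x Mx; rewrite cfConjgE //.
  have Dc : [~ x, y^-1]%g \in D.
    have nDy : x \in 'N(N)%g := subsetP nNG _ (subsetP sMG _ Mx).
    rewrite inE; apply/andP; split.
      by rewrite commgEr groupM ?groupV // memJ_norm ?groupV.
    by rewrite commgEl groupM ?groupV // memJ_norm ?groupV // groupV.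
  have lc : lambda [~ x, y^-1]%g = 1.
    by have := congr1 (fun f : 'CF(D) => f [~ x, y^-1]%g) lD; rewrite cfResE // cfun1E Dc.
  by rewrite conjg_mulR lin_charM ?lc ?mulr1 //; apply: (subsetP sDM).
have [e De] : exists e, '['Res[M] 'chi_c, 'chi_k] = e%:R.
  by apply/natrP; rewrite Cnat_cfdot_char ?cfRes_char ?irr_char.
have Dres := Clifford_Res_sum_cfclass nsMG ck; rewrite De scaler_nat in Dres.
set cls := ('chi_k ^: G)%CF in Dres.
have clsP xi : xi \in cls -> xi \in irr M /\ cfDet xi ^+ a = lambda /\ xi 1%g = mk%:R.
  case/cfclassP=> g Gg ->; split; first by rewrite cfConjg_irr ?mem_irr.
  by rewrite cfDetConjg -rmorphXn /= -/lambda cfConjg1 Dmk (inertiaJ (subsetP invl g Gg)).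
have detS (r : seq 'CF(M)) : {subset r <= cls} ->
   cfDet (\sum_(xi <- r) xi) ^+ a = lambda ^+ size r /\ (\sum_(xi <- r) xi) 1%g = (size r * mk)%:R.
  elim: r => [|xi r IHr] sub; first by rewrite !big_nil cfDet0 expr1n cfunE.
  have [irrxi [dxi degxi]] := clsP xi (sub xi (mem_head _ _)).
  have subr : {subset r <= cls} by move=> eta reta; apply: sub; rewrite in_cons reta orbT.
  have [dr degr] := IHr subr; have Nxi := irrWchar irrxi.
  have Nr : \sum_(xi <- r) xi \is a character.
    by rewrite big_seq; apply: rpred_sum => eta /subr/clsP[/irrWchar].
  rewrite !big_cons cfDetD //.
  by rewrite exprMn dxi dr cfunE degxi degr -natrD -exprS /= mulSn.
have [dS degS] := detS cls (fun _ h => h).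
have Em' : m = (size cls * mk * e)%N.
  apply/eqP; rewrite -(eqr_nat algC) -deg -Rc cfRes1 -(cfRes1 M) Dres.
  by rewrite -scaler_nat cfunE degS -natrM mulnC.
have p'se : p^'.-nat (size cls * e)%N.
  by apply: pnat_dvd p'm; rewrite Em' mulnAC dvdn_mulr.
have detM : cfDet ('Res[M] 'chi_c) ^+ a = lambda ^+ (size cls * e).
  rewrite Dres cfDetMn; last by rewrite big_seq; apply: rpred_sum => eta /clsP[/irrWchar].
  by rewrite -exprM mulnC exprM dS -exprM.
have pl : p.-nat #[lambda]%CF by apply: (cforder_dvd_pnat lp); apply: pnat_id.
apply: (cforder_pi_pi'_1 pl (k := (size cls * e * ('o('chi_t))%CF)%N)).
  by rewrite pnatM p'se.
rewrite exprM -detM -exprM mulnC exprM cfDetRes ?irr_char // -rmorphXn /=.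
by rewrite -oc exp_cforder rmorph1 expr1n.
Qed.
End Special.

Section Constituents.
Variable gT : finGroupType.
Implicit Types (G D N : {group gT}).

Lemma constt_mul G (phi psi : 'CF(G)) i : i \in irr_constt (phi * psi) ->
  exists a b, [/\ a \in irr_constt phi, b \in irr_constt psi & i \in irr_constt ('chi_a * 'chi_b)].
Proof.
rewrite irr_consttE => nz; apply: boolp.contrapT => no; case/eqP: nz.
rewrite {1}(cfun_sum_constt phi) mulr_suml cfdot_suml big1 // => a ca.
rewrite -scalerAl cfdotZl {1}(cfun_sum_constt psi) mulr_sumr cfdot_suml big1 ?mulr0 // => b cb.
rewrite -scalerAr cfdotZl; apply/eqP; rewrite mulf_eq0; apply/orP; right.
by apply/negPn/negP=> nz; case: no; exists a, b.
Qed.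

Lemma common_constt_dot G (phi psi : 'CF(G)) i : phi \is a character -> psi \is a character ->
  i \in irr_constt phi -> i \in irr_constt psi -> '[phi, psi] != 0.
Proof.
move=> Nphi Npsi ci /(constt_charP i Npsi)[rest Nrest ->].
rewrite cfdotDr; apply: lt0r_neq0; apply: ltr_wpDr.
  by rewrite natr_ge0 // Cnat_cfdot_char.
by rewrite lt0r -irr_consttE ci natr_ge0 // Cnat_cfdot_char ?irr_char.
Qed.
End Constituents.

(** * Coprime cancellation of special factors *)

Section Cancel.
Variables (gT : finGroupType) (p : nat).
Hypothesis p_pr : prime p.
Implicit Types (G H D N M : {group gT}).
Local Notation special := (pi_special p^').

Lemma p'group_special H (i : Iirr H) : (p^'.-group H)%g -> special 'chi_i.
Proof.
move=> p'H; split; first exact: mem_irr.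
  have /natrP[m Dm] := Cnat_irr1 i; exists m; split=> //.
  by apply: pnat_dvd p'H; rewrite -dvdC_nat; have := dvd_irr1_cardG i; rewrite Dm.
move=> S snSH j _; apply: pnat_dvd (pgroupS (subnormal_sub snSH) p'H).
by apply: cforder_lin_char_dvdG; apply: cfDet_lin_char.
Qed.

(** By induction [xi] is trivial on [N], hence linear. Over a p'-quotient its order is both a
    p-number and a p'-number. Over index p, [nu = xi * nu'] and the two agree on a Hall p'-subgroup,
    so they coincide; comparing determinants gives [xi ^+ m = 1] with [m] the degree, prime to p. *)
Lemma special_pi_cancel D (nu nu' xi : 'CF(D)) : p_solvable p D -> special nu -> special nu' ->
  pi_special (p^')^' xi -> '[nu' * xi, nu] != 0 -> xi = 1.
Proof.
have [n] := ubnP #|D|; elim: n D nu nu' xi => // n IHn D nu nu' xi /ltnSE-le_n psD sp_nu sp_nu' sp_xi nz.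
have [irr_nu _ _] := sp_nu; have [irr_nu' _ _] := sp_nu'; have [irr_xi _ _] := sp_xi.
have /irrP[x Dx] := irr_xi; have /irrP[k Dk] := irr_nu.
have [D1|[N [nsND prN psN idx]]] := p_solvable_prime_step p_pr psD.
  have abD : abelian D by rewrite D1 abelian1.
  apply/cfun_inP=> y Dy; rewrite cfun1E Dy; have /set1P-> : y \in [1 gT]%g by rewrite -D1.
  by rewrite Dx lin_char1 //; apply: (elimT (char_abelianP _)).
have [sND nND] := andP nsND.
have kerN : N \subset cfker xi.
  have [u cu] := constt_cfRes_irr N k.
  have ck : k \in irr_constt (nu' * xi) by rewrite irr_consttE -Dk.
  have Nm : nu' * xi \is a character by rewrite rpredM ?irrWchar.
  have cuR : u \in irr_constt ('Res[N] (nu' * xi)).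
    have /(constt_charP k Nm)[rest Nrest ->] := ck.
    rewrite raddfD /= irr_consttE cfdotDl; apply: lt0r_neq0; apply: ltr_wpDr.
      by rewrite natr_ge0 // Cnat_cfdot_char ?irr_char ?cfRes_char.
    by rewrite lt0r -irr_consttE cu natr_ge0 // Cnat_cfdot_char ?irr_char ?cfRes_char ?irr_char.
  move: cuR; rewrite rmorphM /= => /constt_mul[a [b [ca cb cab]]].
  have b1 : 'chi_b = 1.
    apply: (IHn N 'chi_u 'chi_a); rewrite ?(leq_trans (proper_card prN)) //.
    - by apply: special_Res nsND sp_nu _; rewrite Dk.
    - exact: special_Res nsND sp_nu' _.
    - exact: special_Res nsND sp_xi _.
  have b0 : b = 0 by apply: irr_inj; rewrite b1 irr0.
  by rewrite Dx; apply: constt0_Res_cfker nsND _; rewrite -Dx -b0.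
have linxi : xi \is a linear_char.
  have kerx : N \subset cfker 'chi_x by rewrite -Dx.
  pose y := quo_Iirr N x; have Dy : 'chi_y = ('chi_x / N)%CF by rewrite quo_IirrE.
  suff liny : 'chi_y \is a linear_char by rewrite Dx -(cfQuoK nsND kerx) -Dy cfMod_lin_char.
  case/orP: idx => [/eqP idx|p'idx].
    apply: (elimT (char_abelianP _)); apply/cyclic_abelian/prime_cyclic.
    by rewrite card_quotient // idx.
  have [m pm degm] := special_deg sp_xi.
  have degy : 'chi_y 1%g = m%:R by rewrite Dy cfQuo1 -Dx.
  have m1 : m = 1%N.
    apply: (@pnat_1 p^'); last by [].
    apply: pnat_dvd p'idx; rewrite -card_quotient // -dvdC_nat.
    by have := dvd_irr1_cardG y; rewrite degy.
  by rewrite qualifE /= irr_char degy m1 eqxx.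
have xiN : 'Res[N] xi = 1 by rewrite cfRes_sub_ker // lin_char1 // scale1r.
have xiX := lin_char_index_exp nsND linxi xiN.
case/orP: idx => [/eqP idx|p'idx]; last first.
  have ordxi := special_order sp_xi; rewrite /cfDet_order cfDet_id // in ordxi.
  by apply: cforder_pi_pi'_1 ordxi _ xiX; rewrite (pnatNK p^').
have Dnu : xi * nu' = nu.
  rewrite Dk; apply/esym/irr_constt_self; first exact: mul_lin_irr.
  by rewrite irr_consttE mulrC -Dk.
have [H hallH] := p_solvable_p'_Hall psD; have [sHD p'H _] := and3P hallH.
have [_ injH] := special_Hall p_pr psD hallH.
have sHN : H \subset N.
  apply/subsetP=> h Hh; apply: (pi'_elt_quotient nsND) (mem_p_elt p'H Hh); last exact: (subsetP sHD).
  by rewrite /pgroup card_quotient // idx pnat_id.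
have eqnu : nu' = nu.
  apply: injH => //; rewrite -Dnu rmorphM /= -[in 'Res xi](cfResRes _ sHN sND) xiN.
  by rewrite rmorph1 mul1r.
have [m p'm degm] := special_deg sp_nu.
have xim : xi ^+ m = 1.
  have := congr1 (@cfDet _ D) Dnu; rewrite eqnu cfDet_mul_lin ?irrWchar // degm natrK.
  move=> E; apply/cfun_inP=> y Dy; rewrite cfun1E Dy.
  have nz_det : cfDet nu y != 0 by apply: lin_char_neq0 => //; apply: cfDet_lin_char.
  by apply: (mulIf nz_det); rewrite mul1r -[in RHS]E [RHS]cfunE.
by apply: (cforder_pi_pi'_1 (pi := p)) xim => //; rewrite -idx; apply: (cforder_dvd_pnat xiX); rewrite idx pnat_id.
Qed.
End Cancel.

(** * Special characters and representations of p'-dimension *)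

Section CliffordExtra.
Variables (F : closedFieldType) (gT : finGroupType) (G N : {group gT}) (nsNG : (N <| G)%g).
Let sNG := normal_sub nsNG.
Let nNG := subsetP (normal_norm nsNG).
Variables (d : nat) (s : mx_representation F N d) (n : nat) (M : mx_representation F G n).
Hypotheses (irr_s : mx_irreducible s) (irrM : mx_irreducible M) (Ms : constt_repr (subg_repr M sNG) s).

Lemma Clifford_dim_dvd : (d %| n)%N.
Proof.
have [U [simU simUs]] := Clifford_simple_constt irr_s irrM Ms.
have [_ rkU _ _] := simUs.
have [X sXG [/= def1 dirX]] := Clifford_basis irrM simU.
rewrite -(mxrank1 F n) -def1 (mxdirectP dirX) /=.
apply: (big_ind (fun k => d %| k)%N) => // [k l dk dl|x Xx]; first exact: dvdn_add.
by rewrite mxrankMfree ?repr_mx_free ?(subsetP sXG) // rkU.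
Qed.

Lemma Clifford_Res_constt (D : {group gT}) (sDN : D \subset N) (sDG : D \subset G) k
    (r : mx_representation F D k) :
    (forall g (Gg : g \in G), mx_irreducible (subg_repr (conj_repr s (nNG Gg)) sDN)) ->
    mx_irreducible r -> constt_repr (subg_repr M sDG) r ->
  exists g (Gg : g \in G), mx_rsim (subg_repr (conj_repr s (nNG Gg)) sDN) r.
Proof.
move=> irrD irr_r Mr; have [fam] := irr_family_exists F D; have [j sim_rj] := fam_all fam irr_r.
have [a [a1 a0]] := fam_separated j (enum (fam_ix fam)).
have [U [simU simUs]] := Clifford_simple_constt irr_s irrM Ms.
apply: boolp.contrapT => no.
have /Mr : gring_mx (subg_repr M sDG) a = 0.
  rewrite -(gring_mx_subg_trans sDN sNG sDG) -(gring_inclE sDN).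
  apply: (Clifford_span irrM simU) => x Gx.
  pose simUx := Clifford_simple simU Gx.
  rewrite -[RHS](scale0r (U *m M x)).
  apply: (mul_gring_submod (modU := mxsimple_module simUx) (submx_refl _)).
  rewrite -scalemx1 scale0r; apply/eqP; rewrite (rsim_gring_mx _ (r2 := conj_repr s (nNG Gx))); last first.
    by apply: mx_rsim_trans (Clifford_conj_rsim simU Gx) _; apply: conj_repr_rsim.
  have [i sim_i] := fam_all fam (irrD x Gx).
  rewrite (gring_inclE sDN) (rsim_gring_mx _ sim_i) a0 ?mem_enum //.
  apply/eqP => eqij; apply: no; exists x, Gx.
  by apply: mx_rsim_trans sim_i _; rewrite eqij; apply: mx_rsim_sym.
move/eqP; rewrite (rsim_gring_mx _ sim_rj) a1 => /eqP/matrixP E.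
have /mx_irrP[n_gt0 _] := fam_irr j; have := E (Ordinal n_gt0) (Ordinal n_gt0).
by rewrite !mxE eqxx => /eqP; rewrite oner_eq0.
Qed.
End CliffordExtra.

Section ModularSpecial.
Variables (F : closedFieldType) (p : nat) (lam : F -> algC).
Hypothesis setup : brauer_setup p lam.
Let p_pr : prime p. Proof. by case: setup. Qed.
Let pF : p \in [pchar F]. Proof. by case: setup. Qed.
Variable gT : finGroupType.
Implicit Types (G H N : {group gT}).
Local Notation special := (pi_special p^').
Local Notation reduces := (reduces p lam).

Lemma p'group_reduces_inj H (chi psi : 'CF(H)) n1 n2 (r1 : mx_representation F H n1)
    (r2 : mx_representation F H n2) : (p^'.-group H)%g ->
  reduces chi r1 -> reduces psi r2 -> mx_rsim r1 r2 -> chi = psi.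
Proof.
move=> p'H red1 red2 sim; apply/cfun_inP=> x Hx; have p'x := mem_p_elt p'H Hx.
by rewrite -red1 // -red2 // (brauer_val_rsim lam sim).
Qed.

Lemma special_reduces_irr G (chi : 'CF(G)) n (r : mx_representation F G n) :
  p_solvable p G -> special chi -> reduces chi r -> mx_irreducible r.
Proof.
move=> psG spc red; have [H hallH] := p_solvable_p'_Hall psG; have [sHG p'H _] := and3P hallH.
have [/(_ _ spc)/irrP[j Dj] _] := special_Hall p_pr psG hallH.
apply: (@subg_mx_irr _ _ _ _ _ _ sHG); apply: (p'group_reduces_irr setup p'H (i := j)).
by rewrite -Dj; apply: reduces_sub.
Qed.

Lemma special_reduces_inj G (chi psi : 'CF(G)) n1 n2 (r1 : mx_representation F G n1)
    (r2 : mx_representation F G n2) : p_solvable p G -> special chi -> special psi ->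
  reduces chi r1 -> reduces psi r2 -> mx_rsim r1 r2 -> chi = psi.
Proof.
move=> psG spc spp red1 red2 sim; have [H hallH] := p_solvable_p'_Hall psG; have [sHG p'H _] := and3P hallH.
have [_ inj] := special_Hall p_pr psG hallH; apply: inj => //.
apply: p'group_reduces_inj p'H (reduces_sub sHG red1) (reduces_sub sHG red2) _.
have [B eqn freeB hom] := sim; exists B => // x Hx; apply: hom; exact: (subsetP sHG).
Qed.

(** Over index p the dimension forces [chi_t] to be invariant, so it has a special extension, and
    [M] is the only irreducible over the p-quotient. Over a p'-index [M] is irreducible on the Hall
    subgroup [H], lifts there to [chi_i], and a special character of [G] restricting to [chi_i] is
    sought. *)
Lemma p'dim_special_lift G n (M : mx_representation F G n) : p_solvable p G ->
  mx_irreducible M -> ~~ (p %| n)%N -> exists chi : 'CF(G), special chi /\ reduces chi M.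
Proof.
have [k] := ubnP #|G|; elim: k G n M => // k IHk G n M /ltnSE-le_k psG irrM p'n.
have [G1|[N [nsNG prN psN idx]]] := p_solvable_prime_step p_pr psG.
  have p'G : (p^'.-group G)%g by rewrite G1; apply: pgroup1.
  have [i red] := p'group_irr_lift setup p'G irrM; exists 'chi_i; split=> //.
  exact: p'group_special.
have [sNG nNG] := andP nsNG; have nNG' := subsetP nNG.
have [U simU] := Clifford_simple_exists nsNG irrM.
set s := submod_repr (mxsimple_module simU).
have irr_s : mx_irreducible s by apply/submod_mx_irr.
have Ms : constt_repr (subg_repr M (normal_sub nsNG)) s.
  by move=> a E; rewrite gring_mx_submod E mulmx0 linear0.
have p'd : ~~ (p %| \rank U)%N.
  by apply: contra p'n => /dvdn_trans; apply; apply: Clifford_dim_dvd irr_s irrM Ms.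
have [nu [sp_nu red_nu]] := IHk N _ s (leq_trans (proper_card prN) le_k) psN irr_s p'd.
have [irr_nu _ _] := sp_nu; have /irrP[t Dt] := irr_nu; rewrite Dt in sp_nu red_nu.
have spJ g : g \in G -> special ('chi_t ^ g)%CF.
  by move=> Gg; apply: is_conj_special sp_nu; apply: is_conj_cfConjg; apply: nNG'.
have redJ g (nNg : g \in ('N(N))%g) : reduces ('chi_t ^ g)%CF (conj_repr s nNg).
  exact: reduces_conj red_nu.
have irrJ g (nNg : g \in ('N(N))%g) : mx_irreducible (conj_repr s nNg) by apply: conj_repr_irr.
case/orP: idx => [/eqP idx|p'idx].
  pose T := ('I_G['chi_t])%G; have sTG : T \subset G := subsetIl _ _.
  have sNT : N \subset T by exact: sub_Inertia.
  have iT x (Gx : x \in G) : x \in T <-> mx_rsim (conj_repr s (subsetP (normal_norm nsNG) x Gx)) s.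
    split=> [/setIP[_ Ix]|sim].
      apply: (reduces_irr_rsim setup _ irr_s _ red_nu); first exact: irrJ.
      by rewrite -[X in reduces X _](inertiaJ Ix); apply: redJ.
    rewrite inE Gx inE nNG' //=; apply/eqP.
    exact: special_reduces_inj (spJ x Gx) sp_nu (redJ _ _) red_nu sim.
  have [n1 [r1 [[_ Dn] _ _ _ _]]] := Clifford_correspondence sTG sNT irr_s iT irrM Ms.
  have GT : (G \subset 'I['chi_t])%g.
    have dvd_p : (#|G : T|%g %| p)%N by rewrite -idx; apply: indexgS.
    have p'T : ~~ (p %| #|G : T|%g)%N by apply: contra p'n => dvT; rewrite Dn dvdn_mulr.
    have : #|G : T|%g == 1%N.
      by apply: contraR p'T => n1'; rewrite (prime_nt_dvdP p_pr n1' dvd_p).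
    by rewrite indexg_eq1 => /subset_trans; apply; apply: subsetIr.
  have [c [sp_c Rc]] := special_extend p_pr nsNG idx sp_nu GT.
  have [m [R redR]] := reduces_exists setup (irr_char c).
  have irrR := special_reduces_irr psG sp_c redR.
  exists 'chi_c; split=> //; apply: (reduces_rsim _ redR).
  apply: (p_quotient_irr_rsim pF _ irr_s irrR irrM _ Ms).
    by rewrite /pgroup card_quotient // idx pnat_id.
  have redN := reduces_sub (normal_sub nsNG) redR; rewrite Rc in redN.
  apply: constt_repr_rsim; apply: (reduces_irr_rsim setup _ irr_s redN red_nu).
  exact: special_reduces_irr psN sp_nu redN.
have [H hallH] := p_solvable_p'_Hall psG; have [sHG p'H _] := and3P hallH.
have defG := p'_index_mulHall nsNG hallH p'idx.
pose D := (N :&: H)%G; pose sDN : D \subset N := subsetIl N H; have sDH : D \subset H := subsetIr N H.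
have hallD : (p^'.-Hall(N) D)%g by apply: pHall_setI_normal hallH.
have p'D : (p^'.-group D)%g := pHall_pgroup hallD.
have [irrD injD] := special_Hall p_pr psN hallD.
have irr_sD g (Gg : g \in G) :
    mx_irreducible (subg_repr (conj_repr s (subsetP (normal_norm nsNG) g Gg)) sDN).
  have /irrP[j Dj] := irrD _ (spJ g Gg); apply: (p'group_reduces_irr setup p'D (i := j)).
  by rewrite -Dj; apply: reduces_sub; apply: redJ.
have inj_sD g h (Gg : g \in G) (Gh : h \in G) :
    mx_rsim (subg_repr (conj_repr s (subsetP (normal_norm nsNG) g Gg)) sDN)
            (subg_repr (conj_repr s (subsetP (normal_norm nsNG) h Gh)) sDN) ->
    mx_rsim (conj_repr s (subsetP (normal_norm nsNG) g Gg))
            (conj_repr s (subsetP (normal_norm nsNG) h Gh)).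
  move=> sim; apply: (reduces_irr_rsim setup (irrJ _ _) (irrJ _ _) (redJ _ _)).
  rewrite (injD _ _ (spJ g Gg) (spJ h Gh)); first exact: redJ.
  by apply: p'group_reduces_inj p'D _ _ sim; apply: reduces_sub; apply: redJ.
have pF'H : ([pchar F]^'.-group H)%g by rewrite (eq_pgroup _ (eq_negn (pcharf_eq pF))).
have irrMH := restricted_irr sHG defG irr_s irr_sD inj_sD pF'H irrM Ms.
have [i red_i] := p'group_irr_lift setup p'H irrMH.
have [u cu] := constt_cfRes_irr D i.
have [m [r red_r]] := reduces_exists setup (irr_char u).
have irr_r := p'group_reduces_irr setup p'D red_r.
have sDG : D \subset G := subset_trans sDN sNG.
have Mr : constt_repr (subg_repr M sDG) r.
  move=> a; rewrite -(gring_mx_subg_trans sDH sHG sDG).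
  by apply: (reduces_constt setup _ cu (reduces_sub sDH red_i) red_r irr_r); rewrite cfRes_char ?irr_char.
(* Selects the conjugate of [chi_t] whose restriction to [D] is the constituent [chi_u] of [chi_i];
   inducing that conjugate to [G] gives a character with [chi_i] on [H]. *)
have [g [Gg sim_g]] := Clifford_Res_constt irr_s irrM Ms irr_sD irr_r Mr.
have nNg := subsetP (normal_norm nsNG) g Gg.
have /irrP[v Dv] : ('chi_t ^ g)%CF \in irr N by rewrite cfConjg_irr ?mem_irr.
have sp_v := spJ g Gg; rewrite Dv in sp_v.
have Du : 'Res[D] 'chi_v = 'chi_u.
  rewrite -Dv; apply: p'group_reduces_inj p'D _ red_r sim_g.
  by apply: reduces_sub; apply: redJ.
pose ind := 'Ind[G] 'chi_v.
have Nind : ind \is a character by rewrite cfInd_char ?irr_char.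
have cv : v \in irr_constt ('Res[N] ind).
  by rewrite irr_consttE cfdotC Frobenius_reciprocity fmorph_eq0 cfnorm_eq0 cfInd_eq0 ?irr_char // irr_neq0.
have ci : i \in irr_constt ('Res[H] ind).
  (* A character induced from the normal subgroup [N] vanishes off [N], so the inner product on [H]
     lives on [D], where the two characters share [chi_u]. *)
  have Dsum : \sum_(x in H) ('Res[H] ind) x * ('chi_i x)^* = \sum_(x in D) ('Res[D] ind) x * (('Res[D] 'chi_i) x)^*.
    rewrite (big_setID D) /= (setIidPr sDH) [X in _ + X]big1 ?addr0 => [|x].
      by apply: eq_bigr => x Dx; have Hx := subsetP sDH x Dx; rewrite !cfResE.
    rewrite inE => /andP[nDx Hx]; rewrite cfResE //.
    rewrite (cfun_on0 (cfInd_normal _ nsNG)) ?mul0r //.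
    by apply: contra nDx => Nx; rewrite inE Nx.
  have : '['Res[D] ind, 'Res[D] 'chi_i] != 0.
    apply: common_constt_dot cu; rewrite ?cfRes_char ?irr_char //.
    by apply: (constt_Res_below sDN sNG Nind cv); rewrite Du irr_consttE cfnorm_irr oner_eq0.
  rewrite irr_consttE !cfdotE Dsum !mulf_eq0 !negb_or => /andP[_ ->].
  by rewrite invr_eq0 neq0CG.
have [j cj cij] := constt_Res_above sHG (subxx G) Nind ci; rewrite cfRes_id in cj.
rewrite constt_Ind_Res in cj.
have sp_j := special_p'_over p_pr psG nsNG p'idx sp_v cj.
have [irrH _] := special_Hall p_pr psG hallH.
have Rj := irr_constt_self (irrH _ sp_j) cij.
have [l [R red_R]] := reduces_exists setup (irr_char j).
have irrR := special_reduces_irr psG sp_j red_R.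
exists 'chi_j; split=> //; apply: (reduces_rsim _ red_R); apply: mx_rsim_sym.
have Rs : constt_repr (subg_repr R (normal_sub nsNG)) s.
  apply: (reduces_constt setup _ (i := t) _ (reduces_sub _ red_R) red_nu irr_s); first by rewrite cfRes_char ?irr_char.
  by move: cj; rewrite !irr_consttE -Dv cfdot_Res_conjg.
apply: (restricted_rsim defG irr_s irr_sD inj_sD irrM irrR Ms Rs (sHG := sHG)).
apply: (reduces_irr_rsim setup irrMH _ red_i); last by rewrite Rj; apply: reduces_sub.
by apply: (p'group_reduces_irr setup p'H (i := i)); rewrite Rj; apply: reduces_sub.
Qed.
End ModularSpecial.

(** * Stable linear characters *)

Section Stable.
Variables (gT : finGroupType) (p : nat) (G0 Q : {group gT}) (delta : 'CF(Q)).
Hypothesis pQ : (p.-group Q)%g.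
Hypothesis lin_delta : delta \is a linear_char.
Hypothesis stable : forall x y, x \in Q -> y \in Q -> (y \in x ^: G0)%g -> delta x = delta y.
Implicit Types (H K R W : {group gT}).

(* [mu] is the extension of the stable character [delta] to [K]: its value at [x] *)
(* is that of [delta] at any [G0]-conjugate in [Q] of the p-part of [x].          *)
Definition stable_ext K (mu : 'CF(K)) := mu \is a linear_char /\
  forall x g, x \in K -> g \in G0 -> (x.`_p ^ g)%g \in Q -> mu x = delta (x.`_p ^ g)%g.

Lemma stable_conj x g h : g \in G0 -> h \in G0 -> (x ^ g)%g \in Q -> (x ^ h)%g \in Q ->
  delta (x ^ g)%g = delta (x ^ h)%g.
Proof.
move=> Gg Gh Qxg Qxh; apply: stable => //; apply/imsetP; exists (g^-1 * h)%g; rewrite ?groupM ?groupV //.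
by rewrite -conjgM mulgA mulgV mul1g.
Qed.

Lemma sylow_conj_into K R x : (p.-Sylow(K) (R :&: K))%g -> x \in K ->
  exists2 g, g \in K & (x.`_p ^ g)%g \in R.
Proof.
move=> sylK Kx; set y := (x.`_p)%g; have Ky : y \in K by rewrite groupX.
have py : (p.-group <[y]>)%g by rewrite /pgroup -orderE; apply: p_elt_constt.
have syK : (<[y]> \subset K)%g by rewrite cycle_subG.
have [g Kg sub] := Sylow_Jsub sylK syK py; exists g => //.
have : (y ^ g)%g \in (R :&: K)%g by apply: (subsetP sub); rewrite memJ_conjg cycle_id.
by case/setIP.
Qed.

(* On [R] the transfer [K -> R / ker delta] is the power [#|K : R|] of [delta], by stability. *)
Lemma stable_der1 K : K \subset G0 -> (p.-Sylow(K) (Q :&: K))%g ->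
  {in ((Q :&: K) :&: K^`(1))%g, forall x, delta x = 1}.
Proof.
move=> sKG sylK; pose P := (Q :&: K)%G; have sPQ : P \subset Q := subsetIl Q K.
have sPK : P \subset K := subsetIr Q K.
pose dP := 'Res[P] delta; have linP : dP \is a linear_char by rewrite cfRes_lin_char.
pose Z := (cfker dP)%G.
have nsZ : (Z <| P)%g by exact: cfker_normal.
pose alpha := restrm_morphism (normal_norm nsZ) (coset_morphism Z).
have imA : (alpha @* P = P / Z)%g by rewrite /= morphim_restrm setIid.
have abelA : abelian (alpha @* P)%g.
  rewrite imA sub_der1_abelian //; exact: lin_char_der1.
pose f (u : finmodule.FiniteModule.fmod_of abelA) : algC := (dP / Z)%CF (finmodule.FiniteModule.fmval u).
have linq : (dP / Z)%CF \is a linear_char by rewrite cfQuo_lin_char.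
have fP (u : finmodule.FiniteModule.fmod_of abelA) : finmodule.FiniteModule.fmval u \in (P / Z)%g.
  by rewrite -imA; apply: finmodule.FiniteModule.fmodP.
have fM u v : f (u + v) = f u * f v.
  by rewrite /f finmodule.FiniteModule.fmvalA lin_charM ?fP.
have f0 : f 0 = 1 by rewrite /f finmodule.FiniteModule.fmval0 lin_char1.
move=> g /setIP[Pg K'g]; have Kg := subsetP sPK g Pg.
have trX := transversalP (finmodule.rcosets_cycle_partition sPK Kg).
set X := transversal _ _ in trX.
have E := finmodule.transfer_cycle_expansion sPK abelA Kg trX.
have T0 : finmodule.transfer K abelA g = 0.
  suff /subsetP/(_ g K'g) : (K^`(1) \subset 'ker (finmodule.transfer_morphism K abelA))%g by move/mker.
  rewrite gen_subG; apply/subsetP=> _ /imset2P[x y Kx Ky ->].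
  apply/kerP; first by rewrite groupR.
  by rewrite morphR //; apply/eqP/commgP; rewrite /commute; apply: (addrC (finmodule.transfer K abelA x)).
have sumX := finmodule.sum_index_rcosets_cycle sPK Kg trX.
have XG x : x \in X -> x \in K by apply: (subsetP (transversal_sub trX)).
(* The transfer of [g] vanishes on the derived group. Its cycle expansion is a product of values of
   [delta] at conjugates of powers of [g], which by stability are values at the powers themselves;
   the exponents add up to the index. *)
have dX : delta g ^+ #|K : P|%g = 1.
  rewrite -f0 -T0 E -sumX -prodrXr (big_morph f fM f0); apply: eq_bigr => x Xx.
  have Kx := XG x Xx; set n := #|_ : _|%g; set y := (g ^+ n ^ x^-1)%g.
  have Py : y \in P.
    have := finmodule.mulg_exp_card_rcosets P g x; rewrite -/n => /rcosetP[z Pz Dz].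
    by rewrite /y /conjg invgK mulgA Dz mulgK.
  rewrite /f /restrm /= finmodule.FiniteModule.fmodK; last exact: (mem_morphim alpha Py Py).
  rewrite cfQuoEker //.
  rewrite cfResE // -(lin_charX _ _ (subsetP sPQ g Pg)) //.
  rewrite -(stable_conj (x := (g ^+ n)%g) (g := 1) (h := x^-1)%g) ?conjg1 ?groupV ?(subsetP sKG) //.
    by rewrite groupX // (subsetP sPQ).
  exact: (subsetP sPQ).
have cop : coprime #|<[g]>%g| #|K : P|%g.
  by apply: pnat_coprime (mem_p_elt pQ (subsetP sPQ g Pg)) _; case/and3P: sylK.
have := expgK cop (cycle_id g) => <-.
by rewrite !lin_charX ?groupX ?(subsetP sPQ) // dX expr1n.
Qed.

Lemma linear_extension_exists K : K \subset G0 -> (p.-Sylow(K) (Q :&: K))%g ->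
  exists2 mu : 'CF(K), mu \is a linear_char & {in Q :&: K, mu =1 delta}.
Proof.
move=> sKG sylK; pose P := (Q :&: K)%G; have sPQ : P \subset Q := subsetIl Q K.
have sPK : P \subset K := subsetIr Q K.
have foc := stable_der1 sKG sylK.
have nsK' : (K^`(1) <| K)%g := der_normal 1 K.
apply: boolp.contrapT => no.
have zero i : '['Res[P] delta, 'Res[P] ('chi[K / K^`(1)]_i %% K^`(1))%CF] = 0.
  have lini : 'chi[K / K^`(1)]_i \is a linear_char.
    by apply: (elimT (char_abelianP _)); apply: der_abelian.
  have linm := cfMod_lin_char lini.
  apply/eqP/negPn/negP => nz; apply: no; exists ('chi_i %% K^`(1))%CF => // x Px.
  have [/irrP[a Da] /irrP[b Db]] : 'Res[P] delta \in irr P /\ 'Res[P] ('chi_i %% K^`(1))%CF \in irr P.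
    by rewrite !lin_char_irr ?cfRes_lin_char.
  rewrite Da Db cfdot_irr in nz; have eqab : a = b by apply/eqP; apply: contraNT nz => /negPf->.
  by rewrite -(cfResE _ sPK) // -(cfResE delta sPQ) // Da Db eqab.
have : '['Res[P] delta, 'Res[P] (cfReg (K / K^`(1)) %% K^`(1))%CF] != 0.
  rewrite cfdotE mulf_neq0 ?invr_eq0 ?neq0CG //.
  rewrite (big_setID (K^`(1))%g) /= [X in _ + X]big1 ?addr0 => [|x].
    rewrite (eq_bigr (fun _ => (#|(K / K^`(1))%g|%:R : algC))) => [|x].
      by rewrite sumr_const -mulrnA pnatr_eq0 muln_eq0 negb_or -!lt0n !cardG_gt0.
    case/setIP=> Px K'x; have Kx := subsetP sPK x Px.
    have dx1 : delta x = 1 by apply: foc; rewrite inE Px.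
    rewrite !cfResE // cfModE // cfRegE coset_id // eqxx dx1 mul1r.
    by rewrite rmorph_nat.
  case/setDP=> Px nK'x; have Kx := subsetP sPK x Px.
  rewrite !cfResE // cfModE // cfRegE; case: eqP => [/coset_idr xK'|_]; last by rewrite conjC0 mulr0.
  by case/negP: nK'x; apply: xK'; apply: (subsetP (normal_norm nsK')).
case/eqP; rewrite cfReg_sum !raddf_sum /= big1 // => i _.
by rewrite !linearZ /= cfdotZr zero mulr0.
Qed.

(** The Sylow subgroups met while descending to inertia groups are conjugates of [Q]; [stable_ext]
    does not depend on which conjugate is used. *)
Definition conjQ R := exists2 h, h \in G0 & R :=: (Q :^ h)%g.

Lemma stable_ext_eq K R (mu1 mu2 : 'CF(K)) : K \subset G0 -> conjQ R -> (p.-Sylow(K) (R :&: K))%g ->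
  stable_ext mu1 -> stable_ext mu2 -> mu1 = mu2.
Proof.
move=> sKG [h Gh DR] sylK [_ mu1P] [_ mu2P]; apply/cfun_inP=> x Kx.
have [g Kg Rxg] := sylow_conj_into sylK Kx; have Gg := subsetP sKG g Kg.
have Qx : (x.`_p ^ (g * h^-1))%g \in Q by rewrite conjgM -mem_conjg -DR.
have Ggh : (g * h^-1)%g \in G0 by rewrite groupM ?groupV.
by rewrite (mu1P x _ Kx Ggh Qx) (mu2P x _ Kx Ggh Qx).
Qed.

Lemma stable_ext_Res K H (mu : 'CF(K)) : H \subset K -> stable_ext mu -> stable_ext ('Res[H] mu).
Proof.
move=> sHK [linmu muP]; split=> [|x g Hx Gg Qx]; first by rewrite cfRes_lin_char.
by rewrite cfResE // (muP x g) // (subsetP sHK).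
Qed.

Lemma stable_ext_conj K K' g (mu : 'CF(K)) (mu' : 'CF(K')) : g \in G0 -> is_conj g mu mu' ->
  stable_ext mu -> stable_ext mu'.
Proof.
move=> Gg cc [linmu muP]; have [DK' Dmu'] := cc; split=> [|x' h].
  have := linmu; rewrite !qualifE /= (is_conj_1 cc) => /andP[Nmu ->].
  by rewrite andbT (is_conj_char DK' cc).
rewrite {1}DK' => /imsetP[x Kx ->] Gh; rewrite Dmu' consttJ -conjgM => Qx.
exact: muP Kx (groupM Gg Gh) Qx.
Qed.

(** After conjugating [R] to [Q], some linear character extends [delta]; a suitable power of it
    forgets the p'-parts without changing the values at p-elements. *)
Lemma stable_ext_exists K R : K \subset G0 -> conjQ R -> (p.-Sylow(K) (R :&: K))%g ->
  exists mu : 'CF(K), stable_ext mu.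
Proof.
move=> sKG [h Gh DR] sylK.
wlog: K R h sKG Gh DR sylK / h = 1%g => [IH|h1].
  pose K' := (K :^ h^-1)%G.
  have [] := IH K' Q 1%g.
  - by rewrite -(conjGid (groupVr Gh)) conjSg.
  - exact: group1.
  - by rewrite conjsg1.
  - have -> : (Q :&: K' = (R :&: K) :^ h^-1)%g by rewrite conjIg DR conjsgK.
    by rewrite pHallJ2.
  - by [].
  move=> mu' ext'; have DK : K :=: (K' :^ h)%g by rewrite /= conjsgKV.
  have [mu cc] := is_conj_exists_to mu' DK; exists mu; exact: stable_ext_conj Gh cc ext'.
rewrite h1 conjsg1 in DR; rewrite DR in sylK.
have [lam linl lamP] := linear_extension_exists sKG sylK.
(* Congruent to 1 modulo the p-part and to 0 modulo the p'-part of the order, so that the m-th power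
   of [x] is its p-part. *)
pose m := chinese (#|K|`_p) (#|K|`_p^') 1 0.
have cop : coprime (#|K|`_p) (#|K|`_p^') by apply: coprime_partC.
exists (lam ^+ m); split=> [|x g Kx Gg Qx]; first exact: lin_char_exp.
have lamX y : y \in K -> (lam ^+ m) y = lam (y ^+ m)%g.
  by move=> Ky; rewrite exp_cfunE // lin_charX.
have [Kp Kp'] : (x.`_p)%g \in K /\ (x.`_p^')%g \in K by rewrite !groupX.
have ord_dvd (pi : nat_pred) : (#[(x.`_pi)%g]%g %| #|K|`_pi)%N.
  by rewrite order_constt partn_dvd ?order_dvdG.
have -> : (lam ^+ m) x = lam (x.`_p)%g.
  rewrite lamX // -{1}(consttC p x) expgMn; last by apply: commuteX2; apply: commute_refl.
  have -> : ((x.`_p^') ^+ m = 1)%g.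
    apply/eqP; rewrite -(expg0 (x.`_p^')%g) eq_expg_mod_order.
    by rewrite -(modn_dvdm _ (ord_dvd _)) chinese_modr // modn_dvdm.
  rewrite mulg1; congr (lam _); apply/eqP; rewrite -[X in _ == X](expg1 (x.`_p)%g) eq_expg_mod_order.
  by rewrite -(modn_dvdm _ (ord_dvd _)) chinese_modl // modn_dvdm.
have [k Kk Qxk] := sylow_conj_into sylK Kx; have Gk := subsetP sKG k Kk.
rewrite -(stable_conj Gk Gg Qxk Qx) -lamP; last by rewrite inE Qxk groupJ.
by rewrite cfunJ.
Qed.

Lemma stable_ext_pRegular K (mu : 'CF(K)) x : K \subset G0 -> stable_ext mu -> x \in K ->
  (p^'.-elt x)%g -> mu x = 1.
Proof.
move=> sKG [_ muP] Kx p'x; have x1 : (x.`_p = 1)%g by apply/constt1P.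
by rewrite (muP x 1%g) // x1 conj1g ?lin_char1.
Qed.

Lemma stable_ext_order K R (mu : 'CF(K)) : K \subset G0 -> conjQ R -> (p.-Sylow(K) (R :&: K))%g ->
  stable_ext mu -> p.-nat #[mu]%CF.
Proof.
move=> sKG [h Gh DR] sylK [linmu muP]; apply: (cforder_dvd_pnat (k := #|Q|)) => //.
apply/cfun_inP=> x Kx; rewrite exp_cfunE // cfun1E Kx.
have [g Kg Rxg] := sylow_conj_into sylK Kx; have Gg := subsetP sKG g Kg.
have Qx : (x.`_p ^ (g * h^-1))%g \in Q by rewrite conjgM -mem_conjg -DR.
have Ggh : (g * h^-1)%g \in G0 by rewrite groupM ?groupV.
rewrite (muP x _ Kx Ggh Qx) -lin_charX //.
have -> : ((x.`_p ^ (g * h^-1)) ^+ #|Q| = 1)%g by apply/eqP; rewrite -order_dvdn order_dvdG.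
by rewrite lin_char1.
Qed.

Lemma stable_ext_special K R (mu : 'CF(K)) : K \subset G0 -> conjQ R -> (p.-Sylow(K) (R :&: K))%g ->
  stable_ext mu -> pi_special (p^')^' mu.
Proof.
move=> sKG cQ sylK ext; have [linmu _] := ext; apply: special_lin => //.
by rewrite (pnatNK p); apply: stable_ext_order sKG cQ sylK ext.
Qed.

Lemma stable_ext_inertia K R (mu : 'CF(K)) g : K \subset G0 -> conjQ R -> (p.-Sylow(K) (R :&: K))%g ->
  stable_ext mu -> g \in G0 -> g \in ('N(K))%g -> (mu ^ g)%CF = mu.
Proof.
move=> sKG cQ sylK ext Gg nKg; apply: (stable_ext_eq sKG cQ sylK _ ext).
exact: stable_ext_conj Gg (is_conj_cfConjg _ nKg) ext.
Qed.

Lemma stable_extE (mu : 'CF(Q)) : stable_ext mu -> mu = delta.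
Proof.
case=> _ muP; apply/cfun_inP=> x Qx.
by rewrite (muP x 1%g) ?group1 // constt_p_elt ?conjg1 // (mem_p_elt pQ).
Qed.

(** A linear character of p-power order is trivial on p-regular elements, so its values are those at
    p-parts, which are conjugate into [Q]. *)
Lemma stable_extP W (beta : 'CF(W)) : W \subset G0 -> (p.-Sylow(W) Q)%g ->
  beta \is a linear_char -> p.-nat #[beta]%CF -> 'Res[Q] beta = delta -> stable_ext beta.
Proof.
move=> sWG sylQ linb ordb Db; split=> // x g Wx Gg Qx; have sQW := pHall_sub sylQ.
have sylQ' : (p.-Sylow(W) (Q :&: W))%g by rewrite (setIidPl sQW).
have [k Wk Qxk] := sylow_conj_into sylQ' Wx.
have Gk := subsetP sWG k Wk; have Wxp : (x.`_p)%g \in W by rewrite groupX.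
rewrite -(stable_conj Gk Gg Qxk Qx) -Db cfResE // cfunJ //.
rewrite -{1}(consttC p x) lin_charM ?groupX //.
suff -> : beta (x.`_p^')%g = 1 by rewrite mulr1.
suff p'1 y : y \in W -> (p^'.-elt y)%g -> beta y = 1 by apply: p'1; rewrite ?groupX ?p_elt_constt.
move=> Wy p'y; have cop : coprime #|<[y]>%g| #[beta]%CF.
  by rewrite coprime_sym; apply: pnat_coprime ordb p'y.
have by1 : beta y ^+ #[beta]%CF = 1 by rewrite -exp_cfunE // exp_cforder cfun1E Wy.
have := expgK cop (cycle_id y) => <-.
by rewrite !lin_charX ?groupX // by1 expr1n.
Qed.
End Stable.

(** * Normal nuclei *)

Section NucleusConjugation.
Variables (gT : finGroupType) (pi : nat_pred).
Implicit Types (G H K N W M : {group gT}).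

Lemma is_conj_Ind g G G' K K' (psi : 'CF(K)) (psi' : 'CF(K')) : K \subset G -> G' :=: (G :^ g)%g ->
  is_conj g psi psi' -> is_conj g ('Ind[G] psi) ('Ind[G'] psi').
Proof.
move=> sKG DG' [DK' Dpsi']; split=> // x.
have sKG' : K' \subset G' by rewrite DG' DK' conjSg.
have oK : #|K'| = #|K| by rewrite DK' cardJg.
rewrite !cfIndE // oK; congr (_ * _).
rewrite [LHS](reindex_inj (conjg_inj g)) /=.
apply: eq_big => [y|y _]; first by rewrite DG' memJ_conjg.
by rewrite -conjJg Dpsi'.
Qed.

Lemma is_conj_mul g G G' (chi psi : 'CF(G)) (chi' psi' : 'CF(G')) :
  is_conj g chi chi' -> is_conj g psi psi' -> is_conj g (chi * psi) (chi' * psi').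
Proof. by move=> [DG' E1] [_ E2]; split=> // x; rewrite !cfunE E1 E2. Qed.

Lemma inertia_is_conj N (theta : 'CF(N)) x : (x \in 'I[theta])%g <-> is_conj x theta theta.
Proof.
rewrite inE; split=> [/andP[nNx /eqP E]|[DN E]].
  by have := is_conj_cfConjg theta nNx; rewrite E.
have nNx : (x \in 'N(N))%g by apply/normP.
by rewrite nNx; apply/eqP; apply: is_conj_unique (is_conj_cfConjg theta nNx) _.
Qed.

Lemma is_conj_Inertia g G G' N N' (theta : 'CF(N)) (theta' : 'CF(N')) : G' :=: (G :^ g)%g ->
  is_conj g theta theta' -> ('I_G'[theta'])%g = ('I_G[theta] :^ g)%g.
Proof.
move=> DG' cc; apply/setP=> x; rewrite mem_conjg !in_setI DG' mem_conjg; congr (_ && _).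
have E : (x = g^-1 * ((x ^ g^-1) * g))%g by rewrite conjgE invgK -!mulgA mulKg mulVg mulg1.
have E' : (x ^ g^-1 = g * (x * g^-1))%g by rewrite conjgE invgK.
apply/idP/idP => /inertia_is_conj c; apply/inertia_is_conj.
  by rewrite E'; apply: is_conj_trans cc (is_conj_trans c (is_conj_sym cc)).
by rewrite E; apply: is_conj_trans (is_conj_sym cc) (is_conj_trans c cc).
Qed.

Lemma is_conj_factor g G G' (chi beta : 'CF(G)) (chi' : 'CF(G')) : is_conj g chi chi' ->
  pi_factor pi chi beta -> exists2 beta', pi_factor pi chi' beta' & is_conj g beta beta'.
Proof.
move=> cc [alpha [spa spb E]]; have [DG' _] := cc.
have [alpha' ca] := is_conj_exists_to alpha DG'; have [beta' cb] := is_conj_exists_to beta DG'.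
exists beta' => //; exists alpha'; split; [exact: is_conj_special ca spa | exact: is_conj_special cb spb|].
by apply: is_conj_unique cc _; rewrite E; apply: is_conj_mul.
Qed.

Lemma is_conj_factored g G G' (chi : 'CF(G)) (chi' : 'CF(G')) : is_conj g chi chi' ->
  pi_factored pi chi -> pi_factored pi chi'.
Proof.
move=> cc [irr_chi [beta f]]; split; first exact: (is_conj_irr (proj1 cc) cc irr_chi).
by have [beta' f' _] := is_conj_factor cc f; exists beta'.
Qed.

Lemma is_conj_constt_factored g G G' N N' (chi : 'CF(G)) (chi' : 'CF(G')) : is_conj g chi chi' ->
  N \subset G -> N' :=: (N :^ g)%g -> constt_factored pi N chi -> constt_factored pi N' chi'.
Proof.
move=> cc sNG DN' fac i' ci'.
have [i ci ccI] := is_conj_irr_constt (is_conj_Res (proj1 cc) DN' sNG cc) ci'.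
exact: is_conj_factored ccI (fac i ci).
Qed.

Lemma nucleus_conj g G (chi : 'CF(G)) W (gamma : 'CF(W)) : normal_nucleus pi chi gamma ->
  forall G' (chi' : 'CF(G')), is_conj g chi chi' ->
  exists W' (gamma' : 'CF(W')), normal_nucleus pi chi' gamma' /\ is_conj g gamma gamma'.
Proof.
elim=> [{}G {}chi fac|{W gamma}{}G N {}chi t psi W gamma irr_chi nfac nsNG facN maxN ct irr_psi dotpsi Ind_psi nuc IH] G' chi' cc.
  exists G', chi'; split=> //; apply: NNucleus_factored; exact: is_conj_factored cc fac.
have DG' := proj1 cc; have sNG := normal_sub nsNG.
have DG : G :=: (G' :^ g^-1)%g by rewrite DG' conjsgK.
pose N' := (N :^ g)%G; have DN' : N' :=: (N :^ g)%g by [].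
have [theta' ctheta] := is_conj_exists_to 'chi_t DN'.
have /irrP[t' Dt'] := is_conj_irr DN' ctheta (mem_irr t); rewrite Dt' in ctheta.
have DT' : ('I_G'['chi_t'])%G :=: (('I_G['chi_t])%G :^ g)%g by apply: is_conj_Inertia ctheta.
have sTG : ('I_G['chi_t])%G \subset G := subsetIl _ _.
have [psi' cpsi] := is_conj_exists_to psi DT'.
have [W' [gamma' [nuc' cgamma]]] := IH _ _ cpsi.
exists W', gamma'; split=> //.
have cR : is_conj g ('Res[N] psi) ('Res[N'] psi').
  by apply: (is_conj_Res DT' DN' _ cpsi); apply: sub_Inertia.
apply: (NNucleus_step (t := t') (psi := psi') (N := N')) => //.
- exact (is_conj_irr DG' cc irr_chi).
- by move=> fac'; apply: nfac; apply: is_conj_factored (is_conj_sym cc) fac'.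
- by rewrite /N' DG' normalJ.
- exact: is_conj_constt_factored cc sNG DN' facN.
- move=> M nsM facM; have sMG' := normal_sub nsM.
  rewrite -[gval M](conjsgKV g) conjSg; apply: (maxN (M :^ g^-1)%G).
    by rewrite /= DG normalJ.
  exact: (is_conj_constt_factored (is_conj_sym cc) sMG').
- by rewrite irr_consttE (is_conj_dot (is_conj_Res (proj1 cc) DN' sNG cc) ctheta) -irr_consttE.
- exact (is_conj_irr DT' cpsi irr_psi).
- by rewrite (is_conj_dot cR ctheta).
by apply: is_conj_unique cc; rewrite -Ind_psi; apply: is_conj_Ind.
Qed.

(** In the factored case [gamma] equals [chi], but their types depend on different groups; conjugacy
    under 1 expresses the equality without a cast. *)
Lemma nucleus_inv G (chi : 'CF(G)) W (gamma : 'CF(W)) : normal_nucleus pi chi gamma ->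
  (pi_factored pi chi /\ is_conj 1 chi gamma) \/
  exists N (t : Iirr N) (psi : 'CF(('I_G['chi_t])%G)),
   [/\ [/\ chi \in irr G, ~ pi_factored pi chi, (N <| G)%g & constt_factored pi N chi],
      forall M, (M <| G)%g -> constt_factored pi M chi -> (M \subset N)%g,
      t \in irr_constt ('Res[N] chi),
      [/\ psi \in irr ('I_G['chi_t])%G, '['Res[N] psi, 'chi_t] != 0 & 'Ind[G] psi = chi]
    & normal_nucleus pi psi gamma].
Proof.
case=> [{}G {}chi fac|{W gamma}{}G N {}chi t psi W gamma irr_chi nfac nsNG facN maxN ct irr_psi dotpsi Ind_psi nuc].
  by left; split=> //; apply: is_conj_id.
by right; exists N, t, psi; split.
Qed.

Lemma nucleus_sub G (chi : 'CF(G)) W (gamma : 'CF(W)) : normal_nucleus pi chi gamma -> W \subset G.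
Proof.
elim=> // {}G N {}chi t psi {}W {}gamma _ _ _ _ _ _ _ _ _ _ sWT; exact: subset_trans sWT (subsetIl _ _).
Qed.

Lemma nucleus_irr G (chi : 'CF(G)) W (gamma : 'CF(W)) : normal_nucleus pi chi gamma ->
  chi \in irr G /\ pi_factored pi gamma.
Proof.
elim=> [{}G {}chi fac|{}G N {}chi t psi {}W {}gamma irr_chi _ _ _ _ _ _ _ _ _ [_ fac]] //.
by split=> //; case: fac.
Qed.
End NucleusConjugation.

(** * Special characters and Sylow subgroups over p-quotients *)

Section PQuotients.
Variables (gT : finGroupType) (p : nat).
Hypothesis p_pr : prime p.
Implicit Types (G E H K L N M R : {group gT}).
Local Notation special := (pi_special p^').

Lemma special_extend_uniq G N (chi psi : 'CF(G)) : p_solvable p G -> (N <| G)%g -> (p.-group (G / N))%g ->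
  special chi -> special psi -> 'Res[N] chi = 'Res[N] psi -> chi = psi.
Proof.
move=> psG nsNG pGN sp1 sp2 eqN; have [H hallH] := p_solvable_p'_Hall psG; have [sHG p'H _] := and3P hallH.
have sHN : H \subset N.
  by apply/subsetP=> h Hh; apply: (pi'_elt_quotient nsNG pGN) (mem_p_elt p'H Hh); apply: (subsetP sHG).
have [_ inj] := special_Hall p_pr psG hallH; apply: inj => //.
by rewrite -!(cfResRes _ sHN (normal_sub nsNG)) eqN.
Qed.

(** Extension proceeds through steps of index p; the extension to an intermediate group stays
    invariant because special extensions over a p-quotient are unique. *)
Lemma special_extend_pgroup G N (t : Iirr N) : p_solvable p G -> (N <| G)%g -> (p.-group (G / N))%g ->
    special 'chi_t -> (G \subset 'I['chi_t])%g ->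
  exists c : Iirr G, special 'chi_c /\ 'Res[N] 'chi_c = 'chi_t.
Proof.
have [n] := ubnP #|G|; elim: n G => // n IHn G /ltnSE-le_n psG nsNG pGN spt inv.
have [sNG nNG] := andP nsNG.
have [eqNG | neNG] := eqVneq N G.
  by rewrite -eqNG; exists t; rewrite cfRes_id.
have [L [nsLG sNL idxL]] : exists L, [/\ (L <| G)%g, N \subset L & #|G : L|%g = p].
  have ntGN : (G / N)%G :!=: 1%g.
    by rewrite -cardG_gt1 card_quotient // indexg_gt1; apply: contra neNG => sGN; apply/eqP/group_inj/eqP; rewrite eqEsubset sNG.
  have [eq1|[M maxM _]] := @maximal_exists _ 1%G (G / N)%G (sub1G _); first by case/eqP: ntGN; rewrite -eq1.
  have nsM := p_maximal_normal pGN maxM.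
  exists (coset N @*^-1 M)%G; split; first by rewrite -(quotientGK nsNG) cosetpre_normal.
    exact: sub_cosetpre.
  by rewrite -{1}(quotientGK nsNG) -(p_maximal_index pGN maxM) index_cosetpre ?(normal_sub nsM).
have sLG := normal_sub nsLG; have psL := p_solvable_sub psG sLG.
have nsNL : (N <| L)%g := normalS sNL sLG nsNG.
have pLN : (p.-group (L / N))%g := pgroupS (quotientS N sLG) pGN.
have ltL : (#|L| < n)%N.
  apply: leq_trans le_n; rewrite proper_card // properEneq sLG andbT.
  by apply/eqP=> E; move: (prime_gt1 p_pr); rewrite -idxL E indexgg.
have [c [spc Rc]] := IHn L ltL psL nsNL pLN spt (subset_trans sLG inv).
have invc : (G \subset 'I['chi_c])%g.
  apply/subsetP=> g Gg; have nLg := subsetP (normal_norm nsLG) g Gg.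
  rewrite inE nLg; apply/eqP.
  apply: (special_extend_uniq psL nsNL pLN _ spc).
    exact: is_conj_special (is_conj_cfConjg _ nLg) spc.
  rewrite -cfConjgRes_norm ?(subsetP nNG) // Rc.
  exact: inertiaJ (subsetP inv g Gg).
have [c' [spc' Rc']] := special_extend p_pr nsLG idxL spc invc.
by exists c'; split=> //; rewrite -(cfResRes _ sNL sLG) Rc'.
Qed.

Lemma p_quotient_special pi G N (i : Iirr G) : (N <| G)%g -> (pi.-group (G / N))%g ->
  N \subset cfker 'chi_i -> pi_special pi 'chi_i.
Proof.
move=> nsNG pGN kerN; have [sNG nNG] := andP nsNG; split; first exact: mem_irr.
  pose y := quo_Iirr N i; have Dy : 'chi_y = ('chi_i / N)%CF by rewrite quo_IirrE.
  have /natrP[m Dm] := Cnat_irr1 y; exists m; split.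
    by apply: pnat_dvd pGN; rewrite -dvdC_nat; have := dvd_irr1_cardG y; rewrite Dm.
  by rewrite -Dm Dy cfQuo1.
move=> S snSG j cj; have sSG := subnormal_sub snSG.
have nsI : (N :&: S <| S)%g by rewrite setIC; apply: normalGI sSG nsNG.
have kerj : N :&: S \subset cfker 'chi_j.
  apply: subset_trans (cfker_constt _ cj); last by rewrite cfRes_char ?irr_char.
  by rewrite cfker_Res ?irr_char // setIC setIS.
apply: (@cforder_dvd_pnat _ _ _ _ #|S : N :&: S|%g).
  apply: lin_char_index_exp nsI (cfDet_lin_char _) _.
  rewrite -cfDetRes ?irr_char // cfRes_sub_ker //.
  have /natrP[m ->] := Cnat_irr1 j.
  by rewrite scaler_nat cfDetMn ?rpred1 // cfDet_id ?rpred1 ?expr1n // cfun1_lin_char.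
by rewrite setIC; apply: pnat_dvd (index_setI_dvd nsNG sSG) _; rewrite -card_quotient.
Qed.

Lemma sylow_setI_normal K N R : (K <| N)%g -> (p.-Sylow(N) (R :&: N))%g -> (p.-Sylow(K) (R :&: K))%g.
Proof.
move=> nsKN syl; have := pHall_setI_normal nsKN syl.
by rewrite setIC -setIA (setIidPr (normal_sub nsKN)).
Qed.

(** An order count: the product of [R :&: M] and [R :&: N] already has as many elements as a Sylow
    p-subgroup of the join. *)
Lemma sylow_join G M N R : (M <| G)%g -> (N <| G)%g -> (p.-group R)%g ->
  (p.-Sylow(M) (R :&: M))%g -> (p.-Sylow(N) (R :&: N))%g -> (p.-Sylow(M <*> N) (R :&: (M <*> N)))%g.
Proof.
move=> nsMG nsNG pR sylM sylN.
have nMN : (N \subset 'N(M))%g := subset_trans (normal_sub nsNG) (normal_norm nsMG).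
have nsI : (M :&: N <| M)%g by apply: normalGI (normal_sub nsMG) nsNG.
have sylI := sylow_setI_normal nsI sylM.
have pK : (p.-group (R :&: (M <*> N)))%g := pgroupS (subsetIl _ _) pR.
rewrite pHallE subsetIr /= eqn_leq; apply/andP; split.
  apply: dvdn_leq; first exact: part_gt0.
  by rewrite -(part_pnat_id pK) partn_dvd ?cardG_gt0 // cardSg ?subsetIr.
have oM : #|R :&: M| = (#|M|`_p)%N by move: sylM; rewrite pHallE => /andP[_ /eqP].
have oN : #|R :&: N| = (#|N|`_p)%N by move: sylN; rewrite pHallE => /andP[_ /eqP].
have oI : #|R :&: (M :&: N)| = (#|M :&: N|`_p)%N by move: sylI; rewrite pHallE => /andP[_ /eqP].
rewrite -(leq_pmul2r (cardG_gt0 (R :&: (M :&: N)))) {1}oI.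
have sub : ((R :&: M) * (R :&: N) \subset R :&: (M <*> N))%g.
  by apply: mul_subG; rewrite setIS ?joing_subl ?joing_subr.
have -> : (#|(M <*> N)%g|`_p * #|M :&: N|`_p = #|M|`_p * #|N|`_p)%N.
  by rewrite -!partnM ?cardG_gt0 // norm_joinEr // -mul_cardG.
rewrite -oM -oN mul_cardG; apply: leq_mul; first exact: subset_leq_card.
by rewrite setIACA setIid.
Qed.

Lemma sylow_p_quotient E N R : (N <| E)%g -> (p.-group (E / N))%g -> (p.-Sylow(E) (R :&: E))%g ->
  (E \subset N * R)%g.
Proof.
move=> nsNE pEN syl; have nN := normal_norm nsNE.
have nR : (R :&: E \subset 'N(N))%g := subset_trans (subsetIr R E) nN.
have := pHall_id (quotient_pHall nR syl) pEN => E1.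
have : (E / N \subset (R :&: E) / N)%g by rewrite E1.
by rewrite quotientSK // => /subset_trans; apply; rewrite mulgS ?subsetIl.
Qed.
End PQuotients.

Section LinearTwist.
Variable gT : finGroupType.
Implicit Types (G N E : {group gT}).

Lemma constt_mul_lin G (lambda chi : 'CF(G)) i j : lambda \is a linear_char -> chi \is a character ->
  i \in irr_constt chi -> 'chi_j = lambda * 'chi_i -> j \in irr_constt (lambda * chi).
Proof.
move=> linl Nchi /(constt_charP i Nchi)[rest Nrest ->] Dj.
have Nl := lin_charW linl; apply/constt_charP; first by rewrite rpredM ?rpredD ?irr_char.
by exists (lambda * rest); rewrite ?rpredM // mulrDr Dj.
Qed.

Lemma inertia_conjg G N E (theta : 'CF(N)) g : (N <| G)%g -> (E <| G)%g -> (E \subset 'I[theta])%g ->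
  g \in G -> (E \subset 'I[theta ^ g])%g.
Proof.
move=> nsNG nsEG sEI Gg; apply/subsetP=> x Ex.
have nNg : (g \in 'N(N))%g := subsetP (normal_norm nsNG) g Gg.
have Exg : (x ^ g^-1)%g \in E by rewrite memJ_norm // groupV (subsetP (normal_norm nsEG)).
have cg := is_conj_cfConjg theta nNg.
have cx : is_conj (x ^ g^-1)%g theta theta by apply/inertia_is_conj; apply: (subsetP sEI).
apply/inertia_is_conj; have -> : (x = g^-1 * ((x ^ g^-1) * g))%g by rewrite conjgE invgK -!mulgA mulKg mulVg mulg1.
exact: is_conj_trans (is_conj_sym cg) (is_conj_trans cx cg).
Qed.

Lemma inertia_mul_lin N (alpha mu : 'CF(N)) x : mu \is a linear_char -> (x \in 'I[mu])%g ->
  (x \in 'I[(alpha * mu)%R])%g = (x \in 'I[alpha])%g.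
Proof.
move=> linmu; rewrite !inE => /andP[-> /eqP E] /=.
rewrite rmorphM /= E; apply/eqP/eqP=> [|-> //].
by apply: mulIr; apply: lin_char_unitr.
Qed.
End LinearTwist.

(** * Characters with a stable Navarro vertex and their reductions *)

Section NavarroVertices.
Variables (F : closedFieldType) (p : nat) (lam : F -> algC).
Hypothesis setup : brauer_setup p lam.
Let p_pr : prime p. Proof. by case: setup. Qed.
Let pF : p \in [pchar F]. Proof. by case: setup. Qed.
Variables (gT : finGroupType) (G0 Q : {group gT}) (delta : 'CF(Q)).
Hypotheses (pQ : (p.-group Q)%g) (psG0 : p_solvable p G0).
Hypothesis lin_delta : delta \is a linear_char.
Hypothesis stable : forall x y, x \in Q -> y \in Q -> (y \in x ^: G0)%g -> delta x = delta y.
Implicit Types (D E G H K L M N T W R : {group gT}).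
Local Notation special := (pi_special p^').
Local Notation stab := (stable_ext p G0 delta).
Local Notation conjQ := (conjQ G0 Q).
Local Notation reduces := (reduces p lam).
Local Notation sylow_in R K := (p.-Sylow(K) (R :&: K))%g.

(** The shape of the nucleus characters in question and of their normal constituents. The p-special
    factor is the stable extension, so it is determined by [N] as soon as a conjugate of [Q] meets
    [N] in a Sylow subgroup. *)
Definition stable_factored N (theta : 'CF(N)) :=
  exists (a : Iirr N) (mu : 'CF(N)), [/\ special 'chi_a, stab mu & theta = 'chi_a * mu].

Lemma conjQ_pgroup R : conjQ R -> (p.-group R)%g.
Proof. by case=> h _ DR; rewrite DR pgroupJ. Qed.

Lemma stable_factored_below N K (theta : 'CF(N)) k : N \subset G0 -> (K <| N)%g -> stable_factored theta ->
  k \in irr_constt ('Res[K] theta) -> stable_factored 'chi_k.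
Proof.
move=> sNG nsKN [a [mu [spa ext ->]]]; rewrite rmorphM /= => ck.
have extK := stable_ext_Res (normal_sub nsKN) ext; have [linK _] := extK.
have unitK := lin_char_unitr linK.
have linV : ('Res[K] mu)^-1 \is a linear_char by rewrite rpredV.
have /irrP[j Dj] : ('Res[K] mu)^-1 * 'chi_k \in irr K by rewrite mul_lin_irr ?mem_irr.
have cj : j \in irr_constt ('Res[K] 'chi_a).
  have := constt_mul_lin linV _ ck (esym Dj); rewrite mulrCA mulVr // mulr1; apply.
  by rewrite rpredM ?(lin_charW linK) // cfRes_char ?irr_char.
exists j, ('Res[K] mu); split=> //; first exact: special_Res nsKN spa cj.
by rewrite -Dj mulrAC mulVr ?mul1r.
Qed.

Lemma stable_factored_conj g N N' (theta : 'CF(N)) (theta' : 'CF(N')) : g \in G0 ->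
  is_conj g theta theta' -> stable_factored theta -> stable_factored theta'.
Proof.
move=> Gg cc [a [mu [spa ext E]]]; have DN' := proj1 cc.
have [alpha ca] := is_conj_exists_to 'chi_a DN'; have [mu' cm] := is_conj_exists_to mu DN'.
have /irrP[b Db] := is_conj_irr DN' ca (mem_irr a); rewrite Db in ca.
exists b, mu'; split; [exact: is_conj_special ca spa | exact: stable_ext_conj Gg cm ext|].
by apply: is_conj_unique cc _; rewrite E; apply: is_conj_mul.
Qed.

Lemma stable_factored_reduces N (a : Iirr N) (mu : 'CF(N)) n (s : mx_representation F N n) : N \subset G0 ->
  stab mu -> reduces 'chi_a s -> reduces ('chi_a * mu) s.
Proof.
move=> sNG ext red x Nx p'x; rewrite red // cfunE.
by rewrite (stable_ext_pRegular lin_delta sNG ext) ?mulr1.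
Qed.

(** If [K] were not inside [N], the stable extension would exist on a chief layer [E] above [N]
    inside the join, and all constituents of [chi] on [E] would be factored, against the maximality
    of [N]. *)
Lemma stable_normal_max G N R (chi : 'CF(G)) (t : Iirr N) : G \subset G0 -> (N <| G)%g -> conjQ R ->
    R \subset G -> chi \in irr G -> sylow_in R N ->
    (forall M, (M <| G)%g -> constt_factored p^' M chi -> (M \subset N)%g) ->
    t \in irr_constt ('Res[N] chi) -> stable_factored 'chi_t -> (R \subset 'I['chi_t])%g ->
  forall K, (K <| G)%g -> sylow_in R K -> K \subset N.
Proof.
move=> sGG0 nsNG cR sRG /irrP[i ->] sylN maxN ct facN sRI K nsKG sylK; apply/negPn/negP=> nsKN.
have psG := p_solvable_sub psG0 sGG0; have [sNG nNG] := andP nsNG.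
have sNG0 := subset_trans sNG sGG0.
pose L := (K <*> N)%G; have nsLG : (L <| G)%g by apply: normalY.
have prNL : N \proper L.
  by rewrite properE joing_subr; apply: contra nsKN => /(subset_trans (joing_subl K N)).
have sylL : sylow_in R L by apply: sylow_join nsKG nsNG (conjQ_pgroup cR) sylK sylN.
have [E [nsEG prNE sEL idx]] := chief_layer psG nsNG nsLG prNL.
have sEG := normal_sub nsEG; have psE := p_solvable_sub psG sEG; have sEG0 := subset_trans sEG sGG0.
have sNE := proper_sub prNE; have nsNE : (N <| E)%g := normalS sNE sEG nsNG.
have sylE : sylow_in R E := sylow_setI_normal (normalS sEL (normal_sub nsLG) nsEG) sylL.
have [muE extE] := stable_ext_exists pQ lin_delta stable sEG0 cR sylE.
have [linE _] := extE; have unitE := lin_char_unitr linE.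
suff facE : constt_factored p^' E 'chi_i.
  by move: prNE; rewrite properE (maxN E nsEG facE) andbF.
move=> k ck; split; first exact: mem_irr.
have [u cu] := constt_cfRes_irr N k.
have cui := constt_Res_below sNE sEG (irr_char i) ck cu.
have [g Gg Du] := constt_Res_conj nsNG ct cui.
have nNg := subsetP nNG g Gg.
have [v [mu [spv extN Dv]]] : stable_factored 'chi_u.
  by rewrite Du; exact: (stable_factored_conj (subsetP sGG0 g Gg) (is_conj_cfConjg _ nNg) facN).
have RmuE : 'Res[N] muE = mu.
  exact: (stable_ext_eq sNG0 cR sylN (stable_ext_Res sNE extE) extN).
have [linN _] := extN; have unitN := lin_char_unitr linN.
have spE := stable_ext_special pQ lin_delta sEG0 cR sylE extE.
case/orP: idx => [pEN|p'EN]; last first.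
  have linV : muE^-1 \is a linear_char by rewrite rpredV.
  have /irrP[j Dj] : muE^-1 * 'chi_k \in irr E by rewrite mul_lin_irr ?mem_irr.
  exists muE, 'chi_j; split=> //; last by rewrite -Dj mulrAC mulVr ?mul1r.
  have cv : v \in irr_constt ('Res[N] 'chi_j).
    rewrite -Dj rmorphM /= rmorphV //= RmuE; apply: constt_mul_lin cu _; rewrite ?rpredV ?cfRes_char ?irr_char //.
    by rewrite Dv mulrCA mulVr ?mulr1.
  by apply: (special_p'_over p_pr psE nsNE _ spv cv); rewrite -card_quotient ?normal_norm.
(* For a p-layer the Sylow condition puts [E] inside [N R], and [R] fixes [chi_t]; this passes to
   the conjugate [chi_u] and, after removing the invariant linear factor, to [chi_v]. *)
have invE : (E \subset 'I['chi_v])%g.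
  have sEI : (E \subset 'I['chi_t])%g.
    apply: subset_trans (sylow_p_quotient nsNE pEN sylE) _.
    by rewrite mul_subG ?sub_inertia.
  apply/subsetP=> x Ex; have nNx := subsetP (normal_norm nsNE) x Ex.
  have Ixmu : (x \in 'I[mu])%g.
    rewrite inE nNx; apply/eqP.
    exact: (stable_ext_inertia sNG0 cR sylN extN (subsetP sEG0 x Ex)).
  rewrite -(inertia_mul_lin _ linN Ixmu) -Dv Du.
  by apply: (subsetP (inertia_conjg nsNG nsEG sEI Gg)).
have [c [spc Rc]] := special_extend_pgroup p_pr psE nsNE pEN spv invE.
have /irrP[e De] : muE * 'chi_c \in irr E by rewrite mul_lin_irr ?mem_irr.
have Re : 'Res[N] 'chi_e = 'chi_u by rewrite -De rmorphM /= RmuE Rc Dv mulrC.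
(* Gallagher's theorem: the characters over [chi_u] are its extension times characters of the
   p-group [E / N], and these go into the p-special factor. *)
have [irrb _ codomE _] := constt_Ind_ext nsNE Re.
move: cu; rewrite -constt_Ind_Res codomE => /codomP[b Dk].
have Dchi : 'chi_k = 'chi_(mod_Iirr b) * 'chi_e by rewrite Dk /mul_mod_Iirr /mul_Iirr cfIirrE ?irrb.
exists (muE * 'chi_(mod_Iirr b)), 'chi_c; split=> //; last by rewrite Dchi -De mulrCA [RHS]mulrCA ['chi_c * _]mulrC.
apply: special_mul_lin => //.
  by rewrite (pnatNK p); exact: (stable_ext_order pQ lin_delta sEG0 cR sylE extE).
apply: (p_quotient_special nsNE); first by rewrite /pgroup (pnatNK p).
by rewrite mod_IirrE // cfker_mod.
Qed.

Lemma stable_inertia G N R (alpha mu : 'CF(N)) : G \subset G0 -> (N <| G)%g -> conjQ R -> sylow_in R N ->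
  stab mu -> ('I_G[(alpha * mu)%R] = 'I_G[alpha])%g.
Proof.
move=> sGG0 nsNG cR sylN ext; apply/setP=> x; rewrite !in_setI; case Gx: (x \in G) => //=.
have nNx := subsetP (normal_norm nsNG) x Gx; have sNG0 := subset_trans (normal_sub nsNG) sGG0.
apply: inertia_mul_lin (proj1 ext) _; rewrite inE nNx; apply/eqP.
exact: (stable_ext_inertia sNG0 cR sylN ext (subsetP sGG0 x Gx)).
Qed.

Lemma special_inertia G N (a : Iirr N) d (s : mx_representation F N d) (nsNG : (N <| G)%g) T :
    p_solvable p N -> special 'chi_a -> mx_irreducible s -> reduces 'chi_a s -> T :=: ('I_G['chi_a])%g ->
  forall x (Gx : x \in G), x \in T <-> mx_rsim (conj_repr s (subsetP (normal_norm nsNG) x Gx)) s.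
Proof.
move=> psN spa irr_s red DT x Gx; have nNx := subsetP (normal_norm nsNG) x Gx.
rewrite DT inE Gx /=.
have redx : reduces ('chi_a ^ x)%CF (conj_repr s (subsetP (normal_norm nsNG) x Gx)) by apply: reduces_conj red.
split=> [Ix|sim].
  rewrite (inertiaJ Ix) in redx; apply: (reduces_irr_rsim setup _ irr_s redx red); exact: conj_repr_irr.
rewrite inE nNx /=; apply/eqP.
apply: (special_reduces_inj setup psN _ spa redx red sim).
exact: is_conj_special (is_conj_cfConjg _ nNx) spa.
Qed.

Lemma Clifford_reduces G N T (sTG : T \subset G) (sNT : N \subset T) (chi : 'CF(G)) (psi : 'CF(T))
    (t : Iirr N) n m d (M : mx_representation F G n) (r : mx_representation F T m)
    (s : mx_representation F N d) : psi \in irr T -> '['Res[N] psi, 'chi_t] != 0 -> 'Ind[G] psi = chi ->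
    mx_irreducible r -> mx_irreducible s -> reduces chi M -> reduces psi r -> reduces 'chi_t s ->
  constt_repr (subg_repr M sTG) r /\ constt_repr (subg_repr r sNT) s.
Proof.
move=> /irrP[j ->] dotpsi Ind_psi irr_r irr_s redM red_r red_s; split; last first.
  apply: (reduces_constt setup (i := t) _ _ (reduces_sub sNT red_r) red_s irr_s).
    by rewrite cfRes_char ?irr_char.
  by rewrite irr_consttE.
have Nchi : chi \is a character by rewrite -Ind_psi cfInd_char ?irr_char.
apply: (reduces_constt setup (i := j) _ _ (reduces_sub sTG redM) red_r irr_r).
  by rewrite cfRes_char.
rewrite irr_consttE -Ind_psi cfdotC Frobenius_reciprocity fmorph_eq0 cfnorm_eq0.
by rewrite cfInd_eq0 ?irr_char // irr_neq0.
Qed.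

Lemma Clifford_Ind_reduces G N T (nsNG : (N <| G)%g) (sTG : T \subset G) (sNT : N \subset T) (psi : 'CF(T))
    (t : Iirr N) m d (r : mx_representation F T m) (s : mx_representation F N d) :
    psi \in irr T -> '['Res[N] psi, 'chi_t] != 0 -> mx_irreducible r -> mx_irreducible s ->
    reduces psi r -> reduces 'chi_t s ->
    (forall x (Gx : x \in G), x \in T <-> mx_rsim (conj_repr s (subsetP (normal_norm nsNG) x Gx)) s) ->
  exists n (M : mx_representation F G n),
    [/\ mx_irreducible M, reduces ('Ind[G] psi) M & constt_repr (subg_repr M sTG) r].
Proof.
move=> irr_psi dotpsi irr_r irr_s red_r red_s iT.
have Nchi : 'Ind[G] psi \is a character by rewrite cfInd_char ?irrWchar.
have [n [R0 red0]] := reduces_exists setup Nchi.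
have rs : constt_repr (subg_repr r sNT) s.
  apply: (reduces_constt setup (i := t) _ _ (reduces_sub sNT red_r) red_s irr_s); last by rewrite irr_consttE.
  by rewrite cfRes_char ?irrWchar.
have Dn : n = (#|G : T|%g * m)%N.
  apply/eqP; rewrite -(eqr_nat algC) natrM -(reduces_deg setup red0) -(reduces_deg setup red_r).
  by rewrite cfInd1.
have [|n1 [M [irrM bvM Mr]]] := Clifford_induced sTG irr_s iT setup irr_r rs Dn (R := R0).
  have /irrP[j Dj] := irr_psi.
  have cj : j \in irr_constt ('Res[T] ('Ind[G] psi)).
    rewrite irr_consttE -Dj cfdotC Frobenius_reciprocity fmorph_eq0 cfnorm_eq0.
    by rewrite cfInd_eq0 ?irrWchar // Dj irr_neq0.
  have Nres : 'Res[T] ('Ind[G] psi) \is a character by rewrite cfRes_char.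
  have [rest Nrest Dres] := constt_charP j Nres cj.
  apply: (reduces_summand setup (psi := psi) _ (reduces_sub sTG red0) red_r).
  by rewrite Dres Dj addrC addKr.
by exists n1, M; split=> // x Gx p'x; rewrite bvM // red0.
Qed.

(** The last two hypotheses are what [nucleus_reduction] yields for [psi]. Stating them here lets
    its own induction and the later injectivity proof share the description of [N]. *)
Lemma nucleus_step_data G N R (chi : 'CF(G)) (t : Iirr N) (psi : 'CF(('I_G['chi_t])%G)) :
    G \subset G0 -> chi \in irr G -> (N <| G)%g -> constt_factored p^' N chi ->
    (forall M, (M <| G)%g -> constt_factored p^' M chi -> (M \subset N)%g) ->
    t \in irr_constt ('Res[N] chi) -> psi \in irr ('I_G['chi_t])%G -> '['Res[N] psi, 'chi_t] != 0 ->
    conjQ R -> R \subset ('I_G['chi_t])%g ->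
    (forall K, (K <| ('I_G['chi_t])%G)%g -> sylow_in R K ->
        forall k, k \in irr_constt ('Res[K] psi) -> stable_factored 'chi_k) ->
    (forall K, (K <| ('I_G['chi_t])%G)%g -> constt_factored p^' K psi -> sylow_in R K) ->
  [/\ sylow_in R N, stable_factored 'chi_t
    & forall K, (K <| G)%g -> sylow_in R K -> K \subset N].
Proof.
move=> sGG0 irr_chi nsNG facN maxN ct /irrP[j ->] dotpsi cR sRT IHb IHc.
have [sNG nNG] := andP nsNG; set T := ('I_G['chi_t])%G in j dotpsi sRT IHb IHc *.
have sTG : T \subset G := subsetIl _ _.
have sNT : N \subset T := sub_Inertia _ sNG.
have nsNT : (N <| T)%g := normalS sNT sTG nsNG.
have ctj : t \in irr_constt ('Res[N] 'chi_j) by rewrite irr_consttE.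
have sylN : sylow_in R N.
  apply: (IHc N nsNT) => u cu; have [x /setIP[_ Ix] Du] := constt_Res_conj nsNT ctj cu.
  by rewrite Du (inertiaJ Ix); apply: facN.
have sf := IHb N nsNT sylN t ctj; split=> //.
apply: (stable_normal_max sGG0 nsNG cR (subset_trans sRT sTG) irr_chi sylN maxN ct sf).
exact: subset_trans sRT (subsetIr _ _).
Qed.

(** The statements on normal subgroups [K] ride along in the induction: applied to the Clifford
    correspondent they show that [N] meets [R] in a Sylow subgroup and that [chi_t] is stably
    factored, and the comparison of inertia groups rests on both. *)
Theorem nucleus_reduction G (chi : 'CF(G)) W (gamma : 'CF(W)) : normal_nucleus p^' chi gamma ->
    G \subset G0 -> forall R, conjQ R -> (p.-Sylow(W) R)%g -> stable_factored gamma ->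
  [/\ exists n (M : mx_representation F G n), [/\ mx_irreducible M, reduces chi M & vertex_source M W],
      forall K, (K <| G)%g -> sylow_in R K ->
        forall k, k \in irr_constt ('Res[K] chi) -> stable_factored 'chi_k
    & forall K, (K <| G)%g -> constt_factored p^' K chi -> sylow_in R K].
Proof.
elim=> [{}G {}chi fac|{W gamma}{}G N {}chi t psi W gamma irr_chi nfac nsNG facN maxN ct irr_psi dotpsi Ind_psi nuc IH] sGG0 R cR sylW sf.
  have psG := p_solvable_sub psG0 sGG0; split.
  - have [a [mu [spa ext Dchi]]] := sf; have [n [M red]] := reduces_exists setup (irr_char a).
    have irrM := special_reduces_irr setup psG spa red; exists n, M; split=> //.
      by rewrite Dchi; apply: stable_factored_reduces.
    have [m p'm Dm] := special_deg spa; apply: (p'dim_vertex_source pF); apply: (p'nat_not_dvd p_pr).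
    by have /eqP := reduces_deg setup red; rewrite Dm eqr_nat => /eqP<-.
  - by move=> K nsKG sylK k ck; apply: stable_factored_below nsKG sf ck.
  by move=> K nsKG _; apply: sylow_setI_normal nsKG _; rewrite (setIidPl (pHall_sub sylW)).
have psG := p_solvable_sub psG0 sGG0; have [sNG nNG] := andP nsNG.
have sNG0 := subset_trans sNG sGG0.
have sRT := subset_trans (pHall_sub sylW) (nucleus_sub nuc).
have sTG0 : ('I_G['chi_t])%G \subset G0 := subset_trans (subsetIl _ _) sGG0.
have [IHa IHb IHc] := IH sTG0 R cR sylW sf.
have [sylN sft maxS] := nucleus_step_data sGG0 irr_chi nsNG facN maxN ct irr_psi dotpsi cR sRT IHb IHc.
split; last first.
- by move=> K nsKG facK; apply: sylow_setI_normal sylN; apply: normalS (maxN K nsKG facK) sNG nsKG.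
- move=> K nsKG sylK k ck; have sKN := maxS K nsKG sylK.
  have Nchi : chi \is a character := irrWchar irr_chi.
  have [u cu cku] := constt_Res_above sKN sNG Nchi ck.
  apply: (stable_factored_below sNG0 (normalS sKN sNG nsKG) _ cku).
  have /irrP[i Di] := irr_chi; rewrite Di in ct cu; have [g Gg ->] := constt_Res_conj nsNG ct cu.
  exact: (stable_factored_conj (subsetP sGG0 g Gg) (is_conj_cfConjg _ (subsetP nNG g Gg)) sft).
have [a [mu [spa ext Dt]]] := sft.
have [d [s red_s]] := reduces_exists setup (irr_char a).
have irr_s := special_reduces_irr setup (p_solvable_sub psG0 sNG0) spa red_s.
have red_t : reduces 'chi_t s by rewrite Dt; apply: stable_factored_reduces.
pose T := ('I_G['chi_t])%G; have sTG : T \subset G := subsetIl _ _.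
have sNT : N \subset T := sub_Inertia _ sNG.
have iT := special_inertia nsNG (T := T) (p_solvable_sub psG0 sNG0) spa irr_s red_s.
have {}iT : forall x (Gx : x \in G), x \in T <-> mx_rsim (conj_repr s (subsetP (normal_norm nsNG) x Gx)) s.
  by apply: iT; rewrite /= Dt; apply: stable_inertia cR sylN ext.
have [m [r [irr_r red_r vsW]]] := IHa.
have [n1 [M [irrM redM Mr]]] := Clifford_Ind_reduces sTG sNT irr_psi dotpsi irr_r irr_s red_r red_t iT.
rewrite Ind_psi in redM; exists n1, M; split=> //.
have [_ rs] := Clifford_reduces sTG sNT irr_psi dotpsi Ind_psi irr_r irr_s redM red_r red_t.
have Ms : constt_repr (subg_repr M (normal_sub nsNG)) s.
  move=> b; rewrite -(gring_mx_subg_trans sNT sTG) => /(constt_repr_sub (sHG := sNT) Mr); exact: rs.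
have [n2 [r2 [_ _ _ [vsM _] uniq]]] := Clifford_correspondence sTG sNT irr_s iT irrM Ms.
apply: vsM; apply: vertex_source_rsim vsW; exact: uniq.
Qed.

Lemma stable_factored_inj G R (chi1 chi2 : 'CF(G)) n1 n2 (r1 : mx_representation F G n1)
    (r2 : mx_representation F G n2) : G \subset G0 -> conjQ R -> sylow_in R G ->
    stable_factored chi1 -> stable_factored chi2 -> reduces chi1 r1 -> reduces chi2 r2 ->
  mx_rsim r1 r2 -> chi1 = chi2.
Proof.
move=> sGG0 cR syl [a1 [mu1 [sp1 ext1 ->]]] [a2 [mu2 [sp2 ext2 ->]]] red1 red2 sim.
rewrite (stable_ext_eq sGG0 cR syl ext1 ext2); congr (_ * _).
have red a mu n (r : mx_representation F G n) : stab mu -> reduces ('chi_a * mu) r -> reduces 'chi_a r.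
  move=> ext red x Gx p'x; rewrite red // cfunE (stable_ext_pRegular lin_delta sGG0 ext) ?mulr1 //.
exact: (special_reduces_inj setup (p_solvable_sub psG0 sGG0) sp1 sp2 (red _ _ _ _ ext1 red1) (red _ _ _ _ ext2 red2) sim).
Qed.

Lemma nonfactored_proper G N (chi : 'CF(G)) : chi \in irr G -> ~ pi_factored p^' chi -> (N <| G)%g ->
  constt_factored p^' N chi -> ~~ (G \subset N).
Proof.
move=> /irrP[i ->] nfac nsNG facN; apply/negP=> sGN; apply: nfac.
have eqNG : N = G by apply/group_inj/eqP; rewrite eqEsubset normal_sub.
by move: facN; rewrite eqNG; apply; rewrite cfRes_id irr_consttE cfnorm_irr oner_eq0.
Qed.

Lemma conjQ_conj R R' g : g \in G0 -> R' :=: (R :^ g)%g -> conjQ R -> conjQ R'.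
Proof. by move=> Gg DR' [h Gh DR]; exists (h * g)%g; rewrite ?groupM // DR' DR conjsgM. Qed.

(** Both characters use the same [N], characterized through [R]. Their constituents on [N] reduce to
    constituents of the same [M], hence are conjugate; after conjugation both Clifford
    correspondents reduce to the Clifford correspondent of [M]. *)
Theorem nucleus_injective G (chi1 : 'CF(G)) W1 (gamma1 : 'CF(W1)) : normal_nucleus p^' chi1 gamma1 ->
    G \subset G0 -> forall R, conjQ R -> (p.-Sylow(W1) R)%g -> stable_factored gamma1 ->
    forall (chi2 : 'CF(G)) W2 (gamma2 : 'CF(W2)), normal_nucleus p^' chi2 gamma2 ->
      (p.-Sylow(W2) R)%g -> stable_factored gamma2 ->
    forall n (M : mx_representation F G n), mx_irreducible M -> reduces chi1 M -> reduces chi2 M ->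
  chi1 = chi2.
Proof.
elim=> [{}G {}chi1 fac1|{W1 gamma1}{}G N {}chi1 t1 psi1 W1 gamma1 irr1 nfac1 nsNG facN1 maxN1 ct1 irr_psi1 dotpsi1 Ind_psi1 nuc1 IH] sGG0 R cR sylW1 sf1 chi2 W2 gamma2 nuc2 sylW2 sf2 n M irrM red1 red2.
  have sRG := pHall_sub sylW1; have sylG : sylow_in R G by rewrite (setIidPl sRG).
  (* If [chi2] were not factored, its [N2] would contain every normal subgroup met by [R] in a Sylow
     subgroup, hence [G] itself. *)
  have [[_ cc]|[N2 [t2 [psi2 [[irr2 nfac2 nsN2 facN2] maxN2 ct2 [irr_psi2 dot2 Ind2] nuc2']]]]] := nucleus_inv nuc2.
    have sf2' : stable_factored chi2.
      by apply: stable_factored_conj sf2; [exact: (groupVr (group1 G0))|exact: is_conj_sym cc].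
    exact: (stable_factored_inj sGG0 cR sylG sf1 sf2' red1 red2 (mx_rsim_refl M)).
  have sTG0 := subset_trans (subsetIl G 'I['chi_t2]%g) sGG0.
  have [_ IHb IHc] := nucleus_reduction nuc2' sTG0 cR sylW2 sf2.
  have sRT := subset_trans (pHall_sub sylW2) (nucleus_sub nuc2').
  have [_ _ maxS] := nucleus_step_data sGG0 irr2 nsN2 facN2 maxN2 ct2 irr_psi2 dot2 cR sRT IHb IHc.
  by have := nonfactored_proper irr2 nfac2 nsN2 facN2; rewrite (maxS G) ?normal_refl.
have sTG0 := subset_trans (subsetIl G 'I['chi_t1]%g) sGG0.
have [IHa1 IHb1 IHc1] := nucleus_reduction nuc1 sTG0 cR sylW1 sf1.
have sRT1 := subset_trans (pHall_sub sylW1) (nucleus_sub nuc1).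
have [sylN sft1 maxS1] := nucleus_step_data sGG0 irr1 nsNG facN1 maxN1 ct1 irr_psi1 dotpsi1 cR sRT1 IHb1 IHc1.
have [[_ cc]|[N2 [t2 [psi2 [[irr2 nfac2 nsN2 facN2] maxN2 ct2 [irr_psi2 dot2 Ind2] nuc2']]]]] := nucleus_inv nuc2.
  have DW2 : W2 :=: G by rewrite (proj1 cc) conjsg1.
  have sylG : sylow_in R G by move: sylW2; rewrite DW2 => syl; rewrite (setIidPl (pHall_sub syl)).
  by have := nonfactored_proper irr1 nfac1 nsNG facN1; rewrite (maxS1 G) ?normal_refl.
have sTG02 := subset_trans (subsetIl G 'I['chi_t2]%g) sGG0.
have [_ IHb2 IHc2] := nucleus_reduction nuc2' sTG02 cR sylW2 sf2.
have sRT2 := subset_trans (pHall_sub sylW2) (nucleus_sub nuc2').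
have [sylN2 sft2 maxS2] := nucleus_step_data sGG0 irr2 nsN2 facN2 maxN2 ct2 irr_psi2 dot2 cR sRT2 IHb2 IHc2.
have eqN : N2 = N by apply/group_inj/eqP; rewrite eqEsubset maxS1 // maxS2.
subst N2; have [sNG nNG] := andP nsNG; have sNG0 := subset_trans sNG sGG0.
have psN := p_solvable_sub psG0 sNG0.
have irr_red (t : Iirr N) : stable_factored 'chi_t ->
    exists a mu d (s : mx_representation F N d), [/\ special 'chi_a, stab mu, 'chi_t = 'chi_a * mu,
      mx_irreducible s & reduces 'chi_a s /\ reduces 'chi_t s].
  case=> [a [mu [spa ext Dt]]]; have [d [s red_s]] := reduces_exists setup (irr_char a).
  exists a, mu, d, s; split=> //; first exact: (special_reduces_irr setup psN spa red_s).
  by split=> //; rewrite Dt; apply: stable_factored_reduces.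
have [a1 [mu1 [d1 [s1 [spa1 ext1 Dt1 irr_s1 [reda1 redt1]]]]]] := irr_red t1 sft1.
have [a2 [mu2 [d2 [s2 [spa2 ext2 Dt2 irr_s2 [reda2 redt2]]]]]] := irr_red t2 sft2.
have over (chi : 'CF(G)) (t : Iirr N) d (s : mx_representation F N d) : chi \in irr G -> reduces chi M ->
    t \in irr_constt ('Res[N] chi) -> mx_irreducible s -> reduces 'chi_t s ->
    constt_repr (subg_repr M (normal_sub nsNG)) s.
  move=> irr_chi red ct irr_s red_s.
  by apply: (reduces_constt setup _ ct (reduces_sub _ red) red_s irr_s); rewrite cfRes_char ?irrWchar.
have Ms1 := over _ _ _ _ irr1 red1 ct1 irr_s1 redt1.
have Ms2 := over _ _ _ _ irr2 red2 ct2 irr_s2 redt2.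
have irrJ g (Gg : g \in G) :
    mx_irreducible (subg_repr (conj_repr s1 (subsetP (normal_norm nsNG) g Gg)) (subxx N)).
  apply: (mx_rsim_irr _ (conj_repr_irr (subsetP (normal_norm nsNG) g Gg) irr_s1)).
  by exists 1%:M => // [|x _]; rewrite ?row_free_unit ?unitmx1 // mul1mx mulmx1.
(* Used with [D] equal to [N], where it says that two constituents of [M] on [N] are conjugate. *)
have [g [Gg sim_g]] := Clifford_Res_constt irr_s1 irrM Ms1 irrJ irr_s2 Ms2.
have nNg := subsetP nNG g Gg; have G0g := subsetP sGG0 g Gg.
have Dt21 : ('chi_t1 ^ g)%CF = 'chi_t2.
  apply: (stable_factored_inj sNG0 cR sylN _ sft2 _ redt2 sim_g).
    exact: stable_factored_conj G0g (is_conj_cfConjg _ nNg) sft1.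
  by rewrite -[('chi_t1 ^ g)%CF]cfRes_id; apply/reduces_sub/reduces_conj.
have cg : is_conj g^-1 'chi_t2 'chi_t1.
  by apply: is_conj_sym; rewrite -Dt21; apply: is_conj_cfConjg.
have GgV : (g^-1)%g \in G by rewrite groupV.
have DG : G :=: (G :^ g^-1)%g by rewrite conjGid.
have DT := is_conj_Inertia DG cg.
have [psi2' cpsi] := is_conj_exists_to psi2 (DT : ('I_G['chi_t1])%G :=: _).
have sNT : N \subset ('I_G['chi_t1])%G := sub_Inertia _ sNG.
have irr_psi2' := is_conj_irr DT cpsi irr_psi2.
have dot2' : '['Res[N] psi2', 'chi_t1] != 0.
  by rewrite (is_conj_dot (is_conj_Res DT (proj1 cg) (sub_Inertia _ sNG) cpsi) cg).
have Ind2' : 'Ind[G] psi2' = chi2.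
  apply: is_conj_unique (is_conj_id chi2 GgV); rewrite -{1}Ind2.
  exact: is_conj_Ind (subsetIl _ _) DG cpsi.
have [W2' [gamma2' [nuc2c cgam]]] := nucleus_conj nuc2' cpsi.
pose R' := (R :^ g^-1)%G; have cR' : conjQ R' by apply: (conjQ_conj (groupVr G0g) _ cR).
have sylW2' : (p.-Sylow(W2') R')%g.
  by move: sylW2; rewrite (proj1 cgam) /= pHallJ2.
have sf2' : stable_factored gamma2' := stable_factored_conj (groupVr G0g) cgam sf2.
have [[m1 [r1 [irr_r1 red_r1 vs1]]] _ _] := nucleus_reduction nuc1 sTG0 cR sylW1 sf1.
have [[m2 [r2 [irr_r2 red_r2 vs2]]] _ _] := nucleus_reduction nuc2c sTG0 cR' sylW2' sf2'.
have sTG : ('I_G['chi_t1])%G \subset G := subsetIl _ _.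
have [Mr1 r1s] := Clifford_reduces sTG sNT irr_psi1 dotpsi1 Ind_psi1 irr_r1 irr_s1 red1 red_r1 redt1.
have [Mr2 r2s] := Clifford_reduces sTG sNT irr_psi2' dot2' Ind2' irr_r2 irr_s1 red2 red_r2 redt1.
have DT1 : ('I_G['chi_t1] = 'I_G['chi_a1])%g by rewrite Dt1; apply: stable_inertia cR sylN ext1.
have iT := special_inertia nsNG (T := ('I_G['chi_t1])%G) psN spa1 irr_s1 reda1 DT1.
have [m0 [r0 [_ _ _ _ uniq]]] := Clifford_correspondence sTG sNT irr_s1 iT irrM Ms1.
have sim12 : mx_rsim r1 r2.
  exact: (mx_rsim_trans (uniq _ _ irr_r1 Mr1 r1s) (mx_rsim_sym (uniq _ _ irr_r2 Mr2 r2s))).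
(* Carrying [psi2] over to the inertia group of [chi_t1] has replaced [R] by [R']. Both are vertices
   of the same module, so an element of the inertia group moves [R'] back to [R], as the induction
   hypothesis requires. *)
have vR' : is_vertex r1 R'.
  exact: (vertex_source_vertex p_pr pF (vertex_source_rsim (mx_rsim_sym sim12) vs2) sylW2').
have [x Tx DR] := vertex_source_conj p_pr pF vs1 sylW1 vR'.
have G0x := subsetP sTG0 x Tx.
have [W3 [gamma3 [nuc3 cgam3]]] := nucleus_conj nuc2c (is_conj_id psi2' Tx).
have sylW3 : (p.-Sylow(W3) R)%g by rewrite (proj1 cgam3) DR /= pHallJ2.
have sf3 := stable_factored_conj G0x cgam3 sf2'.
rewrite -Ind_psi1 -Ind2'; congr ('Ind[G] _).
exact: (IH sTG0 R cR sylW1 sf1 psi2' W3 gamma3 nuc3 sylW3 sf3 m1 r1 irr_r1 red_r1 (reduces_rsim (mx_rsim_sym sim12) red_r2)).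
Qed.

(** * Lifting an irreducible module to a character with given vertex *)

Definition p'dim_constt G n (M : mx_representation F G n) N := exists nsNG : (N <| G)%g,
  exists d (s : mx_representation F N d),
  [/\ mx_irreducible s, constt_repr (subg_repr M (normal_sub nsNG)) s & ~~ (p %| d)%N].

Lemma normal_constt_exists G N (nsNG : (N <| G)%g) n (M : mx_representation F G n) : mx_irreducible M ->
  exists d (s : mx_representation F N d),
    mx_irreducible s /\ constt_repr (subg_repr M (normal_sub nsNG)) s.
Proof.
move=> irrM; have [U simU] := Clifford_simple_exists nsNG irrM.
exists (\rank U), (submod_repr (mxsimple_module simU)); split; first by apply/submod_mx_irr.
by move=> a E; rewrite gring_mx_submod E mulmx0 linear0.
Qed.

Lemma normal_constt_chain G N L (nsNG : (N <| G)%g) (nsLG : (L <| G)%g) (nsNL : (N <| L)%g)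
    n (M : mx_representation F G n) d (s : mx_representation F N d) :
    mx_irreducible M -> mx_irreducible s -> constt_repr (subg_repr M (normal_sub nsNG)) s ->
  exists m (r : mx_representation F L m) g (Gg : g \in G),
    [/\ mx_irreducible r, constt_repr (subg_repr M (normal_sub nsLG)) r &
        constt_repr (subg_repr r (normal_sub nsNL)) (conj_repr s (subsetP (normal_norm nsNG) g Gg))].
Proof.
move=> irrM irr_s Ms; have [m [r [irr_r Mr]]] := normal_constt_exists nsLG irrM.
have [d0 [s0 [irr_s0 rs0]]] := normal_constt_exists nsNL irr_r.
have Ms0 : constt_repr (subg_repr M (normal_sub nsNG)) s0.
  move=> a; rewrite -(gring_mx_subg_trans (normal_sub nsNL) (normal_sub nsLG)).
  by move/(constt_repr_sub (sHG := normal_sub nsNL) Mr); apply: rs0.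
have sim g (Gg : g \in G) :
    mx_rsim (conj_repr s (subsetP (normal_norm nsNG) g Gg))
            (subg_repr (conj_repr s (subsetP (normal_norm nsNG) g Gg)) (subxx N)).
  by exists 1%:M => // [|x _]; rewrite ?row_free_unit ?unitmx1 // mul1mx mulmx1.
have irrJ g (Gg : g \in G) :
    mx_irreducible (subg_repr (conj_repr s (subsetP (normal_norm nsNG) g Gg)) (subxx N)).
  exact: (mx_rsim_irr (sim g Gg) (conj_repr_irr _ irr_s)).
have [g [Gg sim_g]] := Clifford_Res_constt irr_s irrM Ms irrJ irr_s0 Ms0.
exists m, r, g, Gg; split=> //; apply: constt_repr_trans rs0 _; apply: constt_repr_rsim.
exact: (mx_rsim_sym (mx_rsim_trans (sim g Gg) sim_g)).
Qed.

Lemma p'dim_constt_1 G n (M : mx_representation F G n) : mx_irreducible M -> p'dim_constt M 1%G.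
Proof.
move=> irrM; exists (normal1 G); have [d [s [irr_s Ms]]] := normal_constt_exists (normal1 G) irrM.
exists d, s; split=> //; have [i red] := p'group_irr_lift setup (pgroup1 gT p^') irr_s.
have lini : 'chi_i \is a linear_char by apply: (elimT (char_abelianP _)); apply: abelian1.
have := reduces_deg setup red; rewrite lin_char1 // => /eqP; rewrite eq_sym pnatr_eq1 => /eqP->.
by rewrite dvdn1 neq_ltn prime_gt1 ?orbT.
Qed.

Lemma p'dim_constt_p' G N L n (M : mx_representation F G n) : mx_irreducible M -> (L <| G)%g -> (N <| L)%g ->
  (p^'.-group (L / N))%g -> p'dim_constt M N -> p'dim_constt M L.
Proof.
move=> irrM nsLG nsNL p'LN [nsNG [d [s [irr_s Ms p'd]]]].
have [m [r [g [Gg [irr_r Mr rs]]]]] := normal_constt_chain nsLG nsNL irrM irr_s Ms.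
exists nsLG, m, r; split=> //.
apply: (p'_quotient_p'dim p_pr pF irr_r (conj_repr_irr _ irr_s) rs _ p'd).
by apply: p'nat_not_dvd; rewrite -?card_quotient ?normal_norm.
Qed.

(** A conjugate of [chi_a] has a special extension to [L]; over the p-quotient [L / N] there is only
    one irreducible above its reduction, so the constituent of [M] on [L] is the reduction of that
    extension. *)
Lemma p'dim_constt_p G N L n (M : mx_representation F G n) (a : Iirr N) d (s : mx_representation F N d)
    (nsNG : (N <| G)%g) : p_solvable p G -> mx_irreducible M -> (L <| G)%g -> (N <| L)%g -> (p.-group (L / N))%g ->
    special 'chi_a -> mx_irreducible s -> reduces 'chi_a s ->
    constt_repr (subg_repr M (normal_sub nsNG)) s -> (L \subset 'I['chi_a])%g ->
  p'dim_constt M L.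
Proof.
move=> psG irrM nsLG nsNL pLN spa irr_s red Ms sLI.
have [m [r [g [Gg [irr_r Mr rs]]]]] := normal_constt_chain nsLG nsNL irrM irr_s Ms.
exists nsLG, m, r; split=> //; have psL := p_solvable_sub psG (normal_sub nsLG).
have nNg := subsetP (normal_norm nsNG) g Gg.
have /irrP[b Db] : ('chi_a ^ g)%CF \in irr N by rewrite cfConjg_irr ?mem_irr.
have spb : special 'chi_b by rewrite -Db; apply: is_conj_special (is_conj_cfConjg _ nNg) spa.
have sLb : (L \subset 'I['chi_b])%g by rewrite -Db; apply: inertia_conjg nsNG nsLG sLI Gg.
have [c [spc Rc]] := special_extend_pgroup p_pr psL nsNL pLN spb sLb.
have [k [R red_R]] := reduces_exists setup (irr_char c).
have irrR := special_reduces_irr setup psL spc red_R.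
have redb : reduces 'chi_b (conj_repr s (subsetP (normal_norm nsNG) g Gg)).
  by rewrite -Db; apply: reduces_conj red.
have irr_sg := conj_repr_irr (subsetP (normal_norm nsNG) g Gg) irr_s.
have Rs : constt_repr (subg_repr R (normal_sub nsNL)) (conj_repr s (subsetP (normal_norm nsNG) g Gg)).
  apply: (reduces_constt setup (i := b) _ _ (reduces_sub _ red_R) redb irr_sg).
    by rewrite cfRes_char ?irr_char.
  by rewrite Rc irr_consttE cfnorm_irr oner_eq0.
have [_ Dm _ _] := p_quotient_irr_rsim pF pLN irr_sg irr_r irrR rs Rs; rewrite Dm.
have [k' p'k Dk] := special_deg spc; apply: (p'nat_not_dvd p_pr).
by have /eqP := reduces_deg setup red_R; rewrite Dk eqr_nat => /eqP<-.
Qed.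

(** The constructor ties the type of [psi] to the inertia group of [chi_t], whereas the modular
    Clifford theory is done in that of the special factor [chi_a]; the equation on [T] bridges the
    two. *)
Lemma nucleus_step G N T (chi : 'CF(G)) (t : Iirr N) (psi : 'CF(T)) W (gamma : 'CF(W)) :
    T :=: ('I_G['chi_t])%g -> chi \in irr G -> ~ pi_factored p^' chi ->
    (N <| G)%g -> constt_factored p^' N chi ->
    (forall M, (M <| G)%g -> constt_factored p^' M chi -> (M \subset N)%g) ->
    t \in irr_constt ('Res[N] chi) -> psi \in irr T -> '['Res[N] psi, 'chi_t] != 0 ->
    'Ind[G] psi = chi -> normal_nucleus p^' psi gamma ->
  normal_nucleus p^' chi gamma.
Proof.
move=> DT; have {}DT : T = ('I_G['chi_t])%G by apply: group_inj.
by subst T; apply: NNucleus_step.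
Qed.

Lemma inertia_Ind_irr G N T (t : Iirr N) (psi : 'CF(T)) : (N <| G)%g -> T :=: ('I_G['chi_t])%g ->
  psi \in irr T -> '['Res[N] psi, 'chi_t] != 0 -> 'Ind[G] psi \in irr G.
Proof.
move=> nsNG DT; have {}DT : T = ('I_G['chi_t])%G by apply: group_inj.
subst T => /irrP[j ->] dotpsi; have [irrI _ _ _ _] := constt_Inertia_bijection t nsNG.
by apply: irrI; rewrite constt_Ind_Res irr_consttE.
Qed.

Lemma constt_mul_sub G (phi chi : 'CF(G)) a b i : phi \is a character -> chi \is a character ->
    a \in irr_constt phi -> b \in irr_constt chi -> i \in irr_constt ('chi_a * 'chi_b) ->
  i \in irr_constt (phi * chi).
Proof.
move=> Nphi Nchi /(constt_charP a Nphi)[r1 N1 ->] /(constt_charP b Nchi)[r2 N2 ->] ci.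
have Nab : 'chi_a * 'chi_b \is a character by rewrite rpredM ?irr_char.
have [r3 N3 E] := constt_charP i Nab ci.
apply/constt_charP; first by rewrite rpredM ?rpredD ?irr_char.
exists (r3 + 'chi_a * r2 + r1 * ('chi_b + r2)); first by rewrite !rpredD ?rpredM ?rpredD ?irr_char.
by rewrite mulrDl mulrDr E -!addrA.
Qed.

(* The coprime cancellation lemma forces the p-special factor to lie over the stable extension. *)
Lemma stable_pFactor K D R (alpha beta : 'CF(K)) (mu : 'CF(D)) xi : K \subset G0 -> (D <| K)%g -> conjQ R ->
    sylow_in R D -> special alpha -> pi_special (p^')^' beta -> stab mu ->
    (forall w, w \in irr_constt ('Res[D] (alpha * beta)) -> stable_factored 'chi_w) ->
    xi \in irr_constt ('Res[D] beta) -> 'chi_xi = mu.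
Proof.
move=> sKG0 nsDK cR sylD spa spb ext sfD cxi; have sDG0 := subset_trans (normal_sub nsDK) sKG0.
have [[irr_a _ _] [irr_b _ _]] := (spa, spb).
have [Na Nb] := (irrWchar irr_a, irrWchar irr_b).
have /irrP[i Di] := irr_a; have [v cv] := constt_cfRes_irr D i; rewrite -Di in cv.
have [|w cw] := @neq0_has_constt _ _ ('chi_v * 'chi_xi).
  apply/eqP => /(congr1 (fun f : 'CF(D) => f 1%g)); rewrite !cfunE => /eqP.
  by rewrite mulf_eq0 !(negPf (irr1_neq0 _)).
have cwD : w \in irr_constt ('Res[D] (alpha * beta)).
  by rewrite rmorphM /=; apply: constt_mul_sub cv cxi cw; rewrite cfRes_char.
have [a [mu' [sp_a ext' Dw]]] := sfD w cwD.
rewrite (stable_ext_eq sDG0 cR sylD ext' ext) in Dw.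
have [linmu _] := ext; have unitmu := lin_char_unitr linmu.
have linV : mu^-1 \is a linear_char by rewrite rpredV.
have ca : a \in irr_constt (mu^-1 * ('chi_v * 'chi_xi)).
  apply: constt_mul_lin linV _ cw _; first by rewrite rpredM ?irr_char.
  by rewrite Dw mulrCA mulVr ?mulr1.
have ordV : (p^')^'.-nat #[mu^-1]%CF.
  apply: (cforder_dvd_pnat (k := #[mu]%CF)); first by rewrite exprVn exp_cforder invr1.
  by rewrite (pnatNK p); exact: (stable_ext_order pQ lin_delta sDG0 cR sylD ext).
have spV := special_mul_lin linV ordV (special_Res nsDK spb cxi).
have : mu^-1 * 'chi_xi = 1.
  apply: (special_pi_cancel p_pr (p_solvable_sub psG0 sDG0) sp_a (special_Res nsDK spa cv) spV).
  by rewrite mulrCA -irr_consttE.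
by move/(congr1 (fun f => mu * f)); rewrite mulrA mulrV // mul1r mulr1.
Qed.

(** The p-regular elements of [E] already lie in [D], where all constituents of [beta] equal the
    stable extension, which is 1 on them. *)
Lemma stable_pFactor_const K D E R (alpha beta : 'CF(K)) x : K \subset G0 -> (D <| K)%g -> conjQ R ->
    sylow_in R D -> special alpha -> pi_special (p^')^' beta ->
    (forall w, w \in irr_constt ('Res[D] (alpha * beta)) -> stable_factored 'chi_w) ->
    (D <| E)%g -> (p.-group (E / D))%g -> x \in E -> (p^'.-elt x)%g ->
  beta x = beta 1%g.
Proof.
move=> sKG0 nsDK cR sylD spa spb sfD nsDE pED Ex p'x; have sDG0 := subset_trans (normal_sub nsDK) sKG0.
have Dx := pi'_elt_quotient nsDE pED Ex p'x.
have [mu ext] := stable_ext_exists pQ lin_delta stable sDG0 cR sylD.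
have [linmu _] := ext.
rewrite -(cfResE beta (normal_sub nsDK) Dx) -(cfRes1 D) {1 2}(cfun_sum_constt ('Res[D] beta)) !sum_cfunE.
apply: eq_bigr => xi cxi; rewrite !cfunE (stable_pFactor sKG0 nsDK cR sylD spa spb ext sfD cxi).
by rewrite (stable_ext_pRegular lin_delta sDG0 ext) // lin_char1.
Qed.

(** Look at a chief layer [E] over [K :&: N] inside [K], and at its join [L] with [N]. A p'-layer
    keeps a constituent of dimension prime to p on [L]. For a p-layer, factoredness on [K] gives [M]
    such a constituent on [E], so [R :&: E] is Sylow in [E]; then [L] lies in [N R], fixes [chi_a],
    and again [L] contradicts the choice of [N]. *)
Lemma p'dim_max_factored G N R n (M : mx_representation F G n) (i : Iirr G) (a : Iirr N) d
    (s : mx_representation F N d) (nsNG : (N <| G)%g) : G \subset G0 -> mx_irreducible M -> reduces 'chi_i M ->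
    conjQ R -> rel_proj M R -> sylow_in R N -> special 'chi_a -> mx_irreducible s -> reduces 'chi_a s ->
    constt_repr (subg_repr M (normal_sub nsNG)) s -> ~~ (p %| d)%N -> (R \subset 'I['chi_a])%g ->
    (forall L, N \proper L -> ~ p'dim_constt M L) ->
    (forall u, u \in irr_constt ('Res[N] 'chi_i) -> stable_factored 'chi_u) ->
  forall K, (K <| G)%g -> constt_factored p^' K 'chi_i -> K \subset N.
Proof.
move=> sGG0 irrM redM cR projR sylN spa irr_s red_s Ms p'd sRI maxN sfN K nsKG facK.
apply/negPn/negP=> nsKN; have psG := p_solvable_sub psG0 sGG0.
have sNG0 := subset_trans (normal_sub nsNG) sGG0; have sKG := normal_sub nsKG.
pose D := (K :&: N)%G; have nsDG : (D <| G)%g by apply: normalI.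
have prDK : D \proper K by rewrite properE subsetIl subsetI subxx.
have [E [nsEG prDE sEK idx]] := chief_layer psG nsDG nsKG prDK.
have sEG := normal_sub nsEG; have sDE := proper_sub prDE.
have nsDE : (D <| E)%g := normalS sDE sEG nsDG.
pose L := (E <*> N)%G; have nsLG : (L <| G)%g by apply: normalY.
have nNE : (E \subset 'N(N))%g := subset_trans sEG (normal_norm nsNG).
have nsNL : (N <| L)%g := normalS (joing_subr E N) (normal_sub nsLG) nsNG.
have prNL : N \proper L.
  rewrite properE joing_subr; apply: contra (proper_subn prDE) => sLN.
  by rewrite subsetI sEK (subset_trans (joing_subl E N)).
have DE : (N :&: E = D)%g.
  by apply/eqP; rewrite eqEsubset !subsetI subsetIl subsetIr sDE (subset_trans (subsetIr _ _) sEK).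
have pLN pi : (pi.-group (E / D))%g -> (pi.-group (L / N))%g.
  by rewrite quotientYidr // /pgroup -(card_isog (second_isog nNE)) DE.
case/orP: idx => [pED|p'ED]; last first.
  apply: (maxN L prNL); apply: (p'dim_constt_p' irrM nsLG nsNL (pLN _ p'ED)).
  by exists nsNG, d, s.
have sylD : sylow_in R D.
  by apply: sylow_setI_normal sylN; apply: normalS (subsetIr K N) (normal_sub nsNG) nsDG.
have [k ck] := constt_cfRes_irr K i; have [_ [beta [alpha [sp_alpha sp_beta Dk]]]] := facK k ck.
have nsDK : (D <| K)%g := normalS (subsetIl K N) sKG nsDG.
have sfD w : w \in irr_constt ('Res[D] (alpha * beta)) -> stable_factored 'chi_w.
  rewrite -Dk => cw; have cwi := constt_Res_below (subsetIl K N) sKG (irr_char i) ck cw.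
  have [u cu cwu] := constt_Res_above (subsetIr K N) (normal_sub nsNG) (irr_char i) cwi.
  exact: (stable_factored_below sNG0 (normalS (subsetIr K N) (normal_sub nsNG) nsDG) (sfN u cu) cwu).
have sKG0 := subset_trans sKG sGG0.
have beta_const x := stable_pFactor_const (x := x) sKG0 nsDK cR sylD sp_alpha sp_beta sfD nsDE pED.
have [[irr_alpha _ _] [irr_beta _ _]] := (sp_alpha, sp_beta).
have /natrP[e De] : beta 1%g \is a Num.nat by have /irrP[b ->] := irr_beta; apply: Cnat_irr1.
have NresK : 'Res[K] 'chi_i \is a character by rewrite cfRes_char ?irr_char.
have [rest Nrest Drest] := constt_charP k NresK ck.
have /irrP[j Dj] := irr_alpha; have [l cl] := constt_cfRes_irr E j; rewrite -Dj in cl.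
have Nal : 'Res[E] alpha \is a character by rewrite cfRes_char ?irrWchar.
(* On [E] this agrees with [chi_i] at p-regular elements, where [beta] is constantly [e]; so [M]
   reduces [chi'] as well, and the constituents of [alpha], which are special, show up in [M]. *)
pose chi' := 'Res[E] alpha *+ e + 'Res[E] rest.
have Nchi' : chi' \is a character by rewrite rpredD ?rpredMn // cfRes_char.
have red' : reduces chi' (subg_repr M sEG).
  move=> x Ex p'x; have Kx := subsetP sEK x Ex.
  have -> : chi' x = alpha x * e%:R + rest x by rewrite cfunE -scaler_nat cfunE !cfResE // mulrC.
  rewrite (reduces_sub sEG redM) // -(cfResRes _ sEK sKG) cfResE // Drest Dk !cfunE.
  by rewrite beta_const // De.
have cl' : l \in irr_constt chi'.
  have e_gt0 : (0 < e)%N.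
    have /irrP[b Db] := irr_beta; rewrite lt0n; apply: contraNneq (irr1_neq0 b) => e0.
    by rewrite -Db De e0.
  have [r1 N1 E1] := constt_charP l Nal cl; apply/constt_charP; first by [].
  exists (r1 + ('Res[E] alpha *+ e.-1 + 'Res[E] rest)).
    by rewrite !rpredD ?rpredMn // cfRes_char.
  by rewrite /chi' -{1}(prednK e_gt0) mulrS {1}E1 -!addrA.
have nsEK : (E <| K)%g := normalS sEK sKG nsEG.
have spl := special_Res nsEK sp_alpha cl.
have psE := p_solvable_sub psG sEG.
have [m [r red_r]] := reduces_exists setup (irr_char l).
have irr_r := special_reduces_irr setup psE spl red_r.
have Mr := reduces_constt setup Nchi' cl' red' red_r irr_r.
have p'm : ~~ (p %| m)%N.
  have [m' p'm' Dm] := special_deg spl; apply: (p'nat_not_dvd p_pr).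
  by have /eqP := reduces_deg setup red_r; rewrite Dm eqr_nat => /eqP<-.
have [P sylP] := Sylow_exists p E.
rewrite (bool_irrelevance sEG (normal_sub nsEG)) in Mr.
have sylE := vertex_normal_sylow p_pr pF irrM irr_r Mr p'm projR (conjQ_pgroup cR) sylP.
have sylL := sylow_join nsEG nsNG (conjQ_pgroup cR) sylE sylN.
apply: (maxN L prNL); apply: (p'dim_constt_p psG irrM nsLG nsNL (pLN _ pED) spa irr_s red_s Ms).
apply: subset_trans (sylow_p_quotient nsNL (pLN _ pED) sylL) _.
by rewrite mul_subG ?sub_inertia.
Qed.

(** [W] is found from [M] alone, before any Sylow subgroup is mentioned: that a Sylow p-subgroup of
    [W] is conjugate to [Q] is learned only afterwards, from the vertex of [M]. The character needs
    it, since the stable extension does. *)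
Theorem nucleus_exists G n (M : mx_representation F G n) : G \subset G0 -> mx_irreducible M ->
  exists W, vertex_source M W /\ forall R, (p.-Sylow(W) R)%g -> conjQ R ->
    exists (chi : 'CF(G)) (gamma : 'CF(W)),
      [/\ normal_nucleus p^' chi gamma, stable_factored gamma & reduces chi M].
Proof.
have [k] := ubnP #|G|; elim: k G n M => // k IHk G n M /ltnSE-le_k sGG0 irrM.
have psG := p_solvable_sub psG0 sGG0.
pose P (N : {group gT}) := boolp.asbool (p'dim_constt M N).
have P1 : P 1%G by apply/boolp.asboolP; apply: p'dim_constt_1.
case: (arg_maxnP (fun N : {group gT} => #|N|) P1) => N /boolp.asboolP p'N maxN.
have {}maxN L : N \proper L -> ~ p'dim_constt M L.
  by move=> prNL /boolp.asboolP PL; have := maxN L PL; rewrite /= leqNgt proper_card.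
have [nsNG [d [s [irr_s Ms p'd]]]] := p'N; have [sNG nNG] := andP nsNG.
have sNG0 := subset_trans sNG sGG0; have psN := p_solvable_sub psG0 sNG0.
have [alpha [spa red_s]] := p'dim_special_lift setup psN irr_s p'd.
have [/irrP[a Da] _ _] := spa; rewrite Da in spa red_s.
have [T DT] : exists T : {group gT}, T :=: ('I_G['chi_a])%g by exists ('I_G['chi_a])%G.
have sTG : T \subset G by rewrite DT subsetIl.
have sNT : N \subset T by rewrite DT sub_Inertia.
have iT := special_inertia nsNG psN spa irr_s red_s DT.
have [GT|nGT] := boolP (G \subset T).
  have sGI : (G \subset 'I['chi_a])%g by apply: subset_trans GT _; rewrite DT subsetIr.
  have eqNG : N = G.
    apply/group_inj/eqP; rewrite eqEproper sNG; apply/negP=> prNG.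
    have [E [nsEG prNE _ /orP idx]] := chief_layer psG nsNG (normal_refl G) prNG.
    have nsNE : (N <| E)%g := normalS (proper_sub prNE) (normal_sub nsEG) nsNG.
    apply: (maxN E prNE); case: idx => [pEN|p'EN]; last exact: (p'dim_constt_p' irrM nsEG nsNE p'EN p'N).
    apply: (p'dim_constt_p psG irrM nsEG nsNE pEN spa irr_s red_s Ms).
    exact: subset_trans (normal_sub nsEG) sGI.
  subst N; exists G; have irrM' : mx_irreducible (subg_repr M (normal_sub nsNG)).
    by apply: (mx_rsim_irr _ irrM); exists 1%:M => // [|x _]; rewrite ?row_free_unit ?unitmx1 // mul1mx mulmx1.
  have [B eqn freeB hom] := constt_repr_irr irrM' irr_s Ms.
  have sim : mx_rsim M s by exists B.
  have p'n : ~~ (p %| n)%N by rewrite eqn.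
  split; first exact: (p'dim_vertex_source pF).
  move=> R sylR cR; have sylG : sylow_in R G by rewrite (setIidPl (pHall_sub sylR)).
  have [mu ext] := stable_ext_exists pQ lin_delta stable sGG0 cR sylG.
  have [linmu _] := ext; exists ('chi_a * mu), ('chi_a * mu); split.
  - apply: NNucleus_factored; split; first by rewrite mulrC mul_lin_irr ?mem_irr.
    by exists mu, 'chi_a; split=> //; exact: (stable_ext_special pQ lin_delta sGG0 cR sylG ext).
  - by exists a, mu.
  apply: stable_factored_reduces => //; exact: reduces_rsim (mx_rsim_sym sim) red_s.
have [m [r [[irr_r _] Mr rs [vsM _] _]]] := Clifford_correspondence sTG sNT irr_s iT irrM Ms.
have ltT : (#|T| < k)%N by apply: leq_trans le_k; rewrite proper_card // properE sTG.
have sTG0 := subset_trans sTG sGG0.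
have [W [vsW IHW]] := IHk T m r ltT sTG0 irr_r; exists W; split; first exact: vsM.
move=> R sylR cR; have [psi [gamma [nuc sf red_r]]] := IHW R sylR cR; exists ('Ind[G] psi), gamma.
have [projR _] := vertex_source_vertex p_pr pF (vsM W vsW) sylR.
have [P0 sylP] := Sylow_exists p N.
have sylN := vertex_normal_sylow p_pr pF irrM irr_s Ms p'd projR (conjQ_pgroup cR) sylP.
have [mu ext] := stable_ext_exists pQ lin_delta stable sNG0 cR sylN; have [linmu _] := ext.
have /irrP[t Dt] : mu * 'chi_a \in irr N by rewrite mul_lin_irr ?mem_irr.
rewrite mulrC in Dt; have sft : stable_factored 'chi_t by exists a, mu.
have red_t : reduces 'chi_t s by rewrite -Dt; apply: stable_factored_reduces.
have DTt : T :=: ('I_G['chi_t])%g by rewrite -Dt (stable_inertia _ sGG0 nsNG cR sylN ext).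
have nsNT : (N <| T)%g := normalS sNT sTG nsNG.
have [irr_psi _] := nucleus_irr nuc; have /irrP[j Dj] := irr_psi.
have [_ sfK _] := nucleus_reduction nuc sTG0 cR sylR sf.
have sRT := subset_trans (pHall_sub sylR) (nucleus_sub nuc).
(* A constituent [chi_u] of [psi] reduces to a constituent of [r] on [N]. All of these are
   [T]-conjugate to [s], which [T] fixes, so [chi_u] and [chi_t] have the same reduction and
   coincide. *)
have dotpsi : '['Res[N] psi, 'chi_t] != 0.
  rewrite -irr_consttE; have [u cu] := constt_cfRes_irr N j; rewrite -Dj in cu.
  suff -> : t = u by [].
  have sfu := sfK N nsNT sylN u cu; have [b [mu' [spb ext' Du]]] := sfu.
  have [d' [s' red_b]] := reduces_exists setup (irr_char b).
  have irr_s' := special_reduces_irr setup psN spb red_b.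
  have red_u : reduces 'chi_u s' by rewrite Du; apply: stable_factored_reduces.
  have rs' : constt_repr (subg_repr r (normal_sub nsNT)) s'.
    by apply: (reduces_constt setup _ cu (reduces_sub _ red_r) red_u irr_s'); rewrite cfRes_char ?irrWchar.
  rewrite (bool_irrelevance sNT (normal_sub nsNT)) in rs.
  have sim g (Tg : g \in T) : mx_rsim s
      (subg_repr (conj_repr s (subsetP (normal_norm nsNT) g Tg)) (subxx N)).
    have Gg := subsetP sTG g Tg; apply: mx_rsim_trans (mx_rsim_sym ((iT g Gg).1 Tg)) _.
    rewrite (bool_irrelevance (subsetP (normal_norm nsNG) g Gg) (subsetP (normal_norm nsNT) g Tg)).
    by exists 1%:M => // [|x _]; rewrite ?row_free_unit ?unitmx1 // mul1mx mulmx1.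
  have [g [Tg sim']] := Clifford_Res_constt irr_s irr_r rs (fun g Tg => mx_rsim_irr (sim g Tg) irr_s) irr_s' rs'.
  apply: irr_inj; apply: (stable_factored_inj sNG0 cR sylN sft sfu red_t red_u).
  exact: mx_rsim_trans (sim g Tg) sim'.
have irr_chi := inertia_Ind_irr nsNG DTt irr_psi dotpsi; have /irrP[i Di] := irr_chi.
have [n' [M' [irrM' redM' Mr']]] := Clifford_Ind_reduces sTG sNT irr_psi dotpsi irr_r irr_s red_r red_t iT.
have simM := Clifford_rsim irr_s iT irrM' irrM irr_r rs Mr' Mr.
have redM : reduces ('Ind[G] psi) M := reduces_rsim simM redM'.
have ct : t \in irr_constt ('Res[N] ('Ind[G] psi)).
  rewrite Dj in dotpsi *; apply: (constt_Res_below sNT sTG (j := j)); rewrite ?cfInd_char ?irr_char //.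
  rewrite irr_consttE cfdotC Frobenius_reciprocity fmorph_eq0 cfnorm_eq0.
  by rewrite cfInd_eq0 ?irr_char // irr_neq0.
have sfN u : u \in irr_constt ('Res[N] ('Ind[G] psi)) -> stable_factored 'chi_u.
  rewrite Di in ct * => cu; have [g Gg Du] := constt_Res_conj nsNG ct cu.
  rewrite Du; exact: (stable_factored_conj (subsetP sGG0 g Gg) (is_conj_cfConjg _ (subsetP nNG g Gg)) sft).
have sRI : (R \subset 'I['chi_a])%g by apply: subset_trans sRT _; rewrite DT subsetIr.
have maxF K : (K <| G)%g -> constt_factored p^' K ('Ind[G] psi) -> K \subset N.
  rewrite Di in redM sfN *.
  exact: (p'dim_max_factored sGG0 irrM redM cR projR sylN spa irr_s red_s Ms p'd sRI maxN sfN).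
split=> //; apply: (nucleus_step (psi := psi) DTt irr_chi _ nsNG _ maxF ct) => //.
  move=> fac; case/negP: nGT; apply: (subset_trans _ sNT); apply: maxF => // l.
  by rewrite cfRes_id => cl; rewrite (irr_constt_self irr_chi cl).
move=> u cu; split; first exact: mem_irr.
have [b [mu' [spb ext' Du]]] := sfN u cu; exists mu', 'chi_b; split=> //.
exact: (stable_ext_special pQ lin_delta sNG0 cR sylN ext').
Qed.

(** The p-special factor of the nucleus restricts to the linear [delta], so it has degree 1 and
    p-power order; such an extension is the stable one. *)
Lemma navarro_vertexP G (chi : 'CF(G)) : G \subset G0 -> navarro_vertex p chi Q delta <->
  exists W (gamma : 'CF(W)),
    [/\ normal_nucleus p^' chi gamma, (p.-Sylow(W) Q)%g & stable_factored gamma].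
Proof.
move=> sGG0; have cQ : conjQ Q by exists 1%g; rewrite ?group1 ?conjsg1.
split=> [[W [gamma [nuc sylW [beta [[alpha [spa spb Dg]] Ddelta]]]]]|[W [gamma [nuc sylW [a [mu [spa ext Dg]]]]]]].
  have sWG0 := subset_trans (nucleus_sub nuc) sGG0.
  have [irr_b _ _] := spb.
  have linb : beta \is a linear_char.
    by rewrite qualifE /= irrWchar //= -(cfRes1 Q) -Ddelta lin_char1.
  have ordb : p.-nat #[beta]%CF.
    by have := special_order spb; rewrite /cfDet_order cfDet_id // (pnatNK p).
  have [irr_a _ _] := spa; have /irrP[a Da] := irr_a.
  exists W, gamma; split=> //; exists a, beta; rewrite -Da; split=> //.
  exact: stable_extP.
have sWG0 := subset_trans (nucleus_sub nuc) sGG0; have sQW := pHall_sub sylW.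
have sylQ : sylow_in Q W by rewrite (setIidPl sQW).
exists W, gamma; split=> //; exists mu; split.
  by exists 'chi_a; split=> //; exact: (stable_ext_special pQ lin_delta sWG0 cQ sylQ ext).
apply/esym/(stable_extE (p := p) (G0 := G0) pQ); exact: stable_ext_Res.
Qed.
End NavarroVertices.

Theorem theoremA (gT : finGroupType) (p : nat) (G Q : {group gT})
    (delta : 'CF(Q)) (F : closedFieldType) (lam : F -> algC) :
  prime p -> p \in [pchar F] -> brauer_lift p lam ->
  p_solvable p G -> (Q \subset G)%g -> (p.-group Q)%g ->
  delta \is a linear_char ->
  (forall x y : gT, x \in Q -> y \in Q -> (y \in x ^: G)%g ->
     delta x = delta y) ->
  [/\ forall i : Iirr G, navarro_vertex p 'chi_i Q delta ->
        IBr_vertex p lam G Q (pres p 'chi_i),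
      forall i j : Iirr G, navarro_vertex p 'chi_i Q delta ->
        navarro_vertex p 'chi_j Q delta ->
        pres p 'chi_i =1 pres p 'chi_j -> i = j &
      forall phi : gT -> algC, IBr_vertex p lam G Q phi ->
        exists2 i : Iirr G, navarro_vertex p 'chi_i Q delta &
          pres p 'chi_i =1 phi].
Proof.
move=> p_pr pF lamP psG sQG pQ lin_delta stable.
have setup : brauer_setup p lam by split.
have cQ : conjQ G Q Q by exists 1%g; rewrite ?group1 ?conjsg1.
have navP (i : Iirr G) := navarro_vertexP pQ lin_delta stable 'chi_i (subxx G).
have main i : navarro_vertex p 'chi_i Q delta -> exists n (M : mx_representation F G n) W,
    [/\ mx_irreducible M, reduces p lam 'chi_i M, vertex_source M W & (p.-Sylow(W) Q)%g].
  case/navP=> W [gamma [nuc sylW sf]].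
  have [[n [M [irrM red vs]]] _ _] :=
    nucleus_reduction setup pQ psG lin_delta stable nuc (subxx G) cQ sylW sf.
  by exists n, M, W.
have presE (i : Iirr G) n (M : mx_representation F G n) : reduces p lam 'chi_i M ->
    affords_brauer p lam M (pres p 'chi_i).
  move=> red x; rewrite /pres; case: (boolP (x \in G)) => [Gx|nGx] /=; last by rewrite cfun0 ?if_same.
  by case: ifP => // p'x; rewrite red.
split=> [i nav|i j nav_i nav_j eqp|phi [n [M [irrM aff vM]]]].
- have [n [M [W [irrM red vs sylW]]]] := main i nav; exists n, M; split=> //; first exact: presE.
  exact: (vertex_source_vertex p_pr pF vs sylW).
- have [n [M [_ [irrM red _ _]]]] := main i nav_i.
  have red' : reduces p lam 'chi_j M.
    by move=> x Gx p'x; have := eqp x; rewrite /pres p'x red.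
  have [[W1 [g1 [nuc1 syl1 sf1]]] [W2 [g2 [nuc2 syl2 sf2]]]] := ((navP i).1 nav_i, (navP j).1 nav_j).
  apply: irr_inj.
  exact: (nucleus_injective setup pQ psG lin_delta stable nuc1 (subxx G) cQ syl1 sf1 nuc2 syl2 sf2 irrM red red').
have [W [vs exW]] := nucleus_exists setup pQ psG lin_delta stable (subxx G) irrM.
have [R sylR] := Sylow_exists p W.
(* The Sylow subgroup of the nucleus found for [M] is only a conjugate of the given vertex [Q];
   conjugating the nucleus by [t^-1] fixes [chi] and brings the subgroup to [Q]. *)
have [t Gt DR] := vertex_source_conj p_pr pF vs sylR vM.
have [|chi [gamma [nuc sf red]]] := exW R sylR; first by exists t.
have GtV : (t^-1)%g \in G by rewrite groupV.
have [W' [gamma' [nuc' cg]]] := nucleus_conj nuc (is_conj_id chi GtV).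
have [/irrP[i Di] _] := nucleus_irr nuc; rewrite Di in nuc' red.
exists i.
  apply/navP; exists W', gamma'; split=> //; last exact: stable_factored_conj GtV cg sf.
  by move: sylR; rewrite (proj1 cg) DR -[gval Q in X in _ -> X](conjsgK t) pHallJ2.
by move=> x; rewrite (presE i n M red x) aff.
Qed.
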